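(* For each $n \in \mathbf{N}$, let $W_n = (w_{ij}^{(n)})_{i,j=1}^n$ be a random $n \times n$ Hermitian matrix whose upper triangular entries $w_{ij}^{(n)}$, $1 \le i \le j \le n$, are jointly independent, have mean zero, and have finite variances. Assume that $W_1, W_2, \ldots$ are defined on the same probability space. Suppose that \[ \lim_{n\to\infty} \frac{1}{n}\sum_{i=1}^n \biggl| \sum_{j=1}^n \Bigl( \operatorname{Var}\bigl[w_{ij}^{(n)}\bigr] - \frac{1}{n} \Bigr) \biggr| = 0, \] that there is some finite $C \ge 0$ such that \[ \lim_{n\to\infty} \frac{1}{n}\sum_{i=1}^n \biggl( \sum_{j=1}^n \operatorname{Var}\bigl[w_{ij}^{(n)}\bigr] - C \biggr)_+ = 0, \] and that for every $\epsilon>0$, \[ \lim_{n\to\infty} \frac{1}{n}\sum_{i,j=1}^n \mathbf{E}\bigl[\,|w_{ij}^{(n)}|^2\,\mathbf{1}(|w_{ij}^{(n)}|>\epsilon)\,\bigr] = 0. \] Then, almost surely, $\mu_{W_n} \Rightarrow \mu_{\mathrm{sc}}$ (weak convergence) as $n \to \infty$.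
   Context: Upper triangular entries include the diagonal. For an $n\times n$ Hermitian matrix $A$ with eigenvalues $\lambda_1(A)\ge\cdots\ge\lambda_n(A)$ (with multiplicity), the spectral distribution is $\mu_A := \frac1n\sum_{i=1}^n \delta_{\lambda_i(A)}$, a Borel probability measure on $\mathbf{R}$. A random $n\times n$ Hermitian matrix is a random element of the space of $n\times n$ Hermitian matrices, identified with $\mathbf{C}^{n(n-1)/2}\times\mathbf{R}^n$ with its Borel $\sigma$-algebra. For a complex random variable $w$, $\operatorname{Var}[w] = \mathbf{E}|w-\mathbf{E}w|^2$. $x_+ := \max\{x,0\}$. The semicircle distribution is $\mu_{\mathrm{sc}}(dx) = \frac{1}{2\pi}\sqrt{(4-x^2)_+}\,dx$. *)

(* Defs.v *)
From HB Require Import structures.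
From mathcomp Require Import all_boot all_order all_algebra.
From mathcomp Require Import all_classical all_reals all_analysis.
From mathcomp.real_closed Require Import complex.

Set Implicit Arguments.
Unset Strict Implicit.
Unset Printing Implicit Defensive.

Import Order.TTheory GRing.Theory Num.Theory.
Import numFieldNormedType.Exports.

Local Open Scope classical_set_scope.
Local Open Scope ring_scope.

Section Defs.
Context {R : realType}.

Definition cabs (z : R[i]) : R := Num.sqrt (complex.Re z ^+ 2 + complex.Im z ^+ 2).

Definition eigenvalues_spec (n : nat) (A : 'M[R[i]]_n) (s : 'I_n -> R) : Prop :=
  char_poly A = \prod_(i < n) ('X - (Complex (s i) 0)%:P) /\
  (forall i j : 'I_n, (i <= j)%N -> s j <= s i).

(* lambda_1(A) >= ... >= lambda_n(A); default 0 if A has non-real spectrum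
   (never the case for Hermitian A). *)
Definition eigenvalues (n : nat) (A : 'M[R[i]]_n) : 'I_n -> R :=
  match pselect (exists s, eigenvalues_spec A s) with
  | left h => projT1 (cid h)
  | right _ => fun=> 0
  end.

Definition esd_integral (n : nat) (A : 'M[R[i]]_n) (f : R -> R) : R :=
  n%:R^-1 * \sum_(i < n) f (eigenvalues A i).

Definition sc_density (x : R) : R :=
  (2 * pi)^-1 * Num.sqrt (Num.max (4 - x ^+ 2) 0).

Definition sc_integral (f : R -> R) : R :=
  Rintegral (@lebesgue_measure R) setT (fun x => f x * sc_density x).

Definition esd_weakly_to_sc (A : forall n, 'M[R[i]]_n) : Prop :=
  forall f : R -> R, continuous f -> (exists M, forall x, `|f x| <= M) ->
    (fun n => esd_integral (A n) f) @ \oo --> sc_integral f.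

Section Prob.
Context {d : measure_display} {T : measurableType d} (P : probability T R).

(* complex random variable: real and imaginary parts are measurable
   (Borel sigma-algebra of C = Borel of R^2 = product of Borel) *)
Definition cmeasurable (X : T -> R[i]) : Prop :=
  measurable_fun setT (fun w => complex.Re (X w)) /\ measurable_fun setT (fun w => complex.Im (X w)).

Definition cmean (X : T -> R[i]) : R[i] :=
  Complex (Rintegral P setT (fun w => complex.Re (X w))) (Rintegral P setT (fun w => complex.Im (X w))).

Definition cvar (X : T -> R[i]) : \bar R :=
  (\int[P]_w ((cabs (X w - cmean X)) ^+ 2)%:E)%E.

Definition cindependent (I : finType) (S : {set I}) (X : I -> T -> R[i]) : Prop :=
  forall (J : {set I}) (B : I -> set (R * R)%type),
    J \subset S -> (forall i, measurable (B i)) ->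
    P (\big[setI/setT]_(i in J) [set w | B i (complex.Re (X i w), complex.Im (X i w))]) =
    (\big[*%E/1%E]_(i in J) P [set w | B i (complex.Re (X i w), complex.Im (X i w))])%E.

End Prob.
End Defs.

(* Main.v *)
Require Import Defs.
From HB Require Import structures.
From mathcomp Require Import all_boot all_order all_algebra spectral sesquilinear.
From mathcomp Require Import all_classical all_reals all_analysis.
From mathcomp.real_closed Require Import complex.
From mathcomp Require Import measurable_realfun.
From mathcomp Require Import ring lra.

(* Work with the resolvent G = (W_n - z)^-1 at z = i eta, eta >= C + 1, and
   m = i m0 with m^2 + z m + 1 = 0. Put D_i = G_ii - m, let S_ij be the variance
   profile and s_i its row sums. From sum_j W_ij G_ji = 1 + z G_ii one gets
     (z + m) |D_i|^2 = sum_j (W_ij G_ji + S_ij G_ii G_jj) conj D_i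
       - (s_i - 1) m G_ii conj D_i - G_ii sum_j S_ij D_j conj D_i.
   The first sum is small in mean: expand G to second order in the single entry
   W_ij, which is centered and independent of the resolvent with that entry set
   to 0; the errors are bounded with min(|W_ij|, 1), so no truncation is needed
   and the Lindeberg condition controls them. The last sum is at most
   (1/eta) sum_ij S_ij E|D_i|^2, which eta >= C + 1 lets us absorb up to the
   excess of the row sums over C. Hence the average of E|D_i|^2 tends to 0 and the
   expected normalized trace of G tends to m.

   Replacing one row and the corresponding column moves the normalized trace by
   O(1/(n eta)), so the Doob martingale over the rows has fourth moment O(1/n^2),
   which is summable: the convergence is almost sure, simultaneously for a
   countable dense set of eta.

   The trace at i eta gives the integrals of 1/(x^2 + eta^2) and x/(x^2 + eta^2)
   against the spectral distribution. Partial fractions and Bernstein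
   polynomials in y = t/(x^2 + t) approximate f y, for f bounded continuous, by
   such functions, and a sandwich with 1 - y replaces f y by f. *)

Set Implicit Arguments.
Unset Strict Implicit.
Unset Printing Implicit Defensive.

Import Order.TTheory GRing.Theory Num.Theory.
Import numFieldNormedType.Exports.

Local Open Scope classical_set_scope.
Local Open Scope ring_scope.

(** * Resolvents of Hermitian matrices *)

(** The variance sums of the rows are controlled only on average, so a few rows may be arbitrarily
    bad and no bound uniform in i is available; every estimate is an average over i, and the trivial
    bound |D_i| <= 2 pays for the bad rows. Multiplying the row identity by conj D_i makes its left
    side a square, and since z + m = i (eta + m0) is purely imaginary, taking imaginary parts
    isolates |D_i|^2 with a positive coefficient. Large eta is enough because the functions 1 / (x^2
    + t) with t large already generate, through products, all that the approximation requires.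
    Nothing is known about the joint law of the W_n for different n, so almost sure convergence has
    to come from summable moments. The variance of the trace would give only O(1/n); this is why the
    fourth moment is used. All randomness is carried by a law on finite tuples of coordinates, where
    a conditional expectation is an integral over an independent copy of the missing coordinates. *)

Section ComplexModulus.
Context {R : realType}.
Implicit Types x y z : R[i].

Lemma normC_cabs z : `|z| = (cabs z)%:C%C.
Proof. by rewrite normc_def. Qed.

Lemma cabs_ge0 z : 0 <= cabs z. Proof. exact: sqrtr_ge0. Qed.

Lemma cabs_sqr z : cabs z ^+ 2 = complex.Re z ^+ 2 + complex.Im z ^+ 2.
Proof. by rewrite sqr_sqrtr// addr_ge0// sqr_ge0. Qed.

Lemma cabsM x y : cabs (x * y) = cabs x * cabs y.
Proof. by apply: complexI; rewrite rmorphM/= -!normC_cabs normrM. Qed.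

Lemma cabsD x y : cabs (x + y) <= cabs x + cabs y.
Proof. by rewrite -lecR rmorphD/= -!normC_cabs ler_normD. Qed.

Lemma cabsN x : cabs (- x) = cabs x.
Proof. by apply: complexI; rewrite -!normC_cabs normrN. Qed.

Lemma cabsB x y : cabs (x - y) <= cabs x + cabs y.
Proof. by rewrite -(cabsN y) cabsD. Qed.

Lemma cabsJ x : cabs (conjc x) = cabs x.
Proof. by case: x => a b; rewrite /cabs /= sqrrN. Qed.

Lemma cabsV x : cabs x^-1 = (cabs x)^-1.
Proof. by apply: complexI; rewrite fmorphV/= -!normC_cabs normfV. Qed.

Lemma cabs0 : cabs (0 : R[i]) = 0.
Proof. by apply: complexI; rewrite -normC_cabs normr0. Qed.

Lemma cabs_eq0 x : (cabs x == 0) = (x == 0).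
Proof. by rewrite -[RHS]normr_eq0 normC_cabs -(inj_eq (@complexI R)). Qed.

Lemma cabs_gt0 x : (0 < cabs x) = (x != 0).
Proof. by rewrite lt0r cabs_ge0 andbT cabs_eq0. Qed.

Lemma cabs_real (a : R) : cabs (a%:C%C) = `|a|.
Proof. by rewrite /cabs /= expr0n addr0 sqrtr_sqr. Qed.

Lemma cabs_imag (a : R) : cabs (Complex 0 a) = `|a|.
Proof. by rewrite /cabs /= expr0n add0r sqrtr_sqr. Qed.

Lemma cabs_sum (I : Type) (r : seq I) (P : pred I) (F : I -> R[i]) :
  cabs (\sum_(i <- r | P i) F i) <= \sum_(i <- r | P i) cabs (F i).
Proof.
elim/big_rec2: _ => [|i a b _ h]; first by rewrite cabs0.
by rewrite (le_trans (cabsD _ _))// lerD2l.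
Qed.

Lemma normr_Re z : `|complex.Re z| <= cabs z.
Proof.
by rewrite -(@ler_sqr _ `|_|) ?nnegrE ?cabs_ge0// cabs_sqr real_normK ?num_real// lerDl sqr_ge0.
Qed.

Lemma normr_Im z : `|complex.Im z| <= cabs z.
Proof.
by rewrite -(@ler_sqr _ `|_|) ?nnegrE ?cabs_ge0// cabs_sqr real_normK ?num_real// lerDr sqr_ge0.
Qed.

Lemma mulcJ z : z * conjc z = ((cabs z ^+ 2)%:C)%C.
Proof.
rewrite cabs_sqr; case: z => a b; apply/eqP; rewrite eq_complex /=.
by apply/andP; split; apply/eqP; ring.
Qed.

Lemma cReD x y : complex.Re (x + y) = complex.Re x + complex.Re y.
Proof. by case: x; case: y. Qed.
Lemma cImD x y : complex.Im (x + y) = complex.Im x + complex.Im y.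
Proof. by case: x; case: y. Qed.
Lemma cReM x y : complex.Re (x * y) = complex.Re x * complex.Re y - complex.Im x * complex.Im y.
Proof. by case: x; case: y. Qed.
Lemma cImM x y : complex.Im (x * y) = complex.Re x * complex.Im y + complex.Im x * complex.Re y.
Proof. by case: x => a b; case: y => c d /=; rewrite mulrC (mulrC b). Qed.
Lemma cReN x : complex.Re (- x) = - complex.Re x. Proof. by case: x. Qed.
Lemma cImN x : complex.Im (- x) = - complex.Im x. Proof. by case: x. Qed.
Lemma cReB x y : complex.Re (x - y) = complex.Re x - complex.Re y.
Proof. by rewrite cReD cReN. Qed.
Lemma cImB x y : complex.Im (x - y) = complex.Im x - complex.Im y.
Proof. by rewrite cImD cImN. Qed.
Lemma cReJ x : complex.Re (conjc x) = complex.Re x. Proof. by case: x. Qed.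
Lemma cImJ x : complex.Im (conjc x) = - complex.Im x. Proof. by case: x. Qed.
Lemma cRe_sum (I : Type) (r : seq I) (P : pred I) (F : I -> R[i]) :
  complex.Re (\sum_(i <- r | P i) F i) = \sum_(i <- r | P i) complex.Re (F i).
Proof. by elim/big_rec2: _ => //= i a b _ <-; rewrite cReD. Qed.
Lemma cIm_sum (I : Type) (r : seq I) (P : pred I) (F : I -> R[i]) :
  complex.Im (\sum_(i <- r | P i) F i) = \sum_(i <- r | P i) complex.Im (F i).
Proof. by elim/big_rec2: _ => //= i a b _ <-; rewrite cImD. Qed.

End ComplexModulus.

(** * The resolvent at [i eta]: spectral form, Ward identities, removal of a row and column *)

Section Resolvent.
Context {R : realType}.
Variable eta : R.
Hypothesis eta0 : 0 < eta.

Definition is_hermitian n (A : 'M[R[i]]_n) := forall i j, A i j = conjc (A j i).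

Definition resolvent n (A : 'M[R[i]]_n) : 'M[R[i]]_n :=
  invmx (A - (Complex 0 eta)%:M).

Lemma hermitian_spectral n (A : 'M[R[i]]_n) : is_hermitian A ->
  exists (Q : 'M[R[i]]_n) (s : 'I_n -> R), Q \in unitmx /\
   A = invmx Q *m diag_mx (\row_i Complex (s i) 0) *m Q.
Proof.
move=> hA.
have Ah : A \is hermsymmx.
  apply/is_hermitianmxP; apply/matrixP => i j; rewrite !mxE expr0 mul1r.
  by rewrite hA; case: (A j i) => a b.
have /orthomx_spectralP AE := hermitian_normalmx Ah.
have /mxOverP dR := hermitian_spectral_diag_real Ah.
exists (spectralmx A), (fun i => complex.Re (spectral_diag A 0 i)); split.
  exact: spectral_unit.
have -> : \row_i Complex (complex.Re (spectral_diag A 0 i)) 0 = spectral_diag A.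
  by apply/rowP => i; rewrite mxE; have /complex_realP[k ->] := dR 0 i.
exact: AE.
Qed.

Lemma real_sub_imag_neq0 (a : R) : Complex a 0 - Complex 0 eta != 0.
Proof. by rewrite -cabs_eq0 gt_eqF// cabs_gt0 eq_complex /= sub0r oppr_eq0 (gt_eqF eta0) andbF. Qed.

Lemma spectral_resolvent n (A Q : 'M[R[i]]_n) (s : 'I_n -> R) : Q \in unitmx ->
  A = invmx Q *m diag_mx (\row_i Complex (s i) 0) *m Q ->
  A - (Complex 0 eta)%:M \in unitmx /\
  resolvent A = invmx Q *m diag_mx (\row_i (Complex (s i) 0 - Complex 0 eta)^-1) *m Q.
Proof.
move=> uQ AE.
set G := (X in _ /\ _ = X).
have GE : (A - (Complex 0 eta)%:M) *m G = 1%:M.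
  have -> : A - (Complex 0 eta)%:M =
      invmx Q *m diag_mx (\row_i (Complex (s i) 0 - Complex 0 eta)) *m Q.
    have -> : diag_mx (\row_i (Complex (s i) 0 - Complex 0 eta)) =
        diag_mx (\row_i Complex (s i) 0) - (Complex 0 eta)%:M.
      by apply/matrixP => i j; rewrite !mxE; case: eqP => _; rewrite ?mulr1n ?mulr0n ?subr0.
    rewrite mulmxBr mulmxBl -AE; congr (_ - _).
    by rewrite mul_mx_scalar -scalemxAl mulVmx// scalemx1.
  have conjM (B D : 'M[R[i]]_n) :
      (invmx Q *m B *m Q) *m (invmx Q *m D *m Q) = invmx Q *m (B *m D) *m Q.
    by rewrite -!mulmxA; congr (_ *m (_ *m _)); rewrite mulmxA (mulmxV uQ) mul1mx.
  rewrite /G conjM mulmx_diag.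
  rewrite (_ : diag_mx _ = 1%:M); first by rewrite mulmx1 mulVmx.
  apply/matrixP => i j; rewrite !mxE; case: eqP => // _.
  by rewrite divff// real_sub_imag_neq0.
have [u1 _] := mulmx1_unit GE; split; first exact: u1.
by rewrite /resolvent -[RHS]mul1mx -(mulVmx u1) -mulmxA GE mulmx1.
Qed.

Lemma shifted_unit n (A : 'M[R[i]]_n) : is_hermitian A ->
  A - (Complex 0 eta)%:M \in unitmx.
Proof. by move=> /hermitian_spectral[Q [s [uQ /spectral_resolvent []]]]. Qed.

(** [eigenvalues] is an arbitrary choice among the solutions of [eigenvalues_spec]. Some solution
    exists, namely the sorted spectrum, and every solution is a permutation of the spectrum because
    both factor the same characteristic polynomial; the trace does not see the order. *)
Lemma resolvent_trace_eigenvalues n (A : 'M[R[i]]_n) : is_hermitian A ->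
  \tr (resolvent A) = \sum_i (Complex (eigenvalues A i) 0 - Complex 0 eta)^-1.
Proof.
move=> /hermitian_spectral[Q [s [uQ AE]]].
have [_ ->] := spectral_resolvent uQ AE.
rewrite mxtrace_mulC mulmxA mulmxV// mul1mx mxtrace_diag.
have chE : char_poly A = \prod_(x <- [seq Complex (s i) 0 | i <- enum 'I_n]) ('X - x%:P).
  rewrite big_map big_enum /= /char_poly.
  have -> : char_poly_mx A = map_mx polyC (invmx Q) *m
      char_poly_mx (diag_mx (\row_i Complex (s i) 0)) *m map_mx polyC Q.
    rewrite /char_poly_mx mulmxBr mulmxBl -!map_mxM/= -AE; congr (_ - _).
    by rewrite mul_mx_scalar -scalemxAl -map_mxM mulVmx// map_mx1 scalemx1.
  rewrite !det_mulmx mulrAC -det_mulmx -map_mxM/= mulVmx// map_mx1 det1 mul1r.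
  have -> : char_poly_mx (diag_mx (\row_i Complex (s i) 0)) =
      diag_mx (\row_i ('X - (Complex (s i) 0)%:P)).
    apply/matrixP => i j; rewrite !mxE; case: eqP => // _; rewrite ?mulr1n ?mulr0n ?subr0//.
  by rewrite det_diag; apply: eq_bigr => i _; rewrite mxE.
pose l := sort (fun x y : R => y <= x) [seq s i | i <- enum 'I_n].
have szl : size l = n by rewrite size_sort size_map size_enum_ord.
have ex : exists s, eigenvalues_spec A s.
  exists (fun i => nth 0 l i); split; last first.
    move=> i j ij; have srt : sorted (fun x y : R => y <= x) l.
      by apply: sort_sorted => x y; exact: le_total.
    apply: (sorted_leq_nth _ _ 0 srt) => //; rewrite ?inE ?szl ?ltn_ord//.
    by move=> x y z h1 h2; exact: le_trans h2 h1.
  rewrite chE (perm_big [seq Complex x 0 | x <- l]) /=; last first.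
    have -> : [seq Complex (s i) 0 | i <- enum 'I_n] =
        [seq Complex x 0 | x <- [seq s i | i <- enum 'I_n]] by rewrite -[RHS]map_comp.
    by apply: perm_map; rewrite perm_sym perm_sort.
  by rewrite big_map (big_nth 0) szl big_mkord.
rewrite /eigenvalues; case: pselect => // h; case: (cid h) => t /= [tE _].
rewrite tE in chE.
have pe : perm_eq [seq Complex (t i) 0 | i <- enum 'I_n] [seq Complex (s i) 0 | i <- enum 'I_n].
  by apply: prod_XsubC_eq; rewrite -chE big_map big_enum.
transitivity (\sum_(x <- [seq Complex (s i) 0 | i <- enum 'I_n]) (x - Complex 0 eta)^-1).
  by rewrite big_map big_enum /=; apply: eq_bigr => i _; rewrite mxE.
by rewrite -(perm_big _ pe) big_map big_enum.
Qed.

Section OneMatrix.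
Context {n : nat}.
Variable A : 'M[R[i]]_n.
Hypothesis hA : is_hermitian A.
Let G := resolvent A.

Lemma mul_resolventV : (A - (Complex 0 eta)%:M) *m resolvent A = 1%:M.
Proof. by rewrite mulmxV// shifted_unit. Qed.

Lemma mul_Vresolvent : resolvent A *m (A - (Complex 0 eta)%:M) = 1%:M.
Proof. by rewrite mulVmx// shifted_unit. Qed.

Lemma resolvent_row i :
  \sum_j A i j * resolvent A j i = 1 + Complex 0 eta * resolvent A i i.
Proof.
have /matrixP/(_ i i) := mul_resolventV.
rewrite mulmxBl mul_scalar_mx !mxE eqxx => /eqP; rewrite subr_eq => /eqP ->.
by rewrite addrC.
Qed.

(** The adjoint of [G]; since [A] is Hermitian it is the resolvent at [- i eta]. *)
Let Gs := (map_mx (@conjc R) G)^T.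

Let GsE : Gs *m (A - (Complex 0 (- eta))%:M) = 1%:M.
Proof.
have /(congr1 (fun X => (map_mx (@conjc R) X)^T)) := mul_resolventV.
rewrite map_mxM trmx_mul map_mx1 trmx1 => <-; congr (_ *m _).
apply/matrixP => i j; rewrite !mxE rmorphB/= -hA; congr (_ - _).
by rewrite eq_sym; case: eqP => _; rewrite ?mulr1n ?mulr0n /= ?opprK ?oppr0.
Qed.

Let GsE' : (A - (Complex 0 (- eta))%:M) *m Gs = 1%:M.
Proof. exact: mulmx1C. Qed.

Let twoi : (Complex 0 eta)%:M = (Complex 0 (- eta))%:M + (Complex 0 (eta *+ 2))%:M :> 'M[R[i]]_n.
Proof. by rewrite -raddfD/= ; congr (_%:M); simpc; rewrite mulr2n addrA addNr add0r. Qed.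

(** The resolvent identity between the points [i eta] and [- i eta]. *)
Let ward_r : G - Gs = (Complex 0 (eta *+ 2)) *: (G *m Gs).
Proof.
have : G *m (A - (Complex 0 eta)%:M) *m Gs = Gs by rewrite mul_Vresolvent mul1mx.
rewrite twoi opprD addrA mulmxBr mulmxBl -mulmxA GsE' mulmx1.
by rewrite mul_mx_scalar -scalemxAl => /eqP; rewrite subr_eq addrC -subr_eq => /eqP.
Qed.

Let ward_l : G - Gs = (Complex 0 (eta *+ 2)) *: (Gs *m G).
Proof.
have : Gs *m (A - (Complex 0 eta)%:M) *m G = Gs by rewrite -mulmxA mul_resolventV mulmx1.
rewrite twoi opprD addrA mulmxBr mulmxBl GsE mul1mx.
by rewrite mul_mx_scalar -scalemxAl => /eqP; rewrite subr_eq addrC -subr_eq => /eqP.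
Qed.

(** The sum is a diagonal entry of [G] times its adjoint, and the same entry of [G - Gs] is
    [2 i Im G_ii]; [ward_r] compares the two. *)
Lemma ward_row i : \sum_j cabs (resolvent A i j) ^+ 2 = complex.Im (resolvent A i i) / eta.
Proof.
have /matrixP/(_ i i)/(congr1 (@complex.Im R)) := ward_r.
rewrite !mxE cImB cImJ opprK.
have -> : \sum_j G i j * Gs j i = ((\sum_j cabs (resolvent A i j) ^+ 2)%:C)%C.
  by rewrite rmorph_sum; apply: eq_bigr => j _; rewrite /Gs !mxE mulcJ.
rewrite cImM /= mul0r add0r => e; apply/eqP; rewrite eq_sym -(subr_eq0).
apply/eqP; have eN : eta != 0 by rewrite gt_eqF.
apply: (mulIf eN); rewrite mul0r mulrBl divfK//.
rewrite -/G in e *; lra.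
Qed.

Lemma ward_col i : \sum_j cabs (resolvent A j i) ^+ 2 = complex.Im (resolvent A i i) / eta.
Proof.
have /matrixP/(_ i i)/(congr1 (@complex.Im R)) := ward_l.
rewrite !mxE cImB cImJ opprK.
have -> : \sum_j Gs i j * G j i = ((\sum_j cabs (resolvent A j i) ^+ 2)%:C)%C.
  by rewrite rmorph_sum; apply: eq_bigr => j _; rewrite /Gs !mxE mulrC mulcJ.
rewrite cImM /= mul0r add0r => e; apply/eqP; rewrite eq_sym -(subr_eq0).
apply/eqP; have eN : eta != 0 by rewrite gt_eqF.
apply: (mulIf eN); rewrite mul0r mulrBl divfK//.
rewrite -/G in e *; lra.
Qed.

(** Keeping only the term [j = i] of the Ward sum gives [|G_ii|^2 <= |G_ii| / eta]. *)
Lemma cabs_resolvent_diag i : cabs (resolvent A i i) <= eta^-1.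
Proof.
have h : cabs (G i i) ^+ 2 <= cabs (G i i) / eta.
  apply: (@le_trans _ _ (complex.Im (G i i) / eta)).
    rewrite -ward_row (bigD1 i)//= lerDl sumr_ge0// => j _; exact: sqr_ge0.
  by rewrite ler_pM2r ?invr_gt0// (le_trans (ler_norm _))// normr_Im.
have := cabs_ge0 (G i i); rewrite le_eqVlt => /predU1P[<-|p].
  by rewrite invr_ge0 ltW.
by move: h; rewrite expr2 ler_pM2l.
Qed.

Lemma ward_row_le i : \sum_j cabs (resolvent A i j) ^+ 2 <= eta^-1 ^+ 2.
Proof.
rewrite ward_row expr2 ler_pM2r ?invr_gt0//.
by rewrite (le_trans (ler_norm _))// (le_trans (normr_Im _))// cabs_resolvent_diag.
Qed.

Lemma ward_col_le i : \sum_j cabs (resolvent A j i) ^+ 2 <= eta^-1 ^+ 2.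
Proof. by rewrite ward_col -ward_row ward_row_le. Qed.

Lemma cabs_resolvent i j : cabs (resolvent A i j) <= eta^-1.
Proof.
rewrite -(@ler_sqr _ (cabs _)) ?nnegrE ?cabs_ge0 ?invr_ge0 ?(ltW eta0)//.
rewrite (le_trans _ (ward_row_le i))// (bigD1 j)//= lerDl sumr_ge0// => k _.
exact: sqr_ge0.
Qed.

(** By the Ward identity a zero diagonal entry would kill its whole row, which is impossible in an
    invertible matrix. *)
Lemma resolvent_diag_neq0 i : resolvent A i i != 0.
Proof.
apply/negP => /eqP h; have := ward_row i; rewrite h /= mul0r => h0.
have r0 j : G i j = 0.
  apply/eqP; rewrite -cabs_eq0 -sqrf_eq0.
  by move/eqP: h0; rewrite psumr_eq0 => [/allP/(_ j)|k _]; rewrite ?sqr_ge0 ?mem_index_enum //; apply.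
have /matrixP/(_ i i) := mul_Vresolvent.
rewrite !mxE eqxx big1 => [/esym/eqP|k _]; first by rewrite oner_eq0.
by rewrite -/G r0 mul0r.
Qed.

End OneMatrix.

(* The resolvent with row and column [k] eliminated; it only depends on the
   corresponding minor of the matrix. *)
Definition eliminated n (A : 'M[R[i]]_n) (k : 'I_n) : 'M[R[i]]_n :=
  \matrix_(i, j) (resolvent A i j - resolvent A i k * resolvent A k j / resolvent A k k).

(** The difference [D] is annihilated by all rows of [A - z] except row [k], so it is column [k] of
    the resolvent times a row vector [rho]. Row [k] of [D] vanishes and [G_kk] does not, hence
    [rho = 0]. *)
Lemma eliminated_local n (A A' : 'M[R[i]]_n) k : is_hermitian A -> is_hermitian A' ->
  (forall i j, i != k -> j != k -> A i j = A' i j) ->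
  eliminated A k = eliminated A' k.
Proof.
move=> hA hA' AA'.
have row0 B j : is_hermitian B -> eliminated B k k j = 0.
  by move=> hB; rewrite mxE mulrAC divff ?mul1r ?subrr// resolvent_diag_neq0.
have mulE B i j : is_hermitian B -> i != k ->
    ((B - (Complex 0 eta)%:M) *m eliminated B k) i j = (i == j)%:R.
  move=> hB ik.
  have -> : eliminated B k = resolvent B -
      (resolvent B k k)^-1 *: (resolvent B *m (delta_mx k k *m resolvent B)).
    apply/matrixP => a b; rewrite !mxE (bigD1 k)//= big1 => [|c ck].
      rewrite !mxE (bigD1 k)//= big1 => [|c ck].
        by rewrite !mxE !eqxx mul1r !addr0 mulrC.
      by rewrite !mxE (negbTE ck) andbF mul0r.
    rewrite !mxE big1 ?mulr0// => d _.
    by rewrite !mxE (negbTE ck) mul0r.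
  rewrite mulmxBr -scalemxAr (mulmxA (B - _)) mul_resolventV// mul1mx !mxE.
  by rewrite big1 ?mulr0 ?subr0// => d _; rewrite !mxE (negbTE ik) mul0r.
pose D := eliminated A k - eliminated A' k.
have De i j : i != k -> ((A - (Complex 0 eta)%:M) *m D) i j = 0.
  move=> ik; rewrite mulmxBr mxE mulE// mxE.
  (* Column [k], where the two matrices may differ, meets the zero row [k] of [eliminated A' k]. *)
  have -> : ((A - (Complex 0 eta)%:M) *m eliminated A' k) i j =
       ((A' - (Complex 0 eta)%:M) *m eliminated A' k) i j.
    rewrite [LHS]mxE [RHS]mxE; apply: eq_bigr => l _.
    have [->|lk] := eqVneq l k; first by rewrite row0// !mulr0.
    by congr (_ * _); rewrite !mxE AA'.
  by rewrite mulE// subrr.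
pose rho j := ((A - (Complex 0 eta)%:M) *m D) k j.
have DE i j : D i j = resolvent A i k * rho j.
  have -> : D = resolvent A *m ((A - (Complex 0 eta)%:M) *m D).
    by rewrite mulmxA mul_Vresolvent// mul1mx.
  rewrite mxE (bigD1 k)//= big1 ?addr0// => l lk.
  by rewrite De ?mulr0.
have rho0 j : rho j = 0.
  have := DE k j; rewrite !mxE -!/(eliminated _ _) => /esym/eqP.
  have := row0 A j hA; have := row0 A' j hA'; rewrite !mxE => -> ->.
  by rewrite subrr mulf_eq0 (negbTE (resolvent_diag_neq0 _ _)) //= => /eqP.
apply/eqP; rewrite -subr_eq0; apply/eqP/matrixP => i j.
by rewrite -/D DE rho0 mulr0 mxE.
Qed.

(** The difference is [(G^2)_kk / G_kk]. By [|x y| <= (|x|^2 + |y|^2) / 2] and the two Ward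
    identities the numerator is at most [Im G_kk / eta], so the bound involves neither [A] nor
    [n]. *)
Lemma trace_eliminated n (A : 'M[R[i]]_n) k : is_hermitian A ->
  cabs (\tr (resolvent A) - \tr (eliminated A k)) <= eta^-1.
Proof.
move=> hA.
have -> : \tr (resolvent A) - \tr (eliminated A k) =
   (\sum_i resolvent A i k * resolvent A k i) / resolvent A k k.
  rewrite -raddfB /= /mxtrace mulr_suml; apply: eq_bigr => i _.
  by rewrite !mxE opprB addrCA addrN addr0.
rewrite cabsM cabsV ler_pdivrMr ?cabs_gt0 ?resolvent_diag_neq0//.
rewrite (le_trans (cabs_sum _ _ _))//.
apply: (@le_trans _ _ (\sum_i (cabs (resolvent A i k) ^+ 2 + cabs (resolvent A k i) ^+ 2) / 2)).
  apply: ler_sum => i _; rewrite cabsM.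
  have := sqr_ge0 (cabs (resolvent A i k) - cabs (resolvent A k i)); nra.
rewrite -mulr_suml big_split /= ward_row// ward_col//.
have -> : forall x : R, (x + x) / 2 = x by move=> x; field.
rewrite mulrC ler_pM2l ?invr_gt0//.
by rewrite (le_trans (ler_norm _))// normr_Im.
Qed.

Lemma trace_resolvent_bounded_difference n (A A' : 'M[R[i]]_n) k :
  is_hermitian A -> is_hermitian A' ->
  (forall i j, i != k -> j != k -> A i j = A' i j) ->
  cabs (\tr (resolvent A) - \tr (resolvent A')) <= 2 / eta.
Proof.
move=> hA hA' h; have e := eliminated_local hA hA' h.
have -> : \tr (resolvent A) - \tr (resolvent A') =
   (\tr (resolvent A) - \tr (eliminated A k)) -
   (\tr (resolvent A') - \tr (eliminated A' k)).
  by rewrite e; ring.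
rewrite (le_trans (cabsB _ _))// mulr_natl mulr2n.
by rewrite lerD// trace_eliminated.
Qed.

(* The resolvent identity [G = G0 - G0 V G] when [A - A0 = V] is supported on
   the entries [(i, j)] and [(j, i)]. *)
Lemma resolvent_entry_expansion n (A A0 : 'M[R[i]]_n) (i j : 'I_n) a b :
  is_hermitian A -> is_hermitian A0 ->
  (forall k l, A k l = A0 k l + (if (k == i) && (l == j) then A i j else
      if (k == j) && (l == i) then A j i else 0)) ->
  resolvent A a b = resolvent A0 a b - A i j * resolvent A0 a i * resolvent A j b
    - (i != j)%:R * A j i * resolvent A0 a j * resolvent A i b.
Proof.
move=> hA hA0 AE.
(* For [i = j] the two elementary matrices coincide; the factor [(i != j)%:R] keeps the entry from
   being counted twice. *)
pose V := A i j *: delta_mx i j + (i != j)%:R *: (A j i *: delta_mx j i) : 'M[R[i]]_n.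
have VE : A = A0 + V.
  apply/matrixP => k l; rewrite AE !mxE; congr (_ + _).
  case: ifPn => [/andP[/eqP -> /eqP ->]|b1].
    rewrite mulr1; case: (i == j) => /=; first by rewrite mul0r addr0.
    by rewrite !mulr0 addr0.
  case: ifPn => [/andP[/eqP kj /eqP li]|_]; last by rewrite !mulr0 addr0.
  by move: b1; rewrite kj li (eq_sym j) andbb => ->; rewrite mulr0 mul1r mulr1 add0r.
have e : resolvent A = resolvent A0 - resolvent A0 *m V *m resolvent A.
  have : resolvent A0 *m (A - (Complex 0 eta)%:M) *m resolvent A = resolvent A0.
    by rewrite -mulmxA mul_resolventV// mulmx1.
  rewrite {1}VE addrAC mulmxDr mulmxDl mul_Vresolvent// mul1mx => /eqP.
  by rewrite eq_sym -subr_eq => /eqP.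
rewrite {1}e !mxE -addrA -opprD; congr (_ - _).
have E (i' j' : 'I_n) : (resolvent A0 *m delta_mx i' j' *m resolvent A) a b = resolvent A0 a i' * resolvent A j' b.
  rewrite mxE (bigD1 j')//= big1 => [|k kj]; rewrite !mxE (bigD1 i')//= big1 => [|l li].
  - by rewrite !mxE !eqxx mulr1 !addr0.
  - by rewrite !mxE (negbTE li) mulr0.
  - by rewrite !mxE (negbTE kj) andbF mulr0 addr0 mul0r.
  - by rewrite !mxE (negbTE li) mulr0.
transitivity ((resolvent A0 *m V *m resolvent A) a b); first by rewrite [RHS]mxE.
have F (X : 'M[R[i]]_n) c : (c *: X) a b = c * X a b by rewrite mxE.
have D (X Y : 'M[R[i]]_n) : (X + Y) a b = X a b + Y a b by rewrite mxE.
rewrite /V mulmxDr mulmxDl D -!scalemxAr -!scalemxAl !F !E; ring.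
Qed.

End Resolvent.

(** * Semicircle integrals *)

Section Semicircle.
Context {R : realType}.
Implicit Types (f g : R -> R) (x : R).

Lemma sc_densityE x : sc_density x = (2 * pi)^-1 * Num.sqrt (4 - x ^+ 2).
Proof.
rewrite /sc_density; congr (_ * _); case: leP => // h.
by rewrite sqrtr0 ler0_sqrtr.
Qed.

Let r x := Num.sqrt (4 - x ^+ 2).

Lemma cont_r : continuous r.
Proof.
move=> x; apply: (@continuous_comp _ _ _ (fun x : R => 4 - x ^+ 2) (@Num.sqrt R)).
  by apply: continuousB; [exact: cvg_cst|exact: exprn_continuous].
exact: sqrt_continuous.
Qed.

Lemma continuous_sc_density : continuous (@sc_density R).
Proof.
move=> x; rewrite (funext sc_densityE).
by apply: cvgM; [exact: cvg_cst|exact: cont_r].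
Qed.

Lemma sc_density_ge0 x : 0 <= sc_density x.
Proof. by rewrite sc_densityE mulr_ge0 ?sqrtr_ge0// invr_ge0 mulr_ge0// pi_ge0. Qed.

Lemma sc_integralE f :
  sc_integral f = \int[lebesgue_measure]_(x in `[-2, 2]) (f x * sc_density x).
Proof.
rewrite /sc_integral [RHS]Rintegral_mkcond; congr Rintegral.
apply/funext => x; rewrite patchE; case: ifPn => //.
rewrite mem_setE in_itv/= negb_and -!ltNge => h.
rewrite sc_densityE ler0_sqrtr ?mulr0// subr_le0.
by case/orP: h => h; nra.
Qed.

Lemma integrable_sc f : continuous f ->
  lebesgue_measure.-integrable `[-2, 2] (EFin \o (fun x => f x * sc_density x)).
Proof.
move=> cf; apply: continuous_compact_integrable; first exact: segment_compact.
apply: continuous_subspaceT => x; apply: cvgM; first exact: cf.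
exact: continuous_sc_density.
Qed.

Lemma sc_integralD f g : continuous f -> continuous g ->
  sc_integral (fun x => f x + g x) = sc_integral f + sc_integral g.
Proof.
move=> cf cg; rewrite !sc_integralE -RintegralD//; try exact: integrable_sc.
by apply: eq_Rintegral => x _; rewrite mulrDl.
Qed.

Lemma sc_integralZ c f : continuous f ->
  sc_integral (fun x => c * f x) = c * sc_integral f.
Proof.
move=> cf; rewrite !sc_integralE -RintegralZl//; last exact: integrable_sc.
by apply: eq_Rintegral => x _; rewrite mulrA.
Qed.

Lemma le_sc_integral f g : continuous f -> continuous g -> (forall x, f x <= g x) ->
  sc_integral f <= sc_integral g.
Proof.
move=> cf cg fg; rewrite !sc_integralE; apply: le_Rintegral => //; try exact: integrable_sc.
by move=> x _; rewrite ler_wpM2r// sc_density_ge0.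
Qed.

(** Differentiability is asked only inside the interval, because [r] has infinite slope at [-2] and
    [2]. *)
Lemma FTC2_Rintegral (a b : R) (f F : R -> R) : a < b -> continuous f -> continuous F ->
  (forall x, a < x < b -> is_derive x 1 F (f x)) ->
  \int[lebesgue_measure]_(x in `[a, b]) f x = F b - F a.
Proof.
move=> ab cf cF dF; rewrite /Rintegral (@continuous_FTC2 _ f F)//.
- exact: continuous_subspaceT.
- split.
  + by move=> x; rewrite in_itv/= => /dF [].
  + exact/cvg_at_right_filter/cF.
  + exact/cvg_at_left_filter/cF.
- by move=> x; rewrite in_itv/= => /dF h; rewrite derive1E (@derive_val _ _ _ _ _ _ _ h).
Qed.

Let r_gt0 x : -2 < x < 2 -> 0 < r x.
Proof. by move=> /andP[h1 h2]; rewrite sqrtr_gt0; nra. Qed.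

Let r2 x : -2 < x < 2 -> r x ^+ 2 = 4 - x ^+ 2.
Proof. by move=> /andP[h1 h2]; rewrite sqr_sqrtr//; nra. Qed.

Let dr x : -2 < x < 2 -> is_derive x 1 r (- x / r x).
Proof.
move=> h; have r0 := r_gt0 h.
have d1 : is_derive x 1 (fun x : R => 4 - x ^+ 2) (- (2 * x)).
  apply: is_derive_eq; rewrite /GRing.scale /=.
  ring.
have d2 : is_derive (4 - x ^+ 2) 1 (@Num.sqrt R) (2 * r x)^-1.
  by apply: is_derive1_sqrt; rewrite -sqrtr_gt0.
apply: (is_derive_eq (@is_derive1_comp _ (@Num.sqrt R) (fun x => 4 - x ^+ 2) x _ _ d2 d1)); field.
by rewrite gt_eqF.
Qed.

(* [2 * atan (x / (2 + r)) = asin (x / 2)], in a form that is smooth up to the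
   end points of [[-2, 2]]. *)
Let u x := x / (2 + r x).

Let cont_u : continuous u.
Proof.
move=> x; apply: cvgM; first exact: cvg_id.
apply: cvgV; first by rewrite gt_eqF// ltr_wpDr ?sqrtr_ge0.
by apply: cvgD; [exact: cvg_cst|exact: cont_r].
Qed.

(** This is the derivative of [asin (x / 2)]; the relation [r^2 + x^2 = 4] collapses [1 + u^2] to
    [4 / (2 + r)]. *)
Let du x : -2 < x < 2 -> is_derive x 1 (fun x => 2 * atan (u x)) (r x)^-1.
Proof.
move=> h; have r0 := r_gt0 h; have rr := r2 h; have drx := dr h.
have n2 : 2 + r x != 0 by rewrite gt_eqF// ltr_wpDr ?ltW.
have d1 : is_derive x 1 (fun x => 2 + r x) (- x / r x).
  by apply: (is_derive_eq (is_deriveD (is_derive_cst (2 : R) x 1) drx)); rewrite add0r.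
have d2 := @is_deriveV R (fun x => 2 + r x) x _ _ n2 d1.
have d3 : is_derive x 1 u (2 / (r x * (2 + r x))).
  apply: (is_derive_eq (is_deriveM (is_derive_id x 1) d2)).
  rewrite /GRing.scale /=.
  have -> : 2 / (r x * (2 + r x)) = (2 * r x + (r x ^+ 2 + x ^+ 2)) / (r x * (2 + r x) ^+ 2).
    by rewrite rr; field; rewrite n2 gt_eqF.
  by field; rewrite n2 gt_eqF.
have d4 := @is_derive1_comp _ (@atan R) u x _ _ (is_derive1_atan (u x)) d3.
apply: (is_derive_eq (is_deriveZ 2 d4)); rewrite /GRing.scale /= /u.
have e1 : 1 + (x / (2 + r x)) ^+ 2 = 4 / (2 + r x).
  have -> : 1 + (x / (2 + r x)) ^+ 2 = (4 + 4 * r x + (r x ^+ 2 + x ^+ 2)) / (2 + r x) ^+ 2.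
    by field.
  by rewrite rr; field.
by rewrite e1; field; rewrite n2 gt_eqF.
Qed.

Let r_end x : x ^+ 2 = 4 -> r x = 0.
Proof. by move=> h; rewrite /r h subrr sqrtr0. Qed.

Let u2 : u 2 = 1. Proof. by rewrite /u r_end ?addr0 ?divff//; ring. Qed.
Let uN2 : u (-2) = -1. Proof. by rewrite /u r_end ?addr0 ?mulNr ?divff//; ring. Qed.

(** An antiderivative of [r] is [x r / 2 + 2 asin (x / 2)], with the arcsine in the form
    [2 atan u]. *)
Lemma sc_integral1 : sc_integral (fun=> 1) = 1 :> R.
Proof.
have pi0 := pi_gt0 R.
pose F x := (2 * pi)^-1 * (x * r x / 2 + 2 * (2 * atan (u x))).
rewrite sc_integralE; transitivity (F 2 - F (-2)); last first.
  rewrite /F u2 uN2 atanN atan1 !r_end; [|ring..].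
  by move: (pi : R) pi0 => p p0; field; rewrite gt_eqF.
apply: FTC2_Rintegral.
- lra.
- move=> x; apply: cvgM; first exact: cvg_cst.
  exact: continuous_sc_density.
- move=> x; apply: cvgM; first exact: cvg_cst.
  apply: cvgD.
    apply: cvgM; last exact: cvg_cst.
    by apply: cvgM; [exact: cvg_id|exact: cont_r].
  apply: cvgM; first exact: cvg_cst.
  apply: cvgM; first exact: cvg_cst.
  apply: continuous_comp; first exact: cont_u.
  exact: continuous_atan.
- move=> x h; have r0 := r_gt0 h; have rr := r2 h.
  have d1 := is_deriveM (is_derive_id x 1) (dr h).
  have d2 := is_deriveZ 2 (du h).
  have d3 := is_deriveZ 2^-1 d1.
  have d4 := is_deriveZ (2 * pi)^-1 (is_deriveD d3 d2).
  rewrite sc_densityE mul1r -/(r x).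
  have -> : F = (2 * pi)^-1 \*: (2^-1 \*: (id * r) + 2 \*: (fun x => 2 * atan (u x))).
    apply/funext => y; rewrite /F !fctE.
    by transitivity ((2 * pi)^-1 * (2^-1 * (y * r y) + 2 * (2 * atan (u y)))); first ring.
  apply: (is_derive_eq d4); rewrite /GRing.scale /=; congr (_ * _).
  have rN : r x != 0 by rewrite gt_eqF.
  transitivity ((r x ^+ 2 + (4 - x ^+ 2)) / (2 * r x)); first by field.
  by rewrite -rr; field.
Qed.

(** * Semicircle integrals of the real and imaginary parts of [1 / (x - i eta)] *)

Section ResolventFunctions.
Variable eta : R.
Hypothesis eta0 : 0 < eta.
Let a := Num.sqrt (eta ^+ 2 + 4).
Let q x := Num.sqrt (x ^+ 2 + eta ^+ 2).

Let a0 : 0 < a. Proof. by rewrite sqrtr_gt0 ltr_wpDl ?sqr_ge0. Qed.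
Let a2 : a ^+ 2 = eta ^+ 2 + 4. Proof. by rewrite sqr_sqrtr// addr_ge0 ?sqr_ge0. Qed.
Let q0 x : 0 < q x. Proof. by rewrite sqrtr_gt0 ltr_wpDl ?sqr_ge0// exprn_gt0. Qed.
Let q2 x : q x ^+ 2 = x ^+ 2 + eta ^+ 2.
Proof. by rewrite sqr_sqrtr// addr_ge0 ?sqr_ge0. Qed.

Let den x := 2 * q x + eta * r x.
Let den0 x : 0 < den x.
Proof. by rewrite ltr_pwDl ?mulr_gt0// mulr_ge0 ?sqrtr_ge0// ltW. Qed.

(* [2 * atan (v x)] is [asin (a x / (2 q))]. *)
Let v x := a * x / den x.

Let cont_q : continuous q.
Proof.
move=> x; apply: (@continuous_comp _ _ _ (fun x : R => x ^+ 2 + eta ^+ 2) (@Num.sqrt R)).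
  by apply: cvgD; [exact: exprn_continuous|exact: cvg_cst].
exact: sqrt_continuous.
Qed.

Let cont_v : continuous v.
Proof.
move=> x; apply: cvgM.
  by apply: cvgM; [exact: cvg_cst|exact: cvg_id].
apply: cvgV; first by rewrite gt_eqF.
by apply: cvgD; apply: cvgM; [exact: cvg_cst|exact: cont_q|exact: cvg_cst|exact: cont_r].
Qed.

Let dq x : is_derive x 1 q (x / q x).
Proof.
have d1 : is_derive x 1 (fun x : R => x ^+ 2 + eta ^+ 2) (2 * x).
  by apply: is_derive_eq; rewrite /GRing.scale /=; ring.
have d2 : is_derive (x ^+ 2 + eta ^+ 2) 1 (@Num.sqrt R) (2 * q x)^-1.
  by apply: is_derive1_sqrt; rewrite -sqrtr_gt0; exact: q0.
apply: (is_derive_eq (@is_derive1_comp _ (@Num.sqrt R) (fun x => x ^+ 2 + eta ^+ 2) x _ _ d2 d1)).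
by field; rewrite gt_eqF.
Qed.

Let dv x : -2 < x < 2 -> is_derive x 1 (fun x => 2 * atan (v x)) (a * eta / (q x ^+ 2 * r x)).
Proof.
move=> h; have r0 := r_gt0 h; have rr := r2 h; have drx := dr h; have dqx := dq x.
have qq := q2 x; have qx := q0 x; have dn := den0 x.
have rN : r x != 0 by rewrite gt_eqF.
have qN : q x != 0 by rewrite gt_eqF.
have dN : den x != 0 by rewrite gt_eqF.
have d1 : is_derive x 1 den (2 * (x / q x) + eta * (- x / r x)).
  exact: (is_deriveD (is_deriveZ 2 dqx) (is_deriveZ eta drx)).
have d2 := @is_deriveV R den x _ _ dN d1.
have d3 : is_derive x 1 v (2 * a * eta / (q x * r x * den x)).
  have d0 : is_derive x 1 (fun x => a * x) a.
    by apply: (is_derive_eq (is_deriveZ a (is_derive_id x 1))); rewrite /GRing.scale /= mulr1.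
  apply: (is_derive_eq (is_deriveM d0 d2)).
  rewrite /GRing.scale /=.
  have -> : 2 * a * eta / (q x * r x * den x) =
     a * (2 * (q x ^+ 2 - x ^+ 2) * r x + eta * (r x ^+ 2 + x ^+ 2) * q x) / (q x * r x * den x ^+ 2).
    rewrite rr qq.
    transitivity (2 * a * eta * (2 * q x + eta * r x) / (q x * r x * den x ^+ 2)).
      by rewrite -/(den x); field; rewrite rN qN dN.
    by congr (_ / _); ring.
  transitivity (a * ((2 * q x + eta * r x) * (q x * r x) - x * (2 * x * r x - eta * x * q x)) /
       (q x * r x * den x ^+ 2)); last by congr (_ / _); ring.
  by rewrite -/(den x); field; rewrite rN qN dN.
have d4 := @is_derive1_comp _ (@atan R) v x _ _ (is_derive1_atan (v x)) d3.
apply: (is_derive_eq (is_deriveZ 2 d4)); rewrite /GRing.scale /= /v.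
(* The relations for [r^2], [q^2] and [a^2] combine to [den^2 + a^2 x^2 = 4 q den]. *)
have e1 : 1 + (a * x / den x) ^+ 2 = 4 * q x / den x.
  have -> : 1 + (a * x / den x) ^+ 2 = (den x ^+ 2 + a ^+ 2 * x ^+ 2) / den x ^+ 2.
    by field.
  have -> : den x ^+ 2 + a ^+ 2 * x ^+ 2 = 4 * q x * den x.
    rewrite /den a2.
    have -> : (2 * q x + eta * r x) ^+ 2 + (eta ^+ 2 + 4) * x ^+ 2 =
       4 * q x ^+ 2 + 4 * q x * eta * r x + eta ^+ 2 * (r x ^+ 2 + x ^+ 2) + 4 * x ^+ 2 by ring.
    have -> : 4 * q x * (2 * q x + eta * r x) = 8 * q x ^+ 2 + 4 * q x * eta * r x by ring.
    by rewrite rr qq; ring.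
  by field.
by rewrite e1; field; rewrite rN qN dN.
Qed.

Lemma continuous_resolvent_even : continuous (fun x => (x ^+ 2 + eta ^+ 2)^-1).
Proof.
move=> x; apply: cvgV; first by rewrite -q2 expf_neq0// gt_eqF.
by apply: cvgD; [exact: exprn_continuous|exact: cvg_cst].
Qed.

(** Since [r^2 = a^2 - q^2], the integrand is [a^2 / (q^2 r) - 1 / r] up to the factor [1 / (2 pi)],
    and both terms have arcsines as antiderivatives. Multiplied by [eta], the value is the positive
    root [m0] of [m0^2 + eta m0 = 1]. *)
Lemma sc_integral_even : sc_integral (fun x => (x ^+ 2 + eta ^+ 2)^-1) =
  (Num.sqrt (eta ^+ 2 + 4) - eta) / 2 / eta.
Proof.
have pi0 := pi_gt0 R.
have eN : eta != 0 by rewrite gt_eqF.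
pose F x := (2 * pi)^-1 * (a / eta * (2 * atan (v x)) - 2 * atan (u x)).
rewrite sc_integralE; transitivity (F 2 - F (-2)); last first.
  have qa x : x ^+ 2 = 4 -> q x = a by move=> e; rewrite /q e addrC.
  have v2 : v 2 = 1.
    rewrite /v /den qa; last by ring.
    rewrite r_end; last by ring.
    by field; rewrite gt_eqF.
  have vN2 : v (-2) = -1.
    rewrite /v /den qa; last by ring.
    rewrite r_end; last by ring.
    by field; rewrite gt_eqF.
  rewrite /F u2 uN2 v2 vN2 !atanN atan1 -/a.
  by move: (pi : R) pi0 => p p0; field; rewrite eN gt_eqF.
apply: FTC2_Rintegral.
- lra.
- move=> x; apply: cvgM; first exact: continuous_resolvent_even.
  exact: continuous_sc_density.
- move=> x; apply: cvgM; first exact: cvg_cst.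
  apply: cvgB.
    apply: cvgM; first exact: cvg_cst.
    apply: cvgM; first exact: cvg_cst.
    apply: continuous_comp; first exact: cont_v.
    exact: continuous_atan.
  apply: cvgM; first exact: cvg_cst.
  apply: continuous_comp; first exact: cont_u.
  exact: continuous_atan.
- move=> x h; have r0 := r_gt0 h; have rr := r2 h; have qq := q2 x; have qx := q0 x.
  have rN : r x != 0 by rewrite gt_eqF.
  have qN : q x != 0 by rewrite gt_eqF.
  have d4 := is_deriveZ (2 * pi)^-1 (is_deriveB (is_deriveZ (a / eta) (dv h)) (du h)).
  apply: (is_derive_eq d4); rewrite sc_densityE -/(r x) -q2.
  rewrite [RHS]mulrCA; congr (_ * _); rewrite /GRing.scale /=.
  transitivity ((a ^+ 2 - q x ^+ 2) / (q x ^+ 2 * r x)).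
    by field; rewrite rN qN eN.
  have -> : a ^+ 2 - q x ^+ 2 = r x ^+ 2 by rewrite a2 qq rr; ring.
  by field; rewrite rN qN.
Qed.

Lemma continuous_resolvent_odd : continuous (fun x => x / (x ^+ 2 + eta ^+ 2)).
Proof. by move=> x; apply: cvgM; [exact: cvg_id|exact: continuous_resolvent_even]. Qed.

Lemma sc_integral_odd : sc_integral (fun x => x / (x ^+ 2 + eta ^+ 2)) = 0.
Proof.
set f := fun x => _.
have cf : continuous (fun x => f x * sc_density x).
  by move=> x; apply: cvgM; [exact: continuous_resolvent_odd|exact: continuous_sc_density].
have e : sc_integral f = - sc_integral f.
  rewrite {1}sc_integralE /Rintegral.
  have := @integration_by_substitution_oppr R (fun x => f x * sc_density x) (-2) 2.
  rewrite opprK => ->; [|lra|exact: continuous_subspaceT].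
  rewrite -[RHS]mulN1r -sc_integralZ; last exact: continuous_resolvent_odd.
  rewrite sc_integralE /Rintegral; congr fine; apply: eq_integral => x _ /=.
  by rewrite /f sc_densityE sqrrN -sc_densityE mulN1r mulNr.
by lra.
Qed.

End ResolventFunctions.

End Semicircle.

(** * Functions of independent coordinates *)

Section ImageLaw.
Context d d' (T : measurableType d) (U : measurableType d') (R : realType).
Variables (P : probability T R) (f : T -> U) (mf : measurable_fun setT f).

(** A copy of [pushforward] under its own name, so that it can carry a probability structure. *)
Definition image_law of measurable_fun setT f := pushforward P f : set U -> \bar R.

HB.instance Definition _ := Measure.copy (image_law mf)
  (measure_function_pushforward__canonical__measure_function_Measure P mf).

Let image_law_setT : image_law mf setT = 1%E.
Proof. by rewrite /image_law /pushforward -(@probability_setT _ _ _ P). Qed.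

HB.instance Definition _ :=
  Measure_isProbability.Build _ _ _ (image_law mf) image_law_setT.

End ImageLaw.

(** * Real-valued expectations and integrability *)

Section Expectation.
Context d (T : measurableType d) (R : realType) (P : probability T R).
Implicit Types f g : T -> R.

Definition Ex f : R := \int[P]_x f x.
Definition intble f := P.-integrable setT (EFin \o f).
Definition bounded f := exists M : R, forall x, `|f x| <= M.

Lemma intble_meas f : intble f -> measurable_fun setT f.
Proof. by move=> /measurable_int /measurable_EFinP. Qed.

Lemma intble_cst (c : R) : intble (fun=> c).
Proof. exact: finite_measure_integrable_cst. Qed.

Lemma intbleD f g : intble f -> intble g -> intble (fun x => f x + g x).
Proof. by move=> hf hg; have := integrableD measurableT hf hg. Qed.

Lemma intbleZ (c : R) f : intble f -> intble (fun x => c * f x).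
Proof. by move=> hf; have := integrableZl measurableT c hf. Qed.

Lemma intbleN f : intble f -> intble (fun x => - f x).
Proof. by move=> hf; have := intbleZ (-1) hf; under eq_fun do rewrite mulN1r. Qed.

Lemma intbleB f g : intble f -> intble g -> intble (fun x => f x - g x).
Proof. by move=> hf hg; apply: intbleD => //; apply: intbleN. Qed.

Lemma intble_sum (I : Type) (r : seq I) (F : I -> T -> R) :
  (forall i, intble (F i)) -> intble (fun x => \sum_(i <- r) F i x).
Proof.
move=> h; elim: r => [|i r ih].
  under eq_fun do rewrite big_nil; exact: intble_cst.
by under eq_fun do rewrite big_cons; exact: intbleD.
Qed.

Lemma intble_le f g : measurable_fun setT f -> (forall x, `|f x| <= g x) ->
  intble g -> intble f.
Proof.
move=> mf fg ig; apply: (le_integrable measurableT _ _ ig).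
  exact/measurable_EFinP.
by move=> x _ /=; rewrite lee_fin (le_trans (fg x))// ler_norm.
Qed.

Lemma intble_bounded f : measurable_fun setT f -> bounded f -> intble f.
Proof. by move=> mf [M hM]; apply: (intble_le mf hM); exact: intble_cst. Qed.

Lemma intble_norm f : intble f -> intble (fun x => `|f x|).
Proof.
move=> hf; apply: (intble_le (g := fun x => `|f x|)); last first.
- by have := integrable_abse hf.
- by move=> x; rewrite normr_id.
- by apply: measurableT_comp => //; exact: intble_meas.
Qed.

Lemma intbleM_bounded f g : intble f -> measurable_fun setT g -> bounded g ->
  intble (fun x => f x * g x).
Proof.
move=> hf mg [M hM]; apply: (intble_le (g := fun x => M * `|f x|)).
- by apply: measurable_funM => //; exact: intble_meas.
- by move=> x; rewrite normrM mulrC ler_wpM2r.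
- by apply: intbleZ; apply: intble_norm.
Qed.

Lemma Ex_cst (c : R) : Ex (fun=> c) = c.
Proof.
transitivity (c * fine (P setT)); first exact: Rintegral_cst.
by have -> : P setT = 1%E := @probability_setT _ _ _ P; rewrite mulr1.
Qed.

Lemma ExD f g : intble f -> intble g -> Ex (fun x => f x + g x) = Ex f + Ex g.
Proof. by move=> hf hg; rewrite /Ex RintegralD. Qed.

Lemma ExZ (c : R) f : intble f -> Ex (fun x => c * f x) = c * Ex f.
Proof. by move=> hf; rewrite /Ex RintegralZl. Qed.

Lemma ExN f : intble f -> Ex (fun x => - f x) = - Ex f.
Proof. by move=> hf; rewrite -mulN1r -ExZ//; under eq_fun do rewrite -mulN1r. Qed.

Lemma ExB f g : intble f -> intble g -> Ex (fun x => f x - g x) = Ex f - Ex g.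
Proof. by move=> hf hg; rewrite ExD ?ExN//; exact: intbleN. Qed.

Lemma Ex_sum (I : Type) (r : seq I) (F : I -> T -> R) : (forall i, intble (F i)) ->
  Ex (fun x => \sum_(i <- r) F i x) = \sum_(i <- r) Ex (F i).
Proof.
move=> h; elim: r => [|i r ih].
  by rewrite big_nil -[RHS](Ex_cst 0); under eq_fun do rewrite big_nil.
rewrite big_cons -ih -ExD//; last exact: intble_sum.
by under eq_fun do rewrite big_cons.
Qed.

Lemma Ex_le f g : intble f -> intble g -> (forall x, f x <= g x) -> Ex f <= Ex g.
Proof. by move=> hf hg h; apply: le_Rintegral => // x _. Qed.

Lemma Ex_ge0 f : (forall x, 0 <= f x) -> 0 <= Ex f.
Proof. by move=> h; apply: Rintegral_ge0 => x _. Qed.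

Lemma norm_Ex f : intble f -> `|Ex f| <= Ex (fun x => `|f x|).
Proof. by move=> h; apply: le_normr_Rintegral. Qed.

Lemma Ex_bound f (M : R) : intble f -> (forall x, `|f x| <= M) -> `|Ex f| <= M.
Proof.
move=> hf h; rewrite (le_trans (norm_Ex hf))// -[leRHS]Ex_cst.
by apply: Ex_le => //; [exact: intble_norm|exact: intble_cst].
Qed.

Lemma EFin_Ex f : intble f -> (\int[P]_x (f x)%:E)%E = (Ex f)%:E.
Proof. by move=> h; rewrite /Ex /Rintegral fineK// integrable_fin_num. Qed.

End Expectation.

Lemma Ex_prod d1 d2 (T1 : measurableType d1) (T2 : measurableType d2) (R : realType)
  (P1 : probability T1 R) (P2 : probability T2 R) (f : T1 * T2 -> R) :
  measurable_fun setT f -> bounded f ->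
  Ex (P1 \x P2)%E f = Ex P1 (fun x => Ex P2 (fun y => f (x, y))) /\
  measurable_fun setT (fun x => Ex P2 (fun y => f (x, y))).
Proof.
move=> mf bf; have i := @intble_bounded _ _ _ (P1 \x P2)%E _ mf bf.
have i2 x : intble P2 (fun y => f (x, y)).
  by apply: intble_bounded; [exact: measurableT_comp|case: bf => M h; exists M].
have E : fubini_F P2 (EFin \o f) = EFin \o (fun x => Ex P2 (fun y => f (x, y))).
  by apply/funext => x; rewrite /fubini_F /= (EFin_Ex (i2 x)).
split; last by have := measurable_fubini_F i; rewrite E => /measurable_EFinP.
by rewrite /Ex /Rintegral -(integral12_prod_meas1 i) E.
Qed.

(** * Independent coordinates and resampling *)

Section TupleLaw.
Context d (V : measurableType d) (R : realType) (N : nat).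
Local Notation E := (N.-tuple V).

Definition box (B : 'I_N -> set V) : set E := [set x | forall i, B i (tnth x i)].

Lemma boxE B : box B = \big[setI/setT]_(i < N) [set x | B i (tnth x i)].
Proof.
apply/seteqP; split=> x /=.
  by move=> h; rewrite -bigcap_seq => i _; exact: h.
by rewrite -bigcap_seq => h i; apply: h => /=; rewrite mem_index_enum.
Qed.

Lemma measurable_box B : (forall i, measurable (B i)) -> measurable (box B).
Proof.
move=> mB; rewrite boxE; apply: bigsetI_measurable => i _.
by rewrite -[X in measurable X]setTI; apply: measurable_tnth.
Qed.

Definition boxes : set (set E) := [set box B | B in [set B | forall i, measurable (B i)]].

Lemma measurable_boxes : @measurable _ E = <<s boxes >>.
Proof.
apply/seteqP; split; last first.
  apply: smallest_sub; first exact: sigma_algebra_measurable.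
  by move=> _ [B mB <-]; exact: measurable_box.
apply: smallest_sub; first exact: smallest_sigma_algebra.
move=> A; rewrite -bigcup_seq => -[i _ [B mB <-]].
apply: sub_sigma_algebra; rewrite setTI.
exists (fun j => if j == i then B else setT) => [j /=|]; first by case: eqP.
apply/seteqP; split=> x /=; first by move=> /(_ i); rewrite eqxx.
by move=> Bx j; case: eqP => // ->.
Qed.

(** Boxes are stable under intersection and generate the product sigma-algebra. *)
Lemma box_measure_unique (m1 m2 : {measure set E -> \bar R}) :
  (forall B, (forall i, measurable (B i)) -> m1 (box B) = m2 (box B)) ->
  (m1 setT < +oo)%E -> forall A, measurable A -> m1 A = m2 A.
Proof.
move=> h fin; have bT : box (fun=> setT) = setT by apply/seteqP; split.
apply: (measure_unique boxes (fun=> setT)) => //.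
- exact: measurable_boxes.
- move=> _ _ [B mB <-] [B' mB' <-]; exists (fun i => B i `&` B' i) => [i /=|].
    exact: measurableI.
  by apply/seteqP; split=> x /= => [hx|[hx hx'] i]; [split=> i; case: (hx i)|split].
- by move=> _; exists (fun=> setT) => //=.
- by rewrite bigcup_const//; exists 0%N.
- by move=> _ [B mB <-]; exact: h.
Qed.

(** With [y] an independent copy of [x], this resamples the coordinates outside [S]; integrating
    over [y] is then the conditional expectation given the coordinates in [S]. *)
Definition mix (S : {set 'I_N}) (x y : E) : E :=
  [tuple if i \in S then tnth x i else tnth y i | i < N].

Lemma tnth_mix S x y i : tnth (mix S x y) i = if i \in S then tnth x i else tnth y i.
Proof. by rewrite tnth_mktuple. Qed.

Lemma measurable_mix S : measurable_fun setT (fun xy : E * E => mix S xy.1 xy.2).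
Proof.
apply/measurable_fun_tnthP => i.
have -> : (@tnth _ V ^~ i) \o (fun xy : E * E => mix S xy.1 xy.2) =
  if i \in S then (@tnth _ V ^~ i) \o fst else (@tnth _ V ^~ i) \o snd.
  by apply/funext => xy /=; rewrite tnth_mix; case: ifP.
case: ifP => _; apply: measurableT_comp;
  by [exact: measurable_tnth|exact: measurable_fst|exact: measurable_snd].
Qed.

Variable mu : probability E R.

Definition independent_coordinates := forall B, (forall i, measurable (B i)) ->
  mu (box B) = (\prod_(i < N) mu [set x | B i (tnth x i)])%E.

Hypothesis indep : independent_coordinates.

(** It suffices to compare on boxes, whose preimage is a product of two boxes; at each coordinate
    one of the two factors is the full space, of mass 1. *)
Lemma mix_invariant S A : measurable A ->
  (mu \x mu)%E [set xy | A (mix S xy.1 xy.2)] = mu A.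
Proof.
move=> mA; have mm := measurable_mix S.
have := @box_measure_unique (image_law (mu \x mu)%E mm) mu _ _ A mA; apply.
  move=> B mB.
  pose B1 i := if i \in S then B i else setT.
  pose B2 i := if i \in S then setT else B i.
  transitivity ((mu \x mu)%E (box B1 `*` box B2)).
    rewrite /= /image_law /pushforward; congr (_ _); apply/seteqP; split=> [[x y]|[x y]] /=.
      by move=> h; split=> i; move: (h i); rewrite /= tnth_mix /B1 /B2; case: ifP.
    by move=> [h1 h2] i; move: (h1 i) (h2 i); rewrite /= tnth_mix /B1 /B2; case: ifP.
  have mB1 i : measurable (B1 i) by rewrite /B1; case: ifP.
  have mB2 i : measurable (B2 i) by rewrite /B2; case: ifP.
  transitivity (mu (box B1) * mu (box B2))%E.
    by apply: product_measure1E; exact: measurable_box.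
  rewrite !indep// -big_split/=.
  etransitivity; last exact/esym/(indep mB).
  apply: eq_bigr => i _.
  rewrite /B1 /B2; case: ifP => _; rewrite ?mul1e ?mule1//.
  + by rewrite [X in (_ * X)%E](_ : _ = 1%E) ?mule1// -(@probability_setT _ _ _ mu).
  + by rewrite [X in (X * _)%E](_ : _ = 1%E) ?mul1e// -(@probability_setT _ _ _ mu).
by rewrite (le_lt_trans (probability_le1 _ measurableT))// ltry.
Qed.

(** The tower property for the conditional expectation given the coordinates in [S]. *)
Lemma Ex_mix S (F : E -> R) : measurable_fun setT F -> bounded F ->
  Ex mu F = Ex mu (fun x => Ex mu (fun y => F (mix S x y))).
Proof.
move=> mF bF; have mm := measurable_mix S.
have mFm : measurable_fun setT (fun xy : E * E => F (mix S xy.1 xy.2)).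
  exact: (measurableT_comp mF mm).
have bFm : bounded (fun xy : E * E => F (mix S xy.1 xy.2)).
  by case: bF => M h; exists M.
have [<- _] := Ex_prod mu mu mFm bFm.
rewrite /Ex /Rintegral; congr fine.
rewrite (eq_measure_integral (image_law (mu \x mu)%E mm)); last first.
  by move=> A mA _; exact/esym/(mix_invariant S mA).
rewrite integral_pushforward//.
- exact/measurable_EFinP.
- exact: intble_bounded.
Qed.

Lemma measurable_Ex_mix S (F : E -> R) : measurable_fun setT F -> bounded F ->
  measurable_fun setT (fun x => Ex mu (fun y => F (mix S x y))).
Proof.
move=> mF bF; have mm := measurable_mix S.
have mFm : measurable_fun setT (fun xy : E * E => F (mix S xy.1 xy.2)).
  exact: (measurableT_comp mF mm).
have bFm : bounded (fun xy : E * E => F (mix S xy.1 xy.2)).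
  by case: bF => M h; exists M.
by have [] := Ex_prod mu mu mFm bFm.
Qed.

Definition depends_on (S : {set 'I_N}) (F : E -> R) := forall x y, F (mix S x y) = F x.

(** Under [mix] the product becomes [u x * v y] on the product space, where Fubini applies.
    Integrability of [u] in place of boundedness admits matrix entries and their squares. *)
Lemma Ex_indepM S (u v : E -> R) : intble mu u ->
  measurable_fun setT v -> bounded v -> depends_on S u ->
  (forall x y, v (mix S x y) = v y) ->
  Ex mu (fun x => u x * v x) = Ex mu u * Ex mu v.
Proof.
move=> iu mv bv uS vS; have mm := measurable_mix S.
have iuv : intble mu (fun x => u x * v x) by exact: intbleM_bounded.
have muv := intble_meas iuv.
have iv : intble mu v by exact: intble_bounded.
have iuvm : intble (mu \x mu)%E (fun xy => u xy.1 * v xy.2).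
  have UV xy : u xy.1 * v xy.2 = (fun x => u x * v x) (mix S xy.1 xy.2) by rewrite uS vS.
  have mE : measurable_fun setT (fun xy : E * E => u xy.1 * v xy.2).
    by rewrite (funext UV); exact: (measurableT_comp muv mm).
  apply/integrableP; split; first exact/measurable_EFinP.
  have /integrableP[_] := iuv.
  rewrite (eq_measure_integral (image_law (mu \x mu)%E mm)); last first.
    by move=> A mA _; exact/esym/(mix_invariant S mA).
  rewrite ge0_integral_pushforward//.
    apply: le_lt_trans; rewrite le_eqVlt; apply/orP; left; apply/eqP.
    by apply: eq_integral => xy _ /=; rewrite uS vS.
  by apply: measurableT_comp => //; exact/measurable_EFinP.
have -> : Ex mu (fun x => u x * v x) = Ex (mu \x mu)%E (fun xy => u xy.1 * v xy.2).
  rewrite /Ex /Rintegral; congr fine.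
  rewrite (eq_measure_integral (image_law (mu \x mu)%E mm)); last first.
    by move=> A mA _; exact/esym/(mix_invariant S mA).
  rewrite integral_pushforward//.
  - by apply: eq_integral => xy _ /=; rewrite uS vS.
  - exact/measurable_EFinP.
  - apply: eq_integrable iuvm => // xy _ /=; by rewrite uS vS.
rewrite {1}/Ex /Rintegral -(integral12_prod_meas1 iuvm) /fubini_F /=.
rewrite mulrC -ExZ// /Ex /Rintegral; congr fine; apply: eq_integral => x _.
by rewrite (EFin_Ex (intbleZ _ iv)) ExZ// mulrC.
Qed.

End TupleLaw.

(** * Fourth moment of a martingale with bounded increments *)

Section Martingale.
Context d (V : measurableType d) (R : realType) (N : nat).
Local Notation E := (N.-tuple V).
Variable mu : probability E R.
Hypothesis indep : independent_coordinates mu.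

Lemma mixK (S S' : {set 'I_N}) (x y z : E) : S \subset S' -> mix S (mix S' x y) z = mix S x z.
Proof.
move=> /fintype.subsetP SS'; apply: eq_from_tnth => i; rewrite !tnth_mix.
by case: ifP => // iS; rewrite SS'.
Qed.

Variables (F : E -> R) (n : nat) (S : nat -> {set 'I_N}) (c : R).
Hypotheses (mF : measurable_fun setT F) (bF : bounded F).
Hypothesis S0 : S 0 = finset.set0.
Hypothesis Sn : S n = [set: 'I_N]%SET.
Hypothesis Smono : forall k, S k \subset S k.+1.
Hypothesis c0 : 0 <= c.
Hypothesis Fc : forall k x y, (forall i, i \notin S k.+1 :\: S k -> tnth x i = tnth y i) ->
  `|F x - F y| <= c.

Let M k x := Ex mu (fun y => F (mix (S k) x y)) - Ex mu F.

Let mM k : measurable_fun setT (M k).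
Proof.
by apply: measurable_funB; [exact: measurable_Ex_mix|exact: measurable_cst].
Qed.

Let iFx k x : intble mu (fun y => F (mix (S k) x y)).
Proof.
apply: intble_bounded; last by case: bF => K h; exists K.
have := measurableT_comp mF (measurable_mix (S k)).
by move=> /measurable_fun_pair2; apply.
Qed.

Let iF : intble mu F. Proof. exact: intble_bounded. Qed.

Let bM k : bounded (M k).
Proof.
case: bF => K h; exists (K + K) => x; rewrite (le_trans (ler_normB _ _))//.
by rewrite lerD// Ex_bound.
Qed.

Let Mdiff k x : `|M k.+1 x - M k x| <= c.
Proof.
rewrite /M opprB addrA subrK -ExB; [|exact: iFx..].
apply: Ex_bound => [|y]; first by apply: intbleB; exact: iFx.
apply: (@Fc k) => i; rewrite !tnth_mix finset.in_setD negb_and negbK => /orP[iS|/negbTE iS].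
  by rewrite iS (fintype.subsetP (Smono k) _ iS).
by rewrite iS; case: ifP => // /(fintype.subsetP (Smono k)); rewrite iS.
Qed.

Let bpow j (G : E -> R) : bounded G -> bounded (fun x => G x ^+ j).
Proof. by move=> [K h]; exists (K ^+ j) => x; rewrite normrX lerXn2r// ?nnegrE// (le_trans _ (h x)). Qed.

Let ipow j k : intble mu (fun x => M k x ^+ j).
Proof. by apply: intble_bounded; [exact: measurable_funX|exact/bpow/bM]. Qed.

Let bmul (G H : E -> R) : bounded G -> bounded H -> bounded (fun x => G x * H x).
Proof.
move=> [K h] [K' h']; exists (K * K') => x.
by rewrite normrM ler_pM.
Qed.

(** For every [l] with [S k] inside [S l], the integral of [M k ^+ j * M l] has the value given in
    [H], which does not mention [l]; the cases [l = k] and [l = k.+1] are subtracted. *)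
Let orth j k : Ex mu (fun x => M k x ^+ j * (M k.+1 x - M k x)) = 0.
Proof.
have H l : (S k \subset S l) -> Ex mu (fun x => M k x ^+ j * M l x) =
    Ex mu (fun x => M k x ^+ j * F x) - Ex mu F * Ex mu (fun x => M k x ^+ j).
  move=> kl; pose H x := M k x ^+ j * F x.
  have -> : Ex mu H = Ex mu (fun x => M k x ^+ j * Ex mu (fun y => F (mix (S l) x y))).
    rewrite (Ex_mix indep (S l)).
    - apply: (congr1 (Ex mu)); apply/funext => x; rewrite -(ExZ _ (iFx l x)).
      apply: (congr1 (Ex mu)); apply/funext => y; rewrite /H.
      suff -> : M k (mix (S l) x y) = M k x by [].
      rewrite /M; congr (_ - _); apply: (congr1 (Ex mu)).
      by apply/funext => z; rewrite mixK.
    - by apply: measurable_funM => //; exact: measurable_funX.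
    - by apply: bmul => //; exact/bpow/bM.
  rewrite -ExZ// -ExB; last 2 first.
  - apply: intbleM_bounded => //; first exact: measurable_Ex_mix.
    by case: bF => K h; exists K => x; apply: Ex_bound.
  - exact: intbleZ.
  by apply: (congr1 (Ex mu)); apply/funext => x; rewrite /M; ring.
under eq_fun do rewrite mulrBr.
rewrite ExB; last 2 first.
- by apply: intbleM_bounded.
- by apply: intbleM_bounded.
by rewrite !H// subrr.
Qed.

Let M0 x : M 0 x = 0.
Proof.
rewrite /M S0; apply/eqP; rewrite subr_eq0; apply/eqP; apply: (congr1 (Ex mu)).
by apply/funext => y; congr F; apply: eq_from_tnth => i; rewrite tnth_mix inE.
Qed.

Let Mn x : M n x = F x - Ex mu F.
Proof.
rewrite /M Sn; congr (_ - _); rewrite -[RHS](Ex_cst mu); apply: (congr1 (Ex mu)).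
by apply/funext => y; congr F; apply: eq_from_tnth => i; rewrite tnth_mix inE.
Qed.

Let second k : Ex mu (fun x => M k x ^+ 2) <= k%:R * c ^+ 2.
Proof.
elim: k => [|k ih].
  by rewrite mul0r; under eq_fun do rewrite M0 expr0n; rewrite Ex_cst.
apply: (@le_trans _ _ (Ex mu (fun x => (M k x ^+ 2 + 2 * (M k x ^+ 1 * (M k.+1 x - M k x))) + c ^+ 2))).
  apply: Ex_le => //.
    apply: intbleD; last exact: intble_cst.
    apply: intbleD => //; apply: intbleZ; apply: intbleM_bounded => //.
      exact: measurable_funB.
    by exists c => x; exact: Mdiff.
  move=> x; have := Mdiff k x; rewrite ler_norml => /andP[h1 h2].
  rewrite -subr_ge0; have : 0 <= (c - (M k.+1 x - M k x)) * (c + (M k.+1 x - M k x)).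
    by apply: mulr_ge0; lra.
  by rewrite expr1; nra.
have iMd : intble mu (fun x => M k x ^+ 1 * (M k.+1 x - M k x)).
  apply: intbleM_bounded => //; first exact: measurable_funB.
  by exists c => x; exact: Mdiff.
rewrite ExD; [|by apply: intbleD => //; exact: intbleZ|exact: intble_cst].
rewrite ExD//; last exact: intbleZ.
rewrite ExZ// orth mulr0 addr0 Ex_cst -natr1 mulrDl mul1r.
by rewrite lerD2r.
Qed.

(** For an increment [e] with [|e| <= c], the inequality [2 a e^3 <= a^2 e^2 + e^4] yields [(a +
    e)^4 <= a^4 + 4 a^3 e + 8 c^2 a^2 + 3 c^4]. The cubic term has mean zero, and [second] leaves
    [(8 k + 3) c^4], below the growth [(8 k + 4) c^4] of [4 k^2 c^4]. *)
Let fourth k : Ex mu (fun x => M k x ^+ 4) <= 4 * k%:R ^+ 2 * c ^+ 4.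
Proof.
elim: k => [|k ih].
  rewrite expr0n/= mulr0 mul0r; under eq_fun do rewrite M0 expr0n; by rewrite Ex_cst.
have iMd j : intble mu (fun x => M k x ^+ j * (M k.+1 x - M k x)).
  apply: intbleM_bounded => //; first exact: measurable_funB.
  by exists c => x; exact: Mdiff.
apply: (@le_trans _ _ (Ex mu (fun x => (M k x ^+ 4 + 4 * (M k x ^+ 3 * (M k.+1 x - M k x)))
   + (8 * c ^+ 2 * M k x ^+ 2 + 3 * c ^+ 4)))).
  apply: Ex_le => //.
    apply: intbleD; first by apply: intbleD => //; exact: intbleZ.
    by apply: intbleD; [exact: intbleZ|exact: intble_cst].
  move=> x; have := Mdiff k x; move: (M k.+1 x) (M k x) => b a.
  set e := b - a; have -> : b = a + e by rewrite /e; ring.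
  rewrite ler_norml => /andP[h1 h2].
  have e2 : e ^+ 2 <= c ^+ 2.
    rewrite -subr_ge0; have : 0 <= (c - e) * (c + e) by apply: mulr_ge0; lra.
    by nra.
  have a2 := sqr_ge0 a; have ee := sqr_ge0 e; have cc := sqr_ge0 c.
  have e4 : e ^+ 4 <= c ^+ 4.
    have -> : e ^+ 4 = (e ^+ 2) ^+ 2 by ring.
    have -> : c ^+ 4 = (c ^+ 2) ^+ 2 by ring.
    by rewrite lerXn2r.
  have a2e2 : a ^+ 2 * e ^+ 2 <= a ^+ 2 * c ^+ 2 by rewrite ler_wpM2l.
  have ae3 : 2 * (a * e ^+ 3) <= a ^+ 2 * e ^+ 2 + e ^+ 4.
    by have := sqr_ge0 (a * e - e ^+ 2); nra.
  have -> : (a + e) ^+ 4 = a ^+ 4 + 4 * (a ^+ 3 * e) + 6 * (a ^+ 2 * e ^+ 2) +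
     4 * (a * e ^+ 3) + e ^+ 4 by ring.
  lra.
rewrite ExD; last 2 first.
- by apply: intbleD => //; exact: intbleZ.
- by apply: intbleD; [exact: intbleZ|exact: intble_cst].
rewrite ExD//; last exact: intbleZ.
rewrite ExD//; last 2 first.
- exact: intbleZ.
- exact: intble_cst.
rewrite Ex_cst (ExZ 4 (iMd 3)) (ExZ _ (ipow 2 k)) orth mulr0 addr0.
have := second k.
set s := Ex mu _ => hs.
have c2 := sqr_ge0 c.
have h8 : 8 * c ^+ 2 * s <= 8 * c ^+ 2 * (k%:R * c ^+ 2) by rewrite ler_wpM2l// mulr_ge0.
have e8 : 8 * c ^+ 2 * (k%:R * c ^+ 2) = 8 * k%:R * c ^+ 4 by ring.
rewrite e8 in h8.
have -> : 4 * k.+1%:R ^+ 2 * c ^+ 4 = 4 * k%:R ^+ 2 * c ^+ 4 + 8 * k%:R * c ^+ 4 + 4 * c ^+ 4.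
  by rewrite -natr1; ring.
have : 0 <= c ^+ 4 by rewrite exprn_ge0.
move: ih; lra.
Qed.

(* Doob martingale with increments bounded by [c]; conditional expectations
   are integrals over an independent copy of the remaining coordinates. *)
Lemma bounded_difference_fourth_moment :
  Ex mu (fun x => (F x - Ex mu F) ^+ 4) <= 4 * n%:R ^+ 2 * c ^+ 4.
Proof. by have := fourth n; under eq_fun do rewrite Mn. Qed.

End Martingale.

(** * Concentration of the normalized trace *)

Section ComplexMeasurability.
Context {d} {T : measurableType d} {R : realType}.
Implicit Types f g : T -> R[i].

Lemma cmeasurable_cst (c : R[i]) : cmeasurable (fun _ : T => c).
Proof. by split; exact: measurable_cst. Qed.

Lemma cmeasurableD f g : cmeasurable f -> cmeasurable g ->
  cmeasurable (fun x => f x + g x).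
Proof.
move=> [f1 f2] [g1 g2]; split.
  by under eq_fun do rewrite cReD; exact: measurable_funD.
by under eq_fun do rewrite cImD; exact: measurable_funD.
Qed.

Lemma cmeasurableM f g : cmeasurable f -> cmeasurable g ->
  cmeasurable (fun x => f x * g x).
Proof.
move=> [f1 f2] [g1 g2]; split.
  under eq_fun do rewrite cReM.
  by apply: measurable_funB; exact: measurable_funM.
under eq_fun do rewrite cImM.
by apply: measurable_funD; exact: measurable_funM.
Qed.

Lemma cmeasurableN f : cmeasurable f -> cmeasurable (fun x => - f x).
Proof.
move=> mf; under eq_fun do rewrite -mulN1r.
by apply: cmeasurableM => //; exact: cmeasurable_cst.
Qed.

Lemma cmeasurableB f g : cmeasurable f -> cmeasurable g ->
  cmeasurable (fun x => f x - g x).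
Proof. by move=> mf mg; apply: cmeasurableD => //; exact: cmeasurableN. Qed.

Lemma cmeasurable_conjc f : cmeasurable f -> cmeasurable (fun x => conjc (f x)).
Proof.
move=> [f1 f2]; split; first by under eq_fun do rewrite cReJ.
by under eq_fun do rewrite cImJ; exact: measurable_funN.
Qed.

Lemma cmeasurable_sum (I : Type) (r : seq I) (P : pred I) (F : I -> T -> R[i]) :
  (forall i, cmeasurable (F i)) -> cmeasurable (fun x => \sum_(i <- r | P i) F i x).
Proof.
move=> h; elim: r => [|i r ih].
  by under eq_fun do rewrite big_nil; exact: cmeasurable_cst.
under eq_fun do rewrite big_cons; case: (P i) => //.
exact: cmeasurableD.
Qed.

Lemma cmeasurable_prod (I : Type) (r : seq I) (P : pred I) (F : I -> T -> R[i]) :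
  (forall i, cmeasurable (F i)) -> cmeasurable (fun x => \prod_(i <- r | P i) F i x).
Proof.
move=> h; elim: r => [|i r ih].
  by under eq_fun do rewrite big_nil; exact: cmeasurable_cst.
under eq_fun do rewrite big_cons; case: (P i) => //.
exact: cmeasurableM.
Qed.

Lemma measurable_funV (f : T -> R) : (forall x, 0 <= f x) ->
  measurable_fun setT f -> measurable_fun setT (fun x => (f x)^-1).
Proof.
move=> f0 mf.
have -> : (fun x => (f x)^-1) = (@powR R ^~ (-1)) \o f.
  apply/funext => x /=; have := f0 x; rewrite le_eqVlt => /predU1P[<-|fx].
    by rewrite invr0 powR0// oppr_eq0 oner_eq0.
  by rewrite powR_inv1// ltW.
by apply: measurableT_comp => //; exact: measurable_powR.
Qed.

Lemma cmeasurableV f : cmeasurable f -> cmeasurable (fun x => (f x)^-1).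
Proof.
move=> [f1 f2].
have mN : measurable_fun setT (fun x => (cabs (f x) ^+ 2)^-1).
  apply: measurable_funV => [x|]; first exact: sqr_ge0.
  under eq_fun do rewrite cabs_sqr.
  by apply: measurable_funD; exact: measurable_funX.
have E x : (f x)^-1 = ((cabs (f x) ^+ 2)^-1)%:C%C * conjc (f x).
  have [->|fx] := eqVneq (f x) 0; first by rewrite invr0 conjc0 mulr0.
  apply: (mulfI fx); rewrite divff// mulrCA mulcJ -rmorphM mulVf//.
  by rewrite sqrf_eq0 cabs_eq0.
under eq_fun do rewrite E.
apply: cmeasurableM; last exact: cmeasurable_conjc.
by split => //=; exact: measurable_cst.
Qed.

Lemma cmeasurable_det n (A : T -> 'M[R[i]]_n) :
  (forall i j, cmeasurable (fun x => A x i j)) -> cmeasurable (fun x => \det (A x)).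
Proof.
move=> mA; rewrite /determinant; apply: cmeasurable_sum => s.
apply: cmeasurableM; first exact: cmeasurable_cst.
by apply: cmeasurable_prod => i; exact: mA.
Qed.

(** Cramer's rule: each entry is a cofactor divided by a determinant, and the shifted matrix is
    always invertible. *)
Lemma cmeasurable_resolvent (eta : R) n (A : T -> 'M[R[i]]_n) : 0 < eta ->
  (forall i j, cmeasurable (fun x => A x i j)) -> (forall x, is_hermitian (A x)) ->
  forall i j, cmeasurable (fun x => resolvent eta (A x) i j).
Proof.
move=> eta0 mA hA i j.
pose B x := A x - (Complex 0 eta)%:M.
have mB k l : cmeasurable (fun x => B x k l).
  have -> : (fun x => B x k l) = (fun x => A x k l - (Complex 0 eta)%:M k l).
    by apply/funext => x; rewrite !mxE.
  by apply: cmeasurableB => //; exact: cmeasurable_cst.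
have -> : (fun x => resolvent eta (A x) i j) =
    (fun x => (\det (B x))^-1 * ((-1) ^+ (j + i) * \det (row' j (col' i (B x))))).
  by apply/funext => x; rewrite /resolvent /invmx shifted_unit// !mxE.
apply: cmeasurableM; first by apply: cmeasurableV; exact: cmeasurable_det.
apply: cmeasurableM; first exact: cmeasurable_cst.
apply: cmeasurable_det => k l.
have -> : (fun x => row' j (col' i (B x)) k l) = (fun x => B x (lift j k) (lift i l)).
  by apply/funext => x; rewrite mxE mxE.
exact: mB.
Qed.

Lemma measurable_cabs f : cmeasurable f -> measurable_fun setT (fun x => cabs (f x)).
Proof.
move=> [f1 f2]; rewrite /cabs.
apply: (measurableT_comp (f := @Num.sqrt R)).
  by apply: continuous_measurable_fun; exact: sqrt_continuous.
by apply: measurable_funD; exact: measurable_funX.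
Qed.

End ComplexMeasurability.

(** * Hermitian matrices as functions of independent coordinates *)

Section HermitianModel.
Context {R : realType} {n : nat}.
Local Notation N := #|{: 'I_n * 'I_n}|.
Local Notation E := (N.-tuple (R * R)%type).

Definition entry (x : E) (i j : 'I_n) : R * R := tnth x (enum_rank (i, j)).

(* The upper triangular coordinates determine a Hermitian matrix; the
   coordinates below the diagonal and the imaginary parts of the diagonal ones
   are ignored. *)
Definition hmatrix (x : E) : 'M[R[i]]_n := \matrix_(i, j)
  if (i < j)%N then Complex (entry x i j).1 (entry x i j).2 else
  if (j < i)%N then Complex (entry x j i).1 (- (entry x j i).2) else
  Complex (entry x i i).1 0.

Lemma hermitian_hmatrix x : is_hermitian (hmatrix x).
Proof.
move=> i j; rewrite !mxE; case: (ltngtP i j) => [||/val_inj ->] //=.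
- by rewrite opprK.
- by rewrite oppr0.
Qed.

Lemma measurable_entry i j :
  measurable_fun setT (fun x : E => (entry x i j).1) /\
  measurable_fun setT (fun x : E => (entry x i j).2).
Proof.
by split; apply: measurableT_comp => //; exact: measurable_tnth.
Qed.

Lemma cmeasurable_hmatrix i j : cmeasurable (fun x => hmatrix x i j).
Proof.
have -> : (fun x : E => hmatrix x i j) = (fun x =>
  if (i < j)%N then Complex (entry x i j).1 (entry x i j).2 else
  if (j < i)%N then Complex (entry x j i).1 (- (entry x j i).2) else
  Complex (entry x i i).1 0) by apply/funext => x; rewrite mxE.
have [m1 m2] := measurable_entry i j; have [m3 m4] := measurable_entry j i.
have [m5 m6] := measurable_entry i i.
case: (i < j)%N; first by split.
case: (j < i)%N; first by split => //=; exact: measurable_funN.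
by split => //=; exact: measurable_cst.
Qed.

Lemma cmeasurable_resolvent_hmatrix (eta : R) : 0 < eta -> forall i j,
  cmeasurable (fun x : E => resolvent eta (hmatrix x) i j).
Proof.
move=> eta0; apply: cmeasurable_resolvent => //; first exact: cmeasurable_hmatrix.
exact: hermitian_hmatrix.
Qed.

(** The filtration of the martingale. [hmatrix] reads an entry at the pair with the smaller index
    first, so the coordinates that enter at step [k] affect only row and column [k]. *)
Definition rows_below (k : nat) : {set 'I_N} := [set e : 'I_N | ((enum_val e).1 < k)%N]%SET.

Lemma hmatrix_row_local k (x y : E) :
  (forall e, e \notin rows_below k.+1 :\: rows_below k -> tnth x e = tnth y e) ->
  forall i j : 'I_n, val i != k -> val j != k -> hmatrix x i j = hmatrix y i j.
Proof.
move=> xy i j ik jk.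
have ent (a b : 'I_n) : val a != k -> entry x a b = entry y a b.
  move=> ak; apply: xy; rewrite !inE enum_rankK /= ltnS.
  by rewrite -leqNgt -eqn_leq eq_sym.
by rewrite !mxE !ent.
Qed.

Definition ntrace (eta : R) (x : E) : R[i] := \tr (resolvent eta (hmatrix x)) / n%:R.

Lemma cmeasurable_ntrace (eta : R) : 0 < eta -> cmeasurable (ntrace eta).
Proof.
move=> eta0; apply: cmeasurableM; last exact: cmeasurable_cst.
by apply: cmeasurable_sum => i; exact: cmeasurable_resolvent_hmatrix.
Qed.

Lemma cabs_natV (k : nat) : cabs ((k%:R)^-1 : R[i]) = k%:R^-1.
Proof.
rewrite cabsV; congr (_^-1).
by rewrite -(rmorph_nat (real_complex R)) cabs_real ger0_norm.
Qed.

Lemma cabs_ntrace (eta : R) x : 0 < eta -> cabs (ntrace eta x) <= eta^-1.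
Proof.
move=> eta0; rewrite cabsM cabs_natV.
have [n0|n0] := posnP n; first by rewrite (_ : n%:R^-1 = 0) ?mulr0 ?invr_ge0 ?ltW// n0 invr0.
rewrite ler_pdivrMr ?ltr0n// (le_trans (cabs_sum _ _ _))//.
apply: (@le_trans _ _ (\sum_(i < n) eta^-1)).
  by apply: ler_sum => i _; apply: cabs_resolvent => //; exact: hermitian_hmatrix.
by rewrite sumr_const card_ord mulr_natr.
Qed.

Lemma ntrace_bounded_difference (eta : R) k (x y : E) : 0 < eta ->
  (forall e, e \notin rows_below k.+1 :\: rows_below k -> tnth x e = tnth y e) ->
  cabs (ntrace eta x - ntrace eta y) <= 2 / eta / n%:R.
Proof.
move=> eta0 xy; have h := hmatrix_row_local xy.
rewrite /ntrace -mulrBl cabsM cabs_natV; have [kn|kn] := ltnP k n.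
  rewrite ler_wpM2r// ?invr_ge0//.
  apply: (@trace_resolvent_bounded_difference R eta eta0 n _ _ (Ordinal kn)) => //;
    by [exact: hermitian_hmatrix|move=> i j ik jk; apply: h].
(* For [k >= n] there is no row [k] to change, and the two matrices agree. *)
have -> : hmatrix x = hmatrix y.
  apply/matrixP => i j; apply: h.
  - by rewrite neq_ltn (leq_trans (ltn_ord i) kn).
  - by rewrite neq_ltn (leq_trans (ltn_ord j) kn).
by rewrite subrr cabs0 mul0r !mulr_ge0 ?invr_ge0// ltW.
Qed.

Variable mu : probability E R.
Hypothesis indep : independent_coordinates mu.

(** [f] stands for the real or the imaginary part. There are [n] martingale steps with increments at
    most [c = 2 / (eta n)], and [4 n^2 c^4] is the bound. *)
Lemma ntrace_fourth_moment (eta : R) (f : R[i] -> R) : 0 < eta -> (0 < n)%N ->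
  (forall z z', f (z - z') = f z - f z') -> (forall z, `|f z| <= cabs z) ->
  measurable_fun setT (fun x => f (ntrace eta x)) ->
  Ex mu (fun x => (f (ntrace eta x) - Ex mu (fun y => f (ntrace eta y))) ^+ 4)
    <= 64 / eta ^+ 4 / n%:R ^+ 2.
Proof.
move=> eta0 n0 fB fle mf.
have nN : n%:R != 0 :> R by rewrite pnatr_eq0 -lt0n.
have -> : 64 / eta ^+ 4 / n%:R ^+ 2 = 4 * n%:R ^+ 2 * (2 / eta / n%:R) ^+ 4.
  by field; rewrite nN gt_eqF.
apply: (@bounded_difference_fourth_moment _ _ _ _ _ indep
   (fun x => f (ntrace eta x)) n rows_below).
- exact: mf.
- by exists (eta^-1) => x; rewrite (le_trans (fle _))// cabs_ntrace.
- by apply/setP => e; rewrite !inE ltn0.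
- by apply/setP => e; rewrite !inE ltn_ord.
- by move=> k; apply/fintype.subsetP => e; rewrite !inE => /ltnW; exact.
- by rewrite !mulr_ge0 ?invr_ge0// ltW.
- move=> k x y xy; rewrite -fB (le_trans (fle _))//.
  exact: ntrace_bounded_difference xy.
Qed.

End HermitianModel.

(** * Expansion in a single matrix entry *)

Section EntryExpansion.
Context {R : realType}.
Implicit Types x y z : R[i].

Lemma cabsM_le x y (a b : R) : cabs x <= a -> cabs y <= b -> cabs (x * y) <= a * b.
Proof. by move=> h1 h2; rewrite cabsM ler_pM ?cabs_ge0. Qed.

Lemma cabsD_le x y (a b : R) : cabs x <= a -> cabs y <= b -> cabs (x + y) <= a + b.
Proof. by move=> h1 h2; rewrite (le_trans (cabsD _ _))// lerD. Qed.

Lemma cabsB_le x y (a b : R) : cabs x <= a -> cabs y <= b -> cabs (x - y) <= a + b.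
Proof. by move=> h1 h2; rewrite (le_trans (cabsB _ _))// lerD. Qed.

(** For [i != j], the letters [a], [b], [p], [q] stand for the entries [(j, i)], [(i, j)], [(i, i)],
    [(j, j)] of the resolvent with [W_ij] and [W_ji] set to zero, the primed letters for those of
    the full resolvent; the four identities are instances of [resolvent_entry_expansion]. *)
Variables w a b p q a' b' p' q' m : R[i].
Hypotheses (Ha : a' = a - w * a * a' - conjc w * q * p')
  (Hp : p' = p - w * p * a' - conjc w * b * p')
  (Hq : q' = q - w * a * q' - conjc w * q * b')
  (Hb : b' = b - w * p * q' - conjc w * b * b').
Hypotheses (a1 : cabs a <= 1) (b1 : cabs b <= 1) (p1 : cabs p <= 1) (q1 : cabs q <= 1).
Hypotheses (a'1 : cabs a' <= 1) (b'1 : cabs b' <= 1) (p'1 : cabs p' <= 1) (q'1 : cabs q' <= 1).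
Hypothesis m1 : cabs m <= 1.

Let rho := Num.min (cabs w) 1.

(** For [|w| <= 1] the resolvent identity gives [2 |w|]; for larger [w] both entries are at most 1
    in modulus. The minimum [rho] merges the two cases and keeps the remainders integrable against
    [|w|^2]. *)
Let diff2 x x' u u' v v' : x' = x - w * u * u' - conjc w * v * v' ->
  cabs x <= 1 -> cabs x' <= 1 -> cabs u <= 1 -> cabs u' <= 1 -> cabs v <= 1 -> cabs v' <= 1 ->
  cabs (x' - x) <= 2 * rho.
Proof.
move=> e h1 h2 h3 h4 h5 h6; rewrite /rho; case: (leP (cabs w) 1) => _; last first.
  by rewrite mulr1 (le_trans (cabsB_le h2 h1)).
have -> : x' - x = - (w * u * u') - conjc w * v * v' by rewrite e; ring.
have := @cabsB_le (- (w * u * u')) (conjc w * v * v') (cabs w * 1 * 1) (cabs w * 1 * 1).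
rewrite !mulr1 mulr_natl mulr2n; apply; rewrite ?cabsN.
- by have := cabsM_le (cabsM_le (lexx (cabs w)) h3) h4; rewrite !mulr1.
- have := cabsM_le (cabsM_le (lexx (cabs w)) h5) h6; rewrite !mulr1.
  by rewrite !cabsM cabsJ.
Qed.

Let da : cabs (a' - a) <= 2 * rho. Proof. exact: (diff2 Ha). Qed.
Let dp : cabs (p' - p) <= 2 * rho. Proof. exact: (diff2 Hp). Qed.
Let dq : cabs (q' - q) <= 2 * rho. Proof. exact: (diff2 Hq). Qed.
Let db : cabs (b' - b) <= 2 * rho. Proof. exact: (diff2 Hb). Qed.

Let rho0 : 0 <= rho. Proof. by rewrite /rho le_min cabs_ge0 ler01. Qed.
Let rho1 : rho <= 1. Proof. by rewrite /rho ge_min lexx orbT. Qed.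

Let cD := conjc (p - m).
Let cD' := conjc (p' - m).
(* Entries of the resolvent before ([a, b, p, q]) and after ([a', b', p', q'])
   inserting the matrix entry [w]: [second_order_ww] and [second_order_wwc] are
   the coefficients of [w^2] and [|w|^2] in [w a' conj (p' - m)]. *)
Definition second_order_ww := - (a * a * conjc (p - m)) - a * conjc b * conjc p.
Definition second_order_wwc := - (q * p * conjc (p - m)) - a * conjc p * conjc a.
Definition expansion_rest := w * a' * conjc (p' - m) - w * (a * conjc (p - m))
  - w ^+ 2 * second_order_ww - ((cabs w ^+ 2)%:C)%C * second_order_wwc.

Let D2 : cabs cD <= 2. Proof. by rewrite cabsJ; exact: cabsB_le. Qed.
Let D'2 : cabs cD' <= 2. Proof. by rewrite cabsJ; exact: cabsB_le. Qed.
Let dD : cabs (cD' - cD) <= 2 * rho.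
Proof. by rewrite /cD' /cD -rmorphB/= cabsJ (_ : _ - _ = p' - p)//; ring. Qed.

(** Substituting the resolvent identity once in [a'] and once in [conj (p' - m)] leaves four terms,
    each with two factors [w] or [conj w] and a difference between primed and unprimed entries; they
    contribute [6 + 6 + 2 + 2]. *)
Lemma expansion_restP : cabs expansion_rest <= 16 * (cabs w ^+ 2 * rho).
Proof.
have cDE : cD' = cD - conjc w * conjc p * conjc a' - w * conjc b * conjc p'.
  rewrite /cD' {1}Hp /cD -(conjcK w) -!rmorphM/= -!rmorphB/= conjcK.
  by congr conjc; ring.
have -> : expansion_rest = - (w ^+ 2 * a) * (a' * cD' - a * cD)
   - (w * conjc w) * q * (p' * cD' - p * cD)
   - (w * conjc w) * (a * conjc p) * (conjc a' - conjc a)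
   - w ^+ 2 * (a * conjc b) * (conjc p' - conjc p).
  rewrite /expansion_rest /second_order_ww /second_order_wwc -mulcJ -/cD -/cD'.
  have -> : w * a' * cD' = w * a * cD' - w * w * a * a' * cD' - w * conjc w * q * p' * cD'.
    by rewrite {1}Ha; ring.
  have -> : w * a * cD' = w * a * (cD - conjc w * conjc p * conjc a' - w * conjc b * conjc p').
    by rewrite {1}cDE.
  by ring.
have d1 : cabs (a' * cD' - a * cD) <= 6 * rho.
  have -> : a' * cD' - a * cD = (a' - a) * cD' + a * (cD' - cD) by ring.
  rewrite (le_trans (cabsD_le (cabsM_le da D'2) (cabsM_le a1 dD)))//; lra.
have d2 : cabs (p' * cD' - p * cD) <= 6 * rho.
  have -> : p' * cD' - p * cD = (p' - p) * cD' + p * (cD' - cD) by ring.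
  rewrite (le_trans (cabsD_le (cabsM_le dp D'2) (cabsM_le p1 dD)))//; lra.
have dac : cabs (conjc a' - conjc a) <= 2 * rho by rewrite -rmorphB/= cabsJ.
have dpc : cabs (conjc p' - conjc p) <= 2 * rho by rewrite -rmorphB/= cabsJ.
have w2 : cabs (w ^+ 2) <= cabs w ^+ 2 by rewrite expr2 cabsM -expr2.
have wwc : cabs (w * conjc w) <= cabs w ^+ 2 by rewrite cabsM cabsJ -expr2.
have pc1 : cabs (conjc p) <= 1 by rewrite cabsJ.
have bc1 : cabs (conjc b) <= 1 by rewrite cabsJ.
have w2a : cabs (- (w ^+ 2 * a)) <= cabs w ^+ 2 * 1 by rewrite cabsN; exact: cabsM_le.
have h := cabsB_le (cabsB_le (cabsB_le (cabsM_le w2a d1)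
  (cabsM_le (cabsM_le wwc q1) d2)) (cabsM_le (cabsM_le wwc (cabsM_le a1 pc1)) dac))
  (cabsM_le (cabsM_le w2 (cabsM_le a1 bc1)) dpc).
by rewrite (le_trans h)//; lra.
Qed.

(** Each product in the coefficient of [w^2] contains two off-diagonal entries, which the Ward
    identities can sum. *)
Lemma second_order_wwP : cabs second_order_ww <= 3 * (cabs a ^+ 2 + cabs b ^+ 2).
Proof.
have h1 : cabs (- (a * a * cD)) <= cabs a * cabs a * 2.
  by rewrite cabsN; apply: cabsM_le => //; exact: cabsM_le.
have h2 : cabs (a * conjc b * conjc p) <= cabs a * cabs b * 1.
  by apply: cabsM_le; [apply: cabsM_le => //; rewrite cabsJ|rewrite cabsJ].
rewrite (le_trans (cabsB_le h1 h2))//.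
have := sqr_ge0 (cabs a - cabs b); have := sqr_ge0 (cabs a); have := sqr_ge0 (cabs b).
by nra.
Qed.

(** The only part of the [|w|^2] coefficient without two off-diagonal factors is
    [- q p conj (p - m)]. It cancels the predicted term up to the change from unprimed to primed
    entries, which costs [2 + 8] times [rho]. *)
Lemma second_order_wwcP :
  cabs (second_order_wwc + p' * q' * conjc (p' - m)) <= cabs a ^+ 2 + 10 * rho.
Proof.
have -> : second_order_wwc + p' * q' * conjc (p' - m) =
   - (a * conjc p * conjc a) + (p' * q' * (cD' - cD) + (p' * (q' - q) + (p' - p) * q) * cD).
  by rewrite /second_order_wwc -/cD -/cD'; ring.
have h1 : cabs (- (a * conjc p * conjc a)) <= cabs a ^+ 2.
  by rewrite cabsN !cabsM !cabsJ mulrAC -expr2 ler_piMr// sqr_ge0.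
have h := cabsD_le h1 (cabsD_le (cabsM_le (cabsM_le p'1 q'1) dD)
  (cabsM_le (cabsD_le (cabsM_le p'1 dq) (cabsM_le dp q1)) D2)).
by rewrite (le_trans h)//; lra.
Qed.

Lemma second_order_ww_le3 : cabs second_order_ww <= 3.
Proof.
have h1 : cabs (- (a * a * cD)) <= 1 * 1 * 2 by rewrite cabsN; exact: cabsM_le (cabsM_le a1 a1) D2.
have h2 : cabs (a * conjc b * conjc p) <= 1 * 1 * 1.
  by apply: cabsM_le; [apply: (cabsM_le a1)|]; rewrite cabsJ.
by rewrite (le_trans (cabsB_le h1 h2))//; lra.
Qed.

Lemma second_order_wwc_le3 : cabs second_order_wwc <= 3.
Proof.
have h1 : cabs (- (q * p * cD)) <= 1 * 1 * 2 by rewrite cabsN; exact: cabsM_le (cabsM_le q1 p1) D2.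
have h2 : cabs (a * conjc p * conjc a) <= 1 * 1 * 1.
  by apply: cabsM_le; [apply: (cabsM_le a1)|]; rewrite cabsJ.
by rewrite (le_trans (cabsB_le h1 h2))//; lra.
Qed.

(** The resolvent with a zeroed entry depends on the pair [(i, j)], so no Ward identity sums it over
    [j]; the full resolvent can be summed. [rho^2 <= rho] keeps the error linear in [rho]. *)
Lemma offdiag_sqr_le : cabs a ^+ 2 + cabs b ^+ 2 <= 2 * (cabs a' ^+ 2 + cabs b' ^+ 2) + 16 * rho.
Proof.
have h x x' : cabs (x' - x) <= 2 * rho -> cabs x ^+ 2 <= 2 * cabs x' ^+ 2 + 8 * rho.
  move=> hd; have : cabs x <= cabs x' + 2 * rho.
    have -> : x = x' - (x' - x) by ring.
    exact: cabsB_le.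
  move=> hx; have x0 := cabs_ge0 x.
  have : cabs x ^+ 2 <= (cabs x' + 2 * rho) ^+ 2 by rewrite lerXn2r ?nnegrE// (le_trans x0).
  have := sqr_ge0 (cabs x' - 2 * rho).
  have : rho * rho <= rho * 1 by rewrite ler_wpM2l.
  by nra.
by have := h _ _ da; have := h _ _ db; lra.
Qed.

End EntryExpansion.

Section SecondOrderMeasurability.
Context {d} {T : measurableType d} {R : realType}.
Variables (a b p q : T -> R[i]) (m : R[i]).
Hypotheses (ma : cmeasurable a) (mb : cmeasurable b) (mp : cmeasurable p) (mq : cmeasurable q).

Let mpm : cmeasurable (fun x => conjc (p x - m)).
Proof. by apply/cmeasurable_conjc/cmeasurableB => //; exact: cmeasurable_cst. Qed.

Lemma cmeasurable_second_order_ww :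
  cmeasurable (fun x => second_order_ww (a x) (b x) (p x) m).
Proof.
apply: cmeasurableB; first by apply: cmeasurableN; exact: cmeasurableM (cmeasurableM ma ma) mpm.
exact: cmeasurableM (cmeasurableM ma (cmeasurable_conjc mb)) (cmeasurable_conjc mp).
Qed.

Lemma cmeasurable_second_order_wwc :
  cmeasurable (fun x => second_order_wwc (a x) (p x) (q x) m).
Proof.
apply: cmeasurableB; first by apply: cmeasurableN; exact: cmeasurableM (cmeasurableM mq mp) mpm.
exact: cmeasurableM (cmeasurableM ma (cmeasurable_conjc mp)) (cmeasurable_conjc ma).
Qed.

End SecondOrderMeasurability.

(** * Means of the terms [W_ij G_ji conj D_i] *)

Section EntryEstimate.
Context {R : realType} {n : nat}.
Local Notation N := #|{: 'I_n * 'I_n}|.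
Local Notation E := (N.-tuple (R * R)%type).

(** The single coordinate from which [hmatrix] reads both entries [(i, j)] and [(j, i)]. *)
Definition coord (i j : 'I_n) : 'I_N := enum_rank (if (i <= j)%N then (i, j) else (j, i)).

Lemma coordC i j : coord i j = coord j i.
Proof.
rewrite /coord; congr enum_rank; case: (ltngtP i j) => // /val_inj ->.
by [].
Qed.

Lemma coord_eq (i j k l : 'I_n) :
  (coord k l == coord i j) = (k == i) && (l == j) || (k == j) && (l == i).
Proof.
apply/eqP/orP => [/enum_rank_inj|[]/andP[/eqP-> /eqP->]//]; last exact: coordC.
by case: leqP => _; case: leqP => _ [-> ->]; rewrite !eqxx; [left|right|right|left].
Qed.

Lemma hmatrix_coord (x y : E) i j : tnth x (coord i j) = tnth y (coord i j) ->
  hmatrix x i j = hmatrix y i j.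
Proof.
by rewrite /coord !mxE /entry; case: (ltngtP i j) => [_|_|/val_inj ->] /= h; rewrite ?h.
Qed.

Lemma hmatrix_coord0 (x : E) i j : tnth x (coord i j) = (0, 0) -> hmatrix x i j = 0.
Proof.
rewrite /coord !mxE /entry; case: (ltngtP i j) => [_|_|/val_inj ->] /= h; rewrite ?h//=.
by rewrite oppr0.
Qed.

Variable mu : probability E R.
Hypothesis indep : independent_coordinates mu.

Lemma intble_cmeasurable (F : E -> R[i]) (K : R) : cmeasurable F ->
  (forall x, cabs (F x) <= K) ->
  [/\ intble mu (fun x => complex.Re (F x)), intble mu (fun x => complex.Im (F x)),
     intble mu (fun x => cabs (F x)) & intble mu (fun x => cabs (F x) ^+ 2)].
Proof.
move=> mF FK; have mc := measurable_cabs mF; case: mF => m1 m2; split.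
- by apply: intble_bounded => //; exists K => x; rewrite (le_trans (normr_Re _)).
- by apply: intble_bounded => //; exists K => x; rewrite (le_trans (normr_Im _)).
- by apply: intble_bounded => //; exists K => x; rewrite ger0_norm ?cabs_ge0.
- apply: intble_bounded; first exact: measurable_funX.
  exists (K ^+ 2) => x; rewrite ger0_norm ?sqr_ge0// lerXn2r// nnegrE ?cabs_ge0//.
  by rewrite (le_trans _ (FK x)) ?cabs_ge0.
Qed.

Lemma norm_Ex_Re (F : E -> R[i]) : intble mu (fun x => complex.Re (F x)) ->
  intble mu (fun x => cabs (F x)) ->
  `|Ex mu (fun x => complex.Re (F x))| <= Ex mu (fun x => cabs (F x)).
Proof.
move=> h1 h2; rewrite (le_trans (norm_Ex h1))//.
by apply: Ex_le; [exact: intble_norm|exact: h2|move=> x; exact: normr_Re].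
Qed.

Lemma norm_Ex_Im (F : E -> R[i]) : intble mu (fun x => complex.Im (F x)) ->
  intble mu (fun x => cabs (F x)) ->
  `|Ex mu (fun x => complex.Im (F x))| <= Ex mu (fun x => cabs (F x)).
Proof.
move=> h1 h2; rewrite (le_trans (norm_Ex h1))//.
by apply: Ex_le; [exact: intble_norm|exact: h2|move=> x; exact: normr_Im].
Qed.

(** Written as a [mix] with a constant tuple, so that its measurability comes from that of [mix].
    The value [(0, 0)] makes the entries [(i, j)] and [(j, i)] of [hmatrix] vanish. *)
Definition zeroed (i j : 'I_n) (x : E) : E :=
  mix (~: [set coord i j]%SET) x [tuple (0, 0) | _ < N].

Lemma measurable_zeroed i j : measurable_fun setT (zeroed i j).
Proof.
have := measurable_mix (V := (R * R)%type) (~: [set coord i j]%SET).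
by move=> /(@measurable_fun_pair1 _ _ _ _ _ _) => /(_ [tuple (0, 0) | _ < N]).
Qed.

Lemma hmatrix_zeroed i j x k l : hmatrix x k l = hmatrix (zeroed i j x) k l +
  (if (k == i) && (l == j) then hmatrix x i j else
   if (k == j) && (l == i) then hmatrix x j i else 0).
Proof.
have := coord_eq i j k l; have [e|ne] := eqVneq (coord k l) (coord i j).
  rewrite [hmatrix (zeroed _ _ _) _ _]hmatrix_coord0 ?add0r; last first.
    by rewrite tnth_mix !inE e eqxx tnth_mktuple.
  by case: ifP => [/andP[/eqP-> /eqP->]//|_ /= /esym h]; rewrite h; case/andP: h => /eqP-> /eqP->.
move=> /esym/norP[/negbTE-> /negbTE->]; rewrite addr0.
by apply: hmatrix_coord; rewrite tnth_mix !inE ne.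
Qed.

(** An entry is independent of the tuple in which it has been erased. [u] is one of the real
    functions [Re w], [Im w], [Re w^2], [Im w^2], [|w|^2] that occur in the expansion. *)
Lemma Ex_entryM i j (u : R[i] -> R) (v : E -> R) :
  intble mu (fun x => u (hmatrix x i j)) -> measurable_fun setT v -> bounded v ->
  Ex mu (fun x => u (hmatrix x i j) * v (zeroed i j x)) =
  Ex mu (fun x => u (hmatrix x i j)) * Ex mu (fun x => v (zeroed i j x)).
Proof.
move=> iu mv bv.
apply: (Ex_indepM (S := [set coord i j]%SET) indep iu (v := fun x => v (zeroed i j x))).
- by apply: (measurableT_comp mv); exact: measurable_zeroed.
- by case: bv => K h; exists K.
- by move=> x y; congr u; apply: hmatrix_coord; rewrite tnth_mix inE eqxx.
- move=> x y; congr v; apply: eq_from_tnth => k; rewrite !tnth_mix !inE.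
  by case: eqP.
Qed.

Variables (eta : R) (m : R[i]).
Hypotheses (eta1 : 1 <= eta) (m1 : cabs m <= 1).
Let eta0 : 0 < eta. Proof. exact: lt_le_trans eta1. Qed.

Lemma cabs_resolvent_le1 (x : E) i j : cabs (resolvent eta (hmatrix x) i j) <= 1.
Proof.
rewrite (le_trans (cabs_resolvent eta0 (hermitian_hmatrix x) i j))//.
by rewrite invf_le1.
Qed.

Local Notation G := (fun x : E => resolvent eta (hmatrix x)).

Variables i j : 'I_n.
Hypothesis iw2 : intble mu (fun x => cabs (hmatrix x i j) ^+ 2).
Hypothesis Rew0 : Ex mu (fun x => complex.Re (hmatrix x i j)) = 0.
Hypothesis Imw0 : Ex mu (fun x => complex.Im (hmatrix x i j)) = 0.
Let S := Ex mu (fun x => cabs (hmatrix x i j) ^+ 2).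
Let w (x : E) := hmatrix x i j.
Let rho (x : E) := Num.min (cabs (w x)) 1.

Let mw : cmeasurable w. Proof. exact: cmeasurable_hmatrix. Qed.
Let mG k l : cmeasurable (fun x => G x k l). Proof. exact: cmeasurable_resolvent_hmatrix. Qed.

Let S0 : 0 <= S. Proof. by apply: Ex_ge0 => x; exact: sqr_ge0. Qed.

Let iRew : intble mu (fun x => complex.Re (w x)).
Proof.
apply: (intble_le (g := fun x => 1 + cabs (w x) ^+ 2)); first by case: mw.
  move=> x; rewrite (le_trans (normr_Re _))//.
  by have := sqr_ge0 (cabs (w x) - 1); have := cabs_ge0 (w x); nra.
by apply: intbleD => //; exact: intble_cst.
Qed.

Let iImw : intble mu (fun x => complex.Im (w x)).
Proof.
apply: (intble_le (g := fun x => 1 + cabs (w x) ^+ 2)); first by case: mw.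
  move=> x; rewrite (le_trans (normr_Im _))//.
  by have := sqr_ge0 (cabs (w x) - 1); have := cabs_ge0 (w x); nra.
by apply: intbleD => //; exact: intble_cst.
Qed.

Let mw2 : cmeasurable (fun x => w x ^+ 2).
Proof. by under eq_fun do rewrite expr2; exact: cmeasurableM. Qed.

Let iRew2 : intble mu (fun x => complex.Re (w x ^+ 2)).
Proof.
apply: (intble_le (g := fun x => cabs (w x) ^+ 2)) => //; first by case: mw2.
by move=> x; rewrite (le_trans (normr_Re _))// expr2 cabsM -expr2.
Qed.

Let iImw2 : intble mu (fun x => complex.Im (w x ^+ 2)).
Proof.
apply: (intble_le (g := fun x => cabs (w x) ^+ 2)) => //; first by case: mw2.
by move=> x; rewrite (le_trans (normr_Im _))// expr2 cabsM -expr2.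
Qed.

Let nRew2 : `|Ex mu (fun x => complex.Re (w x ^+ 2))| <= S.
Proof.
rewrite (le_trans (norm_Ex iRew2))//; apply: Ex_le; [exact: intble_norm|exact: iw2|].
by move=> x; rewrite (le_trans (normr_Re _))// expr2 cabsM -expr2.
Qed.

Let nImw2 : `|Ex mu (fun x => complex.Im (w x ^+ 2))| <= S.
Proof.
rewrite (le_trans (norm_Ex iImw2))//; apply: Ex_le; [exact: intble_norm|exact: iw2|].
by move=> x; rewrite (le_trans (normr_Im _))// expr2 cabsM -expr2.
Qed.

Let mrho : measurable_fun setT rho.
Proof. by apply: measurable_minr; [exact: measurable_cabs|exact: measurable_cst]. Qed.

Let rho0 x : 0 <= rho x. Proof. by rewrite /rho le_min cabs_ge0 ler01. Qed.
Let rho1 x : rho x <= 1. Proof. by rewrite /rho ge_min lexx orbT. Qed.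

Lemma intble_rho : intble mu (fun x => Num.min (cabs (hmatrix x i j)) 1).
Proof.
by apply: (intble_bounded mu mrho); exists 1 => x; rewrite ger0_norm ?rho0 ?rho1.
Qed.

Lemma intble_sqr_rho :
  intble mu (fun x => cabs (hmatrix x i j) ^+ 2 * Num.min (cabs (hmatrix x i j)) 1).
Proof.
apply: (intbleM_bounded iw2 mrho).
by exists 1 => x; rewrite ger0_norm ?rho0 ?rho1.
Qed.

Let mcD k : cmeasurable (fun x => conjc (G x k k - m)).
Proof.
apply: cmeasurable_conjc; apply: cmeasurableB => //; exact: cmeasurable_cst.
Qed.

Let cD2 x k : cabs (conjc (G x k k - m)) <= 2.
Proof. by rewrite cabsJ; apply: cabsB_le => //; exact: cabs_resolvent_le1. Qed.

(** The term of first order in [w] has mean zero, since [w] is centred and independent of the zeroed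
    tuple. The [w^2] term factors, with real and imaginary means of [w^2] at most [S], and its
    coefficient [B] is quadratic in off-diagonal entries. The [|w|^2] term has mean [S] times that
    of [C], which cancels the mean of [H] up to errors of the same kind. *)
Lemma offdiagonal_entry_estimate : i != j ->
  `|Ex mu (fun x => complex.Im (w x * G x j i * conjc (G x i i - m)))
    + S * Ex mu (fun x => complex.Im (G x i i * G x j j * conjc (G x i i - m)))|
  <= S * Ex mu (fun x => 14 * (cabs (G x j i) ^+ 2 + cabs (G x i j) ^+ 2) + 122 * rho x)
    + 16 * Ex mu (fun x => cabs (w x) ^+ 2 * rho x).
Proof.
move=> ij.
(* [B] counts twice, through its real and imaginary parts, so the off-diagonal squares of the zeroed
   resolvent occur at most [2 * 3 + 1 = 7] times. Returning to the full resolvent doubles them and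
   adds 16 [rho] each time: [14 = 7 * 2] and [122 = 7 * 16 + 10]. *)
have lin (b c r p q p' q' : R) : 0 <= r -> p + q <= 2 * (p' + q') + 16 * r ->
    c <= p + 10 * r -> b <= 3 * (p + q) -> 0 <= q -> 2 * b + c <= 14 * (p' + q') + 122 * r by lra.
pose z x := zeroed i j x.
have wJ x : hmatrix x j i = conjc (w x) by exact: hermitian_hmatrix.
have exp x k l : G x k l = G (z x) k l - w x * G (z x) k i * G x j l
    - conjc (w x) * G (z x) k j * G x i l.
  have := resolvent_entry_expansion eta0 k l (hermitian_hmatrix x)
    (hermitian_hmatrix (z x)) (hmatrix_zeroed i j x).
  by rewrite ij mul1r wJ.
pose A x := G x j i * conjc (G x i i - m).
pose B x := second_order_ww (G x j i) (G x i j) (G x i i) m.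
pose C x := second_order_wwc (G x j i) (G x i i) (G x j j) m.
pose T x := expansion_rest (w x) (G (z x) j i) (G (z x) i j) (G (z x) i i) (G (z x) j j)
   (G x j i) (G x i i) m.
pose H x := G x i i * G x j j * conjc (G x i i - m).
have G1 := cabs_resolvent_le1.
have T16 x : cabs (T x) <= 16 * (cabs (w x) ^+ 2 * rho x).
  by apply: expansion_restP => //; exact: exp.
have B3 x : cabs (B (z x)) <= 3 * (cabs (G (z x) j i) ^+ 2 + cabs (G (z x) i j) ^+ 2).
  by apply: second_order_wwP.
have CH x : cabs (C (z x) + H x) <= cabs (G (z x) j i) ^+ 2 + 10 * rho x.
  apply: (second_order_wwcP (w := w x) (b := G (z x) i j) (a' := G x j i) (b' := G x i j)) => //; exact: exp.
have QQ x : cabs (G (z x) j i) ^+ 2 + cabs (G (z x) i j) ^+ 2 <=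
    2 * (cabs (G x j i) ^+ 2 + cabs (G x i j) ^+ 2) + 16 * rho x.
  apply: (offdiag_sqr_le (p := G (z x) i i) (q := G (z x) j j) (p' := G x i i) (q' := G x j j)) => //; exact: exp.
have mz (F : E -> R[i]) : cmeasurable F -> cmeasurable (fun x => F (z x)).
  by move=> [m2 m3]; split; [apply: (measurableT_comp m2)|apply: (measurableT_comp m3)];
    exact: measurable_zeroed.
have mA : cmeasurable A by exact: cmeasurableM (mG j i) (mcD i).
have mB : cmeasurable B by exact: cmeasurable_second_order_ww (mG j i) (mG i j) (mG i i).
have mC : cmeasurable C by exact: cmeasurable_second_order_wwc (mG j i) (mG i i) (mG j j).
have mH : cmeasurable H by exact: cmeasurableM (cmeasurableM (mG i i) (mG j j)) (mcD i).
have mWA : cmeasurable (fun x => w x * G x j i * conjc (G x i i - m)).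
  exact: cmeasurableM (cmeasurableM mw (mG j i)) (mcD i).
have TE x : T x = w x * G x j i * conjc (G x i i - m) - w x * A (z x)
     - w x ^+ 2 * B (z x) - ((cabs (w x) ^+ 2)%:C)%C * C (z x) by [].
have mT : cmeasurable T.
  rewrite (funext TE); apply: cmeasurableB; last first.
    apply: cmeasurableM; last exact: mz.
    split; last exact: measurable_cst.
    by apply: measurable_funX; exact: measurable_cabs.
  apply: (cmeasurableB _ (cmeasurableM mw2 (mz _ mB))).
  exact: cmeasurableB mWA (cmeasurableM mw (mz _ mA)).
have A2 x : cabs (A x) <= 1 * 2 by exact: cabsM_le (G1 x j i) (cD2 x i).
have B6 x : cabs (B x) <= 3 by exact: second_order_ww_le3 (G1 x j i) (G1 x i j) (G1 x i i) m1.
have C6 x : cabs (C x) <= 3 by exact: second_order_wwc_le3 (G1 x j i) (G1 x i i) (G1 x j j) m1.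
have H2 x : cabs (H x) <= 1 * 1 * 2.
  exact: cabsM_le (cabsM_le (G1 x i i) (G1 x j j)) (cD2 x i).
have [iRB iIB iB _] := intble_cmeasurable (mz _ mB) (fun x => B6 (z x)).
have [_ iIC _ _] := intble_cmeasurable (mz _ mC) (fun x => C6 (z x)).
have [_ iIH _ _] := intble_cmeasurable mH H2.
have [_ iCH1 iCH _] := intble_cmeasurable (cmeasurableD (mz _ mC) mH)
  (fun x => cabsD_le (C6 (z x)) (H2 x)).
have i16 : intble mu (fun x => 16 * (cabs (w x) ^+ 2 * rho x)).
  by apply: intbleZ; exact: intble_sqr_rho.
have iIT : intble mu (fun x => complex.Im (T x)).
  apply: (intble_le (g := fun x => 16 * (cabs (w x) ^+ 2 * rho x))) => //.
    by case: mT.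
  by move=> x; rewrite (le_trans (normr_Im _)).
have bRe (F : E -> R[i]) K : (forall x, cabs (F x) <= K) -> bounded (fun x : E => complex.Re (F x)).
  by move=> h; exists K => x; rewrite (le_trans (normr_Re _)).
have bIm (F : E -> R[i]) K : (forall x, cabs (F x) <= K) -> bounded (fun x : E => complex.Im (F x)).
  by move=> h; exists K => x; rewrite (le_trans (normr_Im _)).
have mRe (F : E -> R[i]) : cmeasurable F -> measurable_fun setT (fun x : E => complex.Re (F x)) by move=> [].
have mIm (F : E -> R[i]) : cmeasurable F -> measurable_fun setT (fun x : E => complex.Im (F x)) by move=> [].
have e1 := Ex_entryM (u := fun z => complex.Re z) iRew (mIm _ mA) (bIm _ _ A2).
have e2 := Ex_entryM (u := fun z => complex.Im z) iImw (mRe _ mA) (bRe _ _ A2).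
have e3 := Ex_entryM (u := fun z => complex.Re (z ^+ 2)) iRew2 (mIm _ mB) (bIm _ _ B6).
have e4 := Ex_entryM (u := fun z => complex.Im (z ^+ 2)) iImw2 (mRe _ mB) (bRe _ _ B6).
have e5 := Ex_entryM (u := fun z => cabs z ^+ 2) iw2 (mIm _ mC) (bIm _ _ C6).
have iM (u : E -> R) (v : E -> R) : intble mu u -> measurable_fun setT v ->
    bounded v -> intble mu (fun x => u x * v (z x)).
  move=> iu mv bv; apply: intbleM_bounded => //.
    by apply: (measurableT_comp mv); exact: measurable_zeroed.
  by case: bv => K h; exists K.
have j1 := iM _ _ iRew (mIm _ mA) (bIm _ _ A2).
have j2 := iM _ _ iImw (mRe _ mA) (bRe _ _ A2).
have j3 := iM _ _ iRew2 (mIm _ mB) (bIm _ _ B6).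
have j4 := iM _ _ iImw2 (mRe _ mB) (bRe _ _ B6).
have j5 := iM _ _ iw2 (mIm _ mC) (bIm _ _ C6).
(* Expectations are of real functions, so the imaginary part is expanded into products of a function
   of [w] alone and a function of the zeroed tuple, which [Ex_entryM] factors. *)
have fE : (fun x => complex.Im (w x * G x j i * conjc (G x i i - m))) = (fun x =>
    complex.Re (w x) * complex.Im (A (z x)) + complex.Im (w x) * complex.Re (A (z x)) +
    (complex.Re (w x ^+ 2) * complex.Im (B (z x)) + complex.Im (w x ^+ 2) * complex.Re (B (z x))) +
    cabs (w x) ^+ 2 * complex.Im (C (z x)) + complex.Im (T x)).
  apply/funext => x.
  have -> : w x * G x j i * conjc (G x i i - m) = w x * A (z x) + w x ^+ 2 * B (z x) +
    ((cabs (w x) ^+ 2)%:C)%C * C (z x) + T x.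
    by rewrite TE; ring.
  move: (T x) (A (z x)) (B (z x)) (C (z x)) (w x ^+ 2) => t a b c w2.
  by rewrite !cImD !cImM /= mul0r addr0; ring.
rewrite fE.
have k12 := intbleD j1 j2; have k34 := intbleD j3 j4.
have k1234 := intbleD k12 k34; have k5 := intbleD k1234 j5.
rewrite (ExD k5 iIT) (ExD k1234 j5) (ExD k12 k34) (ExD j1 j2) (ExD j3 j4).
rewrite /w e1 e2 e3 e4 e5 Rew0 Imw0 !mul0r !add0r -/w -/S -/z.
have CHE := ExD iIC iIH.
have CHI : (fun x => complex.Im (C (z x)) + complex.Im (H x)) = (fun x => complex.Im (C (z x) + H x)).
  by apply/funext => x; exact/esym/cImD.
rewrite CHI in CHE.
have n1 := norm_Ex_Im iIB iB; have n2 := norm_Ex_Re iRB iB.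
have n3 := norm_Ex_Im iCH1 iCH.
have n4 : `|Ex mu (fun x => complex.Im (T x))| <= 16 * Ex mu (fun x => cabs (w x) ^+ 2 * rho x).
  rewrite -(ExZ _ intble_sqr_rho) (le_trans (norm_Ex iIT))//.
  apply: Ex_le; [exact: intble_norm|exact: i16|].
  by move=> x; rewrite (le_trans (normr_Im _)).
have [_ _ _ iji] := intble_cmeasurable (mG j i) (fun x => G1 x j i).
have [_ _ _ iij] := intble_cmeasurable (mG i j) (fun x => G1 x i j).
have n5 : 2 * Ex mu (fun x => cabs (B (z x))) + Ex mu (fun x => cabs (C (z x) + H x)) <=
   Ex mu (fun x => 14 * (cabs (G x j i) ^+ 2 + cabs (G x i j) ^+ 2) + 122 * rho x).
  rewrite -(ExZ _ iB) -(ExD (intbleZ 2 iB) iCH); apply: Ex_le.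
  - by apply: intbleD => //; exact: intbleZ.
  - by apply: intbleD; apply: intbleZ; [exact: intbleD|exact: intble_rho].
  - move=> x; exact: lin (rho0 x) (QQ x) (CH x) (B3 x) (sqr_ge0 (cabs (G (z x) i j))).
move: n1 n2 n3 n4 n5 CHE nRew2 nImw2.
set b1 := Ex mu (fun x => complex.Im (B _)); set b2 := Ex mu (fun x => complex.Re (B _)).
set r1 := Ex mu (fun x => complex.Re _); set r2 := Ex mu (fun x => complex.Im (_ ^+ 2)).
set c := Ex mu (fun x => complex.Im (C _)); set t := Ex mu (fun x => complex.Im (T _)).
set h := Ex mu (fun x => complex.Im (H x)).
set be := Ex mu (fun x => cabs (B _)); set ga := Ex mu (fun x => cabs (_ + _)).
set q := Ex mu (fun x => 14 * _ + _).
move=> n1 n2 n3 n4 n5 CHE r1S r2S; rewrite CHE in n3.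
have -> : r1 * b1 + r2 * b2 + S * c + t + S * h = r1 * b1 + r2 * b2 + S * (c + h) + t by ring.
apply: (@le_trans _ _ (S * be + S * be + S * ga + `|t|)).
  rewrite (le_trans (ler_normD _ _))// lerD2r (le_trans (ler_normD _ _))//.
  apply: lerD; last by rewrite normrM (ger0_norm S0) ler_wpM2l.
  by rewrite (le_trans (ler_normD _ _))// !normrM lerD// ler_pM.
apply: lerD => //.
have -> : S * be + S * be + S * ga = S * (2 * be + ga) by ring.
by rewrite ler_wpM2l.
Qed.

(** A first-order expansion suffices: there are only [n] diagonal entries, so an error of order [S]
    is affordable. The constant is 3 from the expansion plus the trivial bound 2 on the second
    mean. *)
Lemma diagonal_entry_estimate : i = j ->
  `|Ex mu (fun x => complex.Im (w x * G x j i * conjc (G x i i - m)))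
    + S * Ex mu (fun x => complex.Im (G x i i * G x j j * conjc (G x i i - m)))|
  <= 5 * S.
Proof.
move=> ij; pose z x := zeroed i j x.
have G1 := cabs_resolvent_le1.
have exp x : G x i i = G (z x) i i - w x * G (z x) i i * G x i i.
  have := resolvent_entry_expansion eta0 i i (hermitian_hmatrix x)
    (hermitian_hmatrix (z x)) (hmatrix_zeroed i j x).
  by rewrite -/(w x) -ij eqxx !mul0r subr0.
pose A x := G x i i * conjc (G x i i - m).
pose H x := G x i i * G x j j * conjc (G x i i - m).
pose T x := w x * G x j i * conjc (G x i i - m) - w x * A (z x).
have T3 x : cabs (T x) <= 3 * cabs (w x) ^+ 2.
  have dp : cabs (G x i i - G (z x) i i) <= cabs (w x) * 1 * 1.
    have -> : G x i i - G (z x) i i = - (w x * G (z x) i i * G x i i).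
      by rewrite {1}exp; ring.
    by rewrite cabsN; apply: cabsM_le => //; exact: cabsM_le.
  have dD : cabs (conjc (G x i i - m) - conjc (G (z x) i i - m)) <= cabs (w x) * 1 * 1.
    rewrite -rmorphB/= cabsJ.
    have -> : G x i i - m - (G (z x) i i - m) = G x i i - G (z x) i i by ring.
    exact: dp.
  have -> : T x = w x * ((G x i i - G (z x) i i) * conjc (G x i i - m) +
     G (z x) i i * (conjc (G x i i - m) - conjc (G (z x) i i - m))).
    by rewrite /T /A -ij; ring.
  have := cabsM_le (lexx (cabs (w x))) (cabsD_le (cabsM_le dp (cD2 x i)) (cabsM_le (G1 (z x) i i) dD)).
  by move=> h; rewrite (le_trans h)//; lra.
have mA : cmeasurable A by exact: cmeasurableM (mG i i) (mcD i).
have mH : cmeasurable H by exact: cmeasurableM (cmeasurableM (mG i i) (mG j j)) (mcD i).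
have mz (F : E -> R[i]) : cmeasurable F -> cmeasurable (fun x => F (z x)).
  by move=> [m2 m3]; split; [apply: (measurableT_comp m2)|apply: (measurableT_comp m3)];
    exact: measurable_zeroed.
have mT : cmeasurable T.
  exact: cmeasurableB (cmeasurableM (cmeasurableM mw (mG j i)) (mcD i))
    (cmeasurableM mw (mz _ mA)).
have A2 x : cabs (A x) <= 1 * 2 by exact: cabsM_le (G1 x i i) (cD2 x i).
have H2 x : cabs (H x) <= 1 * 1 * 2.
  exact: cabsM_le (cabsM_le (G1 x i i) (G1 x j j)) (cD2 x i).
have [_ iIH _ _] := intble_cmeasurable mH H2.
have i3 := intbleZ 3 iw2.
have iIT : intble mu (fun x => complex.Im (T x)).
  apply: (intble_le _ _ i3); first by case: mT.
  by move=> x; rewrite (le_trans (normr_Im _)).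
have bRA : bounded (fun x => complex.Re (A x)).
  by exists (1 * 2) => x; rewrite (le_trans (normr_Re _)).
have bIA : bounded (fun x => complex.Im (A x)).
  by exists (1 * 2) => x; rewrite (le_trans (normr_Im _)).
have [mRA mIA] := mA.
have e1 := Ex_entryM (u := fun z => complex.Re z) iRew mIA bIA.
have e2 := Ex_entryM (u := fun z => complex.Im z) iImw mRA bRA.
have iM (u : E -> R) (v : E -> R) : intble mu u -> measurable_fun setT v ->
    bounded v -> intble mu (fun x => u x * v (z x)).
  move=> iu mv bv; apply: intbleM_bounded => //.
    by apply: (measurableT_comp mv); exact: measurable_zeroed.
  by case: bv => K h; exists K.
have j1 := iM _ _ iRew mIA bIA; have j2 := iM _ _ iImw mRA bRA.
have fE : (fun x => complex.Im (w x * G x j i * conjc (G x i i - m))) = (fun x =>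
    complex.Re (w x) * complex.Im (A (z x)) + complex.Im (w x) * complex.Re (A (z x)) +
    complex.Im (T x)).
  apply/funext => x.
  have -> : w x * G x j i * conjc (G x i i - m) = w x * A (z x) + T x by rewrite /T; ring.
  move: (T x) (A (z x)) => t a.
  by rewrite cImD cImM.
rewrite fE (ExD (intbleD j1 j2) iIT) (ExD j1 j2).
rewrite /w e1 e2 Rew0 Imw0 !mul0r !add0r -/w -/S.
rewrite (le_trans (ler_normD _ _))// normrM (ger0_norm S0).
have -> : 5 * S = 3 * S + S * 2 by ring.
apply: lerD.
  rewrite -(ExZ _ iw2) (le_trans (norm_Ex iIT))//.
  apply: Ex_le; [exact: intble_norm|exact: i3|].
  by move=> x; rewrite (le_trans (normr_Im _)).
rewrite ler_wpM2l//; apply: Ex_bound => // x.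
by rewrite (le_trans (normr_Im _))// (le_trans (H2 x))// !mul1r.
Qed.

End EntryEstimate.

(** * Self-consistency *)

Section SelfConsistency.
Context {R : realType} {n : nat}.
Local Notation N := #|{: 'I_n * 'I_n}|.
Local Notation E := (N.-tuple (R * R)%type).
Variable mu : probability E R.
Hypothesis indep : independent_coordinates mu.
Variables (eta m0 C : R).
Hypotheses (eta1 : 1 <= eta) (C0 : 0 <= C) (etaC : C + 1 <= eta).
Hypotheses (m00 : 0 <= m0) (m0E : m0 ^+ 2 + eta * m0 = 1).
Hypothesis iw2 : forall i j, intble mu (fun x : E => cabs (hmatrix x i j) ^+ 2).
Hypothesis Rew0 : forall i j, Ex mu (fun x : E => complex.Re (hmatrix x i j)) = 0.
Hypothesis Imw0 : forall i j, Ex mu (fun x : E => complex.Im (hmatrix x i j)) = 0.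

Let eta0 : 0 < eta. Proof. exact: lt_le_trans eta1. Qed.

Definition entry_var i j := Ex mu (fun x : E => cabs (hmatrix x i j) ^+ 2).
Definition entry_tail eps i j :=
  Ex mu (fun x : E => cabs (hmatrix x i j) ^+ 2 * (eps < cabs (hmatrix x i j))%R%:R).

Local Notation G := (fun x : E => resolvent eta (hmatrix x)).
Local Notation S := entry_var.
Let m : R[i] := Complex 0 m0.
Let s i := \sum_j S i j.
Let D (x : E) i := G x i i - m.
Let d i := Ex mu (fun x => cabs (D x i) ^+ 2).

Let m01 : m0 <= 1.
Proof.
have h : m0 * 1 <= m0 * eta by rewrite ler_wpM2l.
have := sqr_ge0 m0; have := m0E; lra.
Qed.

Let m1 : cabs m <= 1. Proof. by rewrite cabs_imag ger0_norm. Qed.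

Let G1 (x : E) i j : cabs (G x i j) <= 1. Proof. exact: cabs_resolvent_le1. Qed.
Let D2 x i : cabs (D x i) <= 2. Proof. exact: cabsB_le. Qed.
Let S0 i j : 0 <= S i j. Proof. by apply: Ex_ge0 => x; exact: sqr_ge0. Qed.
Let mH i j : cmeasurable (fun x : E => hmatrix x i j). Proof. exact: cmeasurable_hmatrix. Qed.
Let mG i j : cmeasurable (fun x => G x i j). Proof. exact: cmeasurable_resolvent_hmatrix. Qed.
Let mD i : cmeasurable (fun x => D x i).
Proof. by apply: cmeasurableB => //; exact: cmeasurable_cst. Qed.
Let mcD i : cmeasurable (fun x => conjc (D x i)). Proof. exact: cmeasurable_conjc. Qed.

Let mind eps i j : measurable_fun setT (fun x : E => (eps < cabs (hmatrix x i j))%R%:R : R).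
Proof.
have -> : (fun x : E => (eps < cabs (hmatrix x i j))%R%:R : R) =
  (fun x => if eps < cabs (hmatrix x i j) then 1 else 0).
  by apply/funext => x; case: ifP.
apply: measurable_fun_ifT; [|exact: measurable_cst..].
by apply: measurable_fun_ltr; [exact: measurable_cst|exact: measurable_cabs].
Qed.

Let bind eps i j : bounded (fun x : E => (eps < cabs (hmatrix x i j))%R%:R : R).
Proof. by exists 1 => x; case: (_ < _); rewrite ?normr1 ?normr0. Qed.

Let iind eps i j : intble mu (fun x : E => (eps < cabs (hmatrix x i j))%R%:R : R).
Proof. exact: intble_bounded. Qed.

Let itail eps i j :
  intble mu (fun x : E => cabs (hmatrix x i j) ^+ 2 * (eps < cabs (hmatrix x i j))%R%:R).
Proof. exact: intbleM_bounded. Qed.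

Let tail0 eps i j : 0 <= entry_tail eps i j.
Proof. by apply: Ex_ge0 => x; rewrite mulr_ge0 ?sqr_ge0. Qed.

Section EpsilonBounds.
Variable eps : R.
Hypothesis eps0 : 0 < eps.
Local Notation tau := (entry_tail eps).

Let var_le i j : S i j <= eps ^+ 2 + tau i j.
Proof.
rewrite -[X in X + _](Ex_cst mu) -(ExD (intble_cst mu _) (itail eps i j)).
apply: Ex_le => //; first by apply: intbleD => //; exact: intble_cst.
move=> x; case: ltP => h; first by rewrite mulr1 lerDr sqr_ge0.
by rewrite mulr0 addr0 lerXn2r ?nnegrE ?cabs_ge0 ?(ltW eps0).
Qed.

(** The mean of [min (|w|, 1)] is at most [eps] plus the probability of [|w| > eps], which Chebyshev
    bounds by [tau / eps^2]. The factor [S <= eps^2 + tau] compensates the division, leaving a bound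
    linear in [tau]. *)
Let var_rho i j : S i j * Ex mu (fun x : E => Num.min (cabs (hmatrix x i j)) 1) <=
  eps * S i j + 2 * tau i j.
Proof.
pose p := Ex mu (fun x : E => (eps < cabs (hmatrix x i j))%R%:R : R).
have p0 : 0 <= p by apply: Ex_ge0 => x.
have p1 : p <= 1.
  rewrite -(Ex_cst mu 1); apply: Ex_le => //; first exact: intble_cst.
  by move=> x; case: (_ < _).
have h1 : Ex mu (fun x : E => Num.min (cabs (hmatrix x i j)) 1) <= eps + p.
  rewrite -(Ex_cst mu eps) -(ExD (intble_cst mu _) (iind eps i j)).
  apply: Ex_le; [exact: intble_rho|by apply: intbleD => //; exact: intble_cst|].
  move=> x; case: ltP => h; first by rewrite ge_min lerDr (ltW eps0) orbT.
  by rewrite addr0 ge_min h.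
have h2 : eps ^+ 2 * p <= tau i j.
  rewrite -(ExZ _ (iind eps i j)); apply: Ex_le => //; first exact: intbleZ.
  move=> x; case: ltP => h; last by rewrite !mulr0.
  by rewrite !mulr1 lerXn2r ?nnegrE ?cabs_ge0 ?(ltW eps0) ?(ltW h).
have h3 : S i j * p <= eps ^+ 2 * p + tau i j * 1.
  by rewrite (le_trans (ler_wpM2r p0 (var_le i j)))// mulrDl lerD2l ler_wpM2l.
have := ler_wpM2l (S0 i j) h1; lra.
Qed.

Let sqr_rho i j :
  Ex mu (fun x : E => cabs (hmatrix x i j) ^+ 2 * Num.min (cabs (hmatrix x i j)) 1) <=
  eps * S i j + tau i j.
Proof.
rewrite -(ExZ _ (iw2 i j)) -(ExD (intbleZ _ (iw2 i j)) (itail eps i j)).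
apply: Ex_le; [exact: intble_sqr_rho|by apply: intbleD => //; exact: intbleZ|].
move=> x; have w0 := sqr_ge0 (cabs (hmatrix x i j)); case: ltP => h.
  rewrite mulr1 (@le_trans _ _ (cabs (hmatrix x i j) ^+ 2 * 1))//.
    by rewrite ler_wpM2l// ge_min lexx orbT.
  by rewrite mulr1 lerDr mulr_ge0// ltW.
by rewrite mulr0 addr0 mulrC ler_wpM2r// ge_min h.
Qed.

Let X i j := Ex mu (fun x => complex.Im (hmatrix x i j * G x j i * conjc (D x i)))
    + S i j * Ex mu (fun x => complex.Im (G x i i * G x j j * conjc (D x i))).
Let Q i j := Ex mu (fun x => cabs (G x j i) ^+ 2 + cabs (G x i j) ^+ 2).

Let iG2 i j : intble mu (fun x => cabs (G x i j) ^+ 2).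
Proof. by have [_ _ _] := intble_cmeasurable mu (mG i j) (fun x => G1 x i j). Qed.

Let Q2 i j : 0 <= Q i j <= 2.
Proof.
have h x a b : cabs (G x a b) ^+ 2 <= 1 by rewrite expr_le1 ?cabs_ge0.
apply/andP; split; first by apply: Ex_ge0 => x; rewrite addr_ge0 ?sqr_ge0.
rewrite -(Ex_cst mu 2); apply: Ex_le; [exact: intbleD|exact: intble_cst|].
by move=> x; have := h x i j; have := h x j i; lra.
Qed.

(** [S Q] is replaced by [eps^2 Q + 2 tau], trading the variance for [eps^2] because the sum of [Q]
    is known. The coefficient 293 adds [28 + 244 + 16] from the off-diagonal bound and 5 from the
    diagonal one. *)
Lemma entry_estimate i j : `|X i j| <=
  14 * eps ^+ 2 * Q i j + 138 * eps * S i j + 293 * tau i j + 5 * (i == j)%:R * eps ^+ 2.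
Proof.
have v := var_le i j; have vr := var_rho i j; have sr := sqr_rho i j.
have /andP[q0 q2] := Q2 i j; have t0 := tail0 eps i j; have sij := S0 i j.
have e2 := sqr_ge0 eps.
have SQ : S i j * Q i j <= eps ^+ 2 * Q i j + tau i j * 2.
  by rewrite (le_trans (ler_wpM2r q0 v))// mulrDl lerD2l ler_wpM2l.
have [ij|ij] := eqVneq i j.
  have := diagonal_entry_estimate indep eta1 m1 (iw2 i j) (Rew0 i j) (Imw0 i j) ij.
  rewrite -/(S i j) -/(X i j) => h; rewrite (le_trans h)//.
  have : 0 <= eps ^+ 2 * Q i j by rewrite mulr_ge0.
  have : 0 <= eps * S i j by rewrite mulr_ge0// ltW.
  by rewrite !mulr1; lra.
have := offdiagonal_entry_estimate indep eta1 m1 (iw2 i j) (Rew0 i j) (Imw0 i j) ij.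
rewrite -/(S i j) -/(X i j) => h; rewrite (le_trans h)//.
rewrite (ExD (intbleZ _ (intbleD (iG2 j i) (iG2 i j))) (intbleZ _ (intble_rho mu i j))).
rewrite (ExZ _ (intbleD (iG2 j i) (iG2 i j))) (ExZ _ (intble_rho mu i j)) -/(Q i j).
by rewrite !mulr0 mul0r; lra.
Qed.

(** By the Ward identities in rows and columns the [n^2] terms add up to order [n] only, so with
    [eps^2] in front they stay negligible after division by [n]. *)
Let sumQ : \sum_i \sum_j Q i j <= 2 * n%:R.
Proof.
have inv1 : eta^-1 ^+ 2 <= 1 by rewrite expr_le1// ?invf_le1// invr_ge0 ltW.
have -> : 2 * n%:R = \sum_(i < n) (2 : R).
  by rewrite sumr_const card_ord mulr_natr.
apply: ler_sum => i _.
rewrite -(Ex_sum _ (fun j => intbleD (iG2 j i) (iG2 i j))) -(Ex_cst mu 2).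
apply: Ex_le; [by apply: intble_sum => j; exact: intbleD|exact: intble_cst|].
move=> x; rewrite big_split/=.
have := ward_row_le eta0 (hermitian_hmatrix x) i.
have := ward_col_le eta0 (hermitian_hmatrix x) i; lra.
Qed.

Let excess := \sum_i Num.max (s i - C) 0.

Let sumS : \sum_i s i <= n%:R * C + excess.
Proof.
have -> : n%:R * C = \sum_(i < n) C by rewrite sumr_const card_ord mulr_natl.
rewrite -big_split/=; apply: ler_sum => i _.
by rewrite -lerBlDl le_max lexx.
Qed.

Let sumX : eps <= 1 -> \sum_i \sum_j `|X i j| <=
  300 * (eps * (1 + C) * n%:R + excess + \sum_i \sum_j tau i j).
Proof.
move=> eps1.
apply: (@le_trans _ _ (14 * eps ^+ 2 * (\sum_i \sum_j Q i j) + 138 * eps * (\sum_i s i) +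
   293 * (\sum_i \sum_j tau i j) + 5 * eps ^+ 2 * n%:R)).
  have -> : 5 * eps ^+ 2 * n%:R = \sum_(i < n) \sum_(j < n) 5 * (i == j)%:R * eps ^+ 2.
    have E i : \sum_(j < n) 5 * (i == j)%:R * eps ^+ 2 = 5 * eps ^+ 2.
      rewrite (bigD1 i)//= eqxx mulr1 big1 ?addr0// => j ji.
      by rewrite eq_sym (negbTE ji) mulr0 mul0r.
    by rewrite (eq_bigr _ (fun i _ => E i)) sumr_const card_ord mulr_natr.
  rewrite !mulr_sumr -!big_split/=; apply: ler_sum => i _.
  rewrite /s !mulr_sumr -!big_split/=; apply: ler_sum => j _.
  exact: entry_estimate.
have e2 : eps ^+ 2 <= eps by rewrite expr2 ler_piMr// ltW.
have nn : 0 <= n%:R :> R by [].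
have ex0 : 0 <= excess by apply: sumr_ge0 => i _; rewrite le_max lexx orbT.
have t0 : 0 <= \sum_i \sum_j tau i j by apply: sumr_ge0 => i _; apply: sumr_ge0.
have h1 : eps ^+ 2 * (\sum_i \sum_j Q i j) <= eps * (2 * n%:R).
  apply: ler_pM => //; first exact: sqr_ge0.
  by apply: sumr_ge0 => i _; apply: sumr_ge0 => j _; case/andP: (Q2 i j).
have h2 : eps * (\sum_i s i) <= eps * (n%:R * C) + eps * excess.
  by rewrite -mulrDr ler_pM2l.
have h3 : eps * excess <= excess by rewrite ler_piMl.
have h4 : eps ^+ 2 * n%:R <= eps * n%:R by rewrite ler_wpM2r.
have h5 : 0 <= eps * (n%:R * C) by rewrite !mulr_ge0// ltW.
have h6 : 0 <= eps * n%:R by rewrite mulr_ge0// ltW.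
lra.
Qed.

Let i_im (F : E -> R[i]) K : cmeasurable F -> (forall x, cabs (F x) <= K) ->
  intble mu (fun x => complex.Im (F x)).
Proof. by move=> mF hF; have [] := intble_cmeasurable mu mF hF. Qed.

Let id2 i : intble mu (fun x => cabs (D x i) ^+ 2).
Proof. by have [] := intble_cmeasurable mu (mD i) (fun x => D2 x i). Qed.

Let d0 i : 0 <= d i. Proof. by apply: Ex_ge0 => x; exact: sqr_ge0. Qed.

Let d4 i : d i <= 4.
Proof.
rewrite -(Ex_cst mu 4); apply: Ex_le => //; first exact: intble_cst.
move=> x; have -> : 4 = 2 ^+ 2 :> R by ring.
by rewrite lerXn2r ?nnegrE ?cabs_ge0.
Qed.

(** After multiplication by [conj D_i], the side [(z + m) |D_i|^2] of the row identity is purely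
    imaginary, so only imaginary parts are kept. *)
Let pointwise x i : (eta + m0) * cabs (D x i) ^+ 2 =
  \sum_j (complex.Im (hmatrix x i j * G x j i * conjc (D x i)) +
     S i j * complex.Im (G x i i * G x j j * conjc (D x i)))
  - (s i - 1) * complex.Im (m * G x i i * conjc (D x i))
  - \sum_j S i j * complex.Im (G x i i * D x j * conjc (D x i)).
Proof.
have ImZ (c : R) z : complex.Im (c%:C%C * z) = c * complex.Im z.
  by rewrite cImM /= mul0r addr0.
have e := resolvent_row eta0 (hermitian_hmatrix x) i.
(* The equation [m^2 + z m + 1 = 0], which makes [1 + (z + m) G_ii] equal to [(z + m) D_i]. *)
have zm : 1 = - (Complex 0 eta + m) * m.
  rewrite /m; apply/eqP; rewrite eq_complex /=; apply/andP; split; apply/eqP; last by ring.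
  by move: m0E => h; rewrite -h; ring.
have sC : ((s i)%:C)%C = \sum_j ((S i j)%:C)%C by rewrite rmorph_sum.
have key : \sum_j (hmatrix x i j * G x j i * conjc (D x i) +
     ((S i j)%:C)%C * (G x i i * G x j j * conjc (D x i)))
   - (((s i)%:C)%C - 1) * (m * G x i i * conjc (D x i))
   - \sum_j ((S i j)%:C)%C * (G x i i * D x j * conjc (D x i))
   = (Complex 0 eta + m) * (D x i * conjc (D x i)).
  rewrite big_split/=.
  have -> : \sum_j hmatrix x i j * G x j i * conjc (D x i) =
      (1 + Complex 0 eta * G x i i) * conjc (D x i) by rewrite -e mulr_suml.
  have -> : \sum_j ((S i j)%:C)%C * (G x i i * G x j j * conjc (D x i)) =
     \sum_j ((S i j)%:C)%C * (G x i i * D x j * conjc (D x i)) +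
      ((s i)%:C)%C * (m * G x i i * conjc (D x i)).
    rewrite sC mulr_suml -big_split/=; apply: eq_bigr => j _.
    by rewrite /D; ring.
  have zm2 : (Complex 0 eta + m) * m = -1 by rewrite [in RHS]zm mulNr opprK.
  have -> : (Complex 0 eta + m) * (D x i * conjc (D x i)) =
     ((Complex 0 eta + m) * G x i i - (Complex 0 eta + m) * m) * conjc (D x i).
    by rewrite {1}/D; ring.
  by rewrite zm2; ring.
have : complex.Im ((Complex 0 eta + m) * (D x i * conjc (D x i))) = (eta + m0) * cabs (D x i) ^+ 2.
  by rewrite mulcJ cImM /=; ring.
move=> <-; rewrite -key !cImB cIm_sum cIm_sum.
congr (_ - _ - _).
- by apply: eq_bigr => j _; rewrite cImD ImZ.
- rewrite -ImZ; suff -> : ((s i - 1)%:C)%C = ((s i)%:C)%C - 1 by [].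
  by rewrite rmorphB rmorph1.
- by apply: eq_bigr => j _; rewrite ImZ.
Qed.

Let iP1 i j : intble mu (fun x => complex.Im (hmatrix x i j * G x j i * conjc (D x i))).
Proof.
apply: (intble_le (g := fun x => 2 * (1 + cabs (hmatrix x i j) ^+ 2))).
- have : cmeasurable (fun x => hmatrix x i j * G x j i * conjc (D x i)) by
    apply: cmeasurableM => //; exact: cmeasurableM.
  by case.
- move=> x; rewrite (le_trans (normr_Im _))//.
  have cD2 : cabs (conjc (D x i)) <= 2 by rewrite cabsJ.
  rewrite (le_trans (cabsM_le (cabsM_le (lexx _) (G1 x j i)) cD2))//.
  by have := sqr_ge0 (cabs (hmatrix x i j) - 1); have := cabs_ge0 (hmatrix x i j); nra.
- by apply: intbleZ; apply: intbleD => //; exact: intble_cst.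
Qed.

Let iP2 i j : intble mu (fun x => complex.Im (G x i i * G x j j * conjc (D x i))).
Proof.
apply: (i_im (K := 1 * 1 * 2)) => [|x]; first by apply: cmeasurableM => //; exact: cmeasurableM.
by apply: cabsM_le; [exact: cabsM_le|rewrite cabsJ].
Qed.

Let iP3 i : intble mu (fun x => complex.Im (m * G x i i * conjc (D x i))).
Proof.
apply: (i_im (K := 1 * 1 * 2)) => [|x].
  by apply: cmeasurableM => //; apply: cmeasurableM => //; exact: cmeasurable_cst.
by apply: cabsM_le; [exact: cabsM_le|rewrite cabsJ].
Qed.

Let iP4 i j : intble mu (fun x => complex.Im (G x i i * D x j * conjc (D x i))).
Proof.
apply: (i_im (K := 1 * 2 * 2)) => [|x]; first by apply: cmeasurableM => //; exact: cmeasurableM.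
by apply: cabsM_le; [exact: cabsM_le|rewrite cabsJ].
Qed.

(** The nonnegative term [m0 d_i] is dropped on the left. [|D_i D_j|] is split into half squares so
    that, [S] being symmetric, summation over [i] turns the last term into a sum of [s i * d i]. *)
Let row_bound i : eta * d i <= \sum_j `|X i j| + 2 * `|s i - 1| +
  eta^-1 * \sum_j S i j * ((d i + d j) / 2).
Proof.
have iPX j := intbleD (iP1 i j) (intbleZ (S i j) (iP2 i j)).
have e : (eta + m0) * d i = \sum_j X i j
   - (s i - 1) * Ex mu (fun x => complex.Im (m * G x i i * conjc (D x i)))
   - \sum_j S i j * Ex mu (fun x => complex.Im (G x i i * D x j * conjc (D x i))).
  rewrite -(ExZ _ (id2 i)) (funext (fun x => pointwise x i)).
  have iA := intble_sum (index_enum _) iPX.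
  have iB := intbleZ (s i - 1) (iP3 i).
  have iC := intble_sum (index_enum _) (fun j => intbleZ (S i j) (iP4 i j)).
  rewrite (ExB (intbleB iA iB) iC) (ExB iA iB) (Ex_sum _ iPX) (ExZ _ (iP3 i)).
  rewrite (Ex_sum _ (fun j => intbleZ (S i j) (iP4 i j))).
  congr (_ - _ - _).
    by apply: eq_bigr => j _; rewrite (ExD (iP1 i j) (intbleZ _ (iP2 i j))) (ExZ _ (iP2 i j)).
  by apply: eq_bigr => j _; rewrite (ExZ _ (iP4 i j)).
apply: (@le_trans _ _ ((eta + m0) * d i)); first by rewrite mulrDl lerDl mulr_ge0.
rewrite e (le_trans (ler_norm _))// (le_trans (ler_normB _ _))//.
apply: lerD.
  rewrite (le_trans (ler_normB _ _))//; apply: lerD; first exact: ler_norm_sum.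
  rewrite normrM mulrC ler_wpM2r//; apply: Ex_bound => // x.
  rewrite (le_trans (normr_Im _))//.
  have cD2 : cabs (conjc (D x i)) <= 2 by rewrite cabsJ.
  by rewrite (le_trans (cabsM_le (cabsM_le m1 (G1 x i i)) cD2))// !mul1r.
rewrite mulr_sumr (le_trans (ler_norm_sum _ _ _))//; apply: ler_sum => j _.
rewrite normrM (ger0_norm (S0 i j)) mulrCA ler_wpM2l//.
rewrite (le_trans (norm_Ex (iP4 i j)))//.
have i2 := intbleD (id2 i) (id2 j).
have -> : eta^-1 * ((d i + d j) / 2) =
    Ex mu (fun x => eta^-1 / 2 * (cabs (D x i) ^+ 2 + cabs (D x j) ^+ 2)).
  by rewrite (ExZ _ i2) (ExD (id2 i) (id2 j)) /d; ring.
apply: Ex_le; [exact: intble_norm|exact: intbleZ|].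
move=> x; rewrite (le_trans (normr_Im _))// !cabsM cabsJ.
have g := cabs_resolvent eta0 (hermitian_hmatrix x) i i.
rewrite -mulrA -mulrA; apply: ler_pM => //; rewrite ?cabs_ge0 ?mulr_ge0 ?cabs_ge0//.
by have := sqr_ge0 (cabs (D x j) - cabs (D x i)); nra.
Qed.

Let Ssym i j : S i j = S j i.
Proof.
apply: (congr1 (Ex mu)); apply/funext => x.
by rewrite (hermitian_hmatrix x i j) cabsJ.
Qed.

Lemma sum_resolvent_deviation : eps <= 1 ->
  \sum_i Ex mu (fun x : E => cabs (resolvent eta (hmatrix x) i i - Complex 0 m0) ^+ 2) <=
  300 * (eps * (1 + C) * n%:R + \sum_i Num.max (\sum_j S i j - C) 0
     + \sum_i \sum_j entry_tail eps i j)
  + 4 * (\sum_i Num.max (\sum_j S i j - C) 0) + 2 * \sum_i `|\sum_j S i j - 1|.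
Proof.
move=> eps1; have hX := sumX eps1.
have -> : \sum_i Ex mu (fun x : E => cabs (resolvent eta (hmatrix x) i i - Complex 0 m0) ^+ 2)
  = \sum_i d i by [].
have rows : eta * (\sum_i d i) <= \sum_i \sum_j `|X i j| + 2 * (\sum_i `|s i - 1|)
    + eta^-1 * (\sum_i s i * d i).
  have -> : \sum_i s i * d i = \sum_i \sum_j S i j * ((d i + d j) / 2).
    have E1 : \sum_i \sum_j S i j * (d j / 2) = \sum_i \sum_j S i j * (d i / 2).
      rewrite exchange_big/=; apply: eq_bigr => i _; apply: eq_bigr => j _.
      by rewrite Ssym.
    transitivity (\sum_i \sum_j S i j * (d i / 2) + \sum_i \sum_j S i j * (d j / 2)).
      rewrite E1 -big_split/=; apply: eq_bigr => i _.
      rewrite /s mulr_suml -big_split/=; apply: eq_bigr => j _; by field.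
    rewrite -big_split/=; apply: eq_bigr => i _.
    by rewrite -big_split/=; apply: eq_bigr => j _; ring.
  rewrite !mulr_sumr -!big_split/=; apply: ler_sum => i _.
  exact: row_bound.
(* A row sum is at most [C] plus its excess over [C], and [d i <= 4] turns the excess into an error
   term. *)
have sd : \sum_i s i * d i <= C * (\sum_i d i) + 4 * excess.
  rewrite !mulr_sumr -big_split/=; apply: ler_sum => i _.
  apply: (@le_trans _ _ ((C + Num.max (s i - C) 0) * d i)).
    by rewrite ler_wpM2r// -lerBlDl le_max lexx.
  rewrite mulrDl lerD2l mulrC ler_wpM2r//.
  by rewrite le_max lexx orbT.
have ex0 : 0 <= excess by apply: sumr_ge0 => i _; rewrite le_max lexx orbT.
have D0 : 0 <= \sum_i d i by apply: sumr_ge0.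
have inv1 : eta^-1 <= 1 by rewrite invf_le1.
have inv0 : 0 <= eta^-1 by rewrite invr_ge0 ltW.
have h1 : eta^-1 * (\sum_i s i * d i) <= C * (\sum_i d i) + 4 * excess.
  apply: (@le_trans _ _ (1 * (C * (\sum_i d i) + 4 * excess))); last by rewrite mul1r.
  apply: ler_pM => //; apply: sumr_ge0 => i _; apply: mulr_ge0 => //.
  exact: sumr_ge0.
have h2 : (C + 1) * (\sum_i d i) <= eta * (\sum_i d i) by rewrite ler_wpM2r.
rewrite -/excess.
have -> : \sum_i `|\sum_j S i j - 1| = \sum_i `|s i - 1| by [].
lra.
Qed.

End EpsilonBounds.
End SelfConsistency.

(** * Weak convergence from resolvents *)

Section Bernstein.
Context {R : realType}.

(* The Bernstein operator [\sum_k 'C(N, k) u^k (1 - u)^(N - k) * phi k], by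
   Pascal's recursion. *)
Fixpoint bernstein (N : nat) (phi : nat -> R) (u : R) : R :=
  if N is N'.+1 then
    u * bernstein N' (fun k => phi k.+1) u + (1 - u) * bernstein N' phi u
  else phi 0%N.

Lemma bernsteinD N phi psi u :
  bernstein N (fun k => phi k + psi k) u = bernstein N phi u + bernstein N psi u.
Proof. by elim: N phi psi => [//|N ih] phi psi /=; rewrite !ih; ring. Qed.

Lemma bernsteinZ N c phi u : bernstein N (fun k => c * phi k) u = c * bernstein N phi u.
Proof. by elim: N phi => [//|N ih] phi /=; rewrite !ih; ring. Qed.

Lemma bernstein_cst N c u : bernstein N (fun=> c) u = c.
Proof. by elim: N => [//|N ih] /=; rewrite !ih; ring. Qed.

Lemma le_bernstein N phi psi u : 0 <= u <= 1 ->
  (forall k, (k <= N)%N -> phi k <= psi k) -> bernstein N phi u <= bernstein N psi u.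
Proof.
move=> /andP[u0 u1]; elim: N phi psi => [|N ih] phi psi h /=; first exact: h.
apply: lerD; apply: ler_wpM2l => //; rewrite ?subr_ge0//; apply: ih => k kN; apply: h => //.
exact: leqW.
Qed.

(** The second moment about [a] of a binomial variable: squared bias plus variance. In the recursion
    the success of one trial shifts [a] to [a - 1]. *)
Lemma bernstein_variance N a u :
  bernstein N (fun k => (k%:R - a) ^+ 2) u = (N%:R * u - a) ^+ 2 + N%:R * (u * (1 - u)).
Proof.
elim: N a => [|N ih] a /=; first by ring.
have -> : bernstein N (fun k => (k.+1%:R - a) ^+ 2) u = bernstein N (fun k => (k%:R - (a - 1)) ^+ 2) u.
  by congr (bernstein _ _ _); apply/funext => k; rewrite -natr1; ring.
by rewrite !ih -natr1; ring.
Qed.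

Lemma uniform_continuity01 (g : R -> R) (e : R) : continuous g -> 0 < e ->
  exists2 del : R, 0 < del & forall u v, 0 <= u <= 1 -> `|u - v| < del -> `|g u - g v| <= e.
Proof.
move=> cg e0; have e20 : 0 < e / 2 by rewrite divr_gt0.
pose Q (del : R) (u : R) := forall v, `|u - v| < del -> `|g u - g v| <= e.
have cpt := (iffLR (compact_near_coveringP _)) (@segment_compact R 0 1).
have H : \forall del \near (0 : R)^'+, (`[0, 1]%classic `<=` Q del).
  apply: cpt => u _.
  have /cvgrPdist_le/(_ _ e20)/nbhs_ballP[rho /= rho0 hrho] := cg u.
  have rho2 : 0 < rho / 2 by rewrite divr_gt0.
  exists (ball u (rho / 2), [set del | del < rho / 2]).
    split => /=; first exact: nbhsx_ballx.
    exact: nbhs_right_lt.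
  move=> [x del] /= [ux dl] v xv.
  have h1 : `|g u - g x| <= e / 2.
    by apply: hrho; apply: le_ball ux; lra.
  have h2 : `|g u - g v| <= e / 2.
    apply: hrho; rewrite /ball/=; rewrite /ball/= in ux.
    have -> : u - v = (u - x) + (x - v) by ring.
    by rewrite (le_lt_trans (ler_normD _ _))//; lra.
  have -> : g x - g v = (g u - g v) - (g u - g x) by ring.
  by rewrite (le_trans (ler_normB _ _))//; lra.
have : \forall del \near (0 : R)^'+, (`[0, 1]%classic `<=` Q del) /\ 0 < del.
  by apply: filterI => //; exact: nbhs_right_gt.
case/(@filter_ex _ _ (at_right_proper_filter 0)) => del [h d0].
by exists del => // u v u01; apply: h; rewrite /= in_itv.
Qed.

Lemma bernstein_approx (g : R -> R) (e : R) : continuous g -> 0 < e ->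
  exists N phi, forall u, 0 <= u <= 1 -> `|g u - bernstein N phi u| <= e.
Proof.
move=> cg e0; have [del d0 hd] := uniform_continuity01 cg (divr_gt0 e0 (ltr0Sn _ 1)).
have [M hM] : exists M, forall u, 0 <= u <= 1 -> `|g u| <= M.
  have cng : {within `[0, 1], continuous (fun u : R => `|g u|)}.
    by apply: continuous_subspaceT => u; apply: cvg_norm; exact: cg.
  have [c _ hc] := EVT_max ler01 cng.
  by exists (`|g c|) => u u01; apply: hc; rewrite in_itv.
have M0 : 0 <= M.
  by apply: (le_trans (normr_ge0 (g 0))); apply: hM; rewrite lexx ler01.
(* For [|u - k / N| >= del] the difference of values is at most [2 M], and by Chebyshev the variance
   [u (1 - u) / N] turns this into a contribution of at most [2 M / (del^2 N)], below [e / 2] once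
   [N > K]. *)
pose K := 4 * M / del ^+ 2 / e; pose N := (Num.trunc K).+1.
have KN : K < N%:R by exact: Num.Theory.truncnS_gt.
have Nn0 : N%:R != 0 :> R by rewrite pnatr_eq0.
have N0 : 0 < N%:R :> R by rewrite ltr0n.
have d2 : 0 < del ^+ 2 by rewrite exprn_gt0.
exists N, (fun k => g (k%:R / N%:R)) => u u01.
pose c := 2 * M / del ^+ 2 / N%:R ^+ 2.
have c0 : 0 <= c by apply: divr_ge0; [apply: divr_ge0; [exact: mulr_ge0|exact: sqr_ge0]|exact: sqr_ge0].
have main k : (k <= N)%N -> `|g u - g (k%:R / N%:R)| <= e / 2 + c * (k%:R - N%:R * u) ^+ 2.
  move=> kN; have k01 : 0 <= (k%:R / N%:R : R) <= 1.
    by rewrite divr_ge0//= ler_pdivrMr// mul1r ler_nat.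
  have [near|far] := ltP (`|u - k%:R / N%:R|) del.
    by rewrite (le_trans (hd _ _ u01 near))// lerDl mulr_ge0 ?sqr_ge0.
  rewrite (le_trans (ler_normB _ _))//.
  apply: (@le_trans _ _ (2 * M)).
    by have := hM _ u01; have := hM _ k01; lra.
  have -> : c * (k%:R - N%:R * u) ^+ 2 = 2 * M * ((u - k%:R / N%:R) ^+ 2 / del ^+ 2).
    by rewrite /c; field; rewrite Nn0 gt_eqF.
  apply: (@le_trans _ _ (2 * M * ((u - k%:R / N%:R) ^+ 2 / del ^+ 2))); last first.
    by rewrite lerDr divr_ge0// ltW.
  rewrite ler_peMr ?mulr_ge0//.
  rewrite ler_pdivlMr// mul1r -[leRHS]real_normK ?num_real//.
  by rewrite lerXn2r ?nnegrE ?normr_ge0 ?(ltW d0).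
have var : bernstein N (fun k => e / 2 + c * (k%:R - N%:R * u) ^+ 2) u <= e.
  rewrite bernsteinD (bernsteinZ N c) bernstein_cst bernstein_variance subrr expr0n/= add0r.
  have -> : c * (N%:R * (u * (1 - u))) = 2 * M / del ^+ 2 * (u * (1 - u)) / N%:R.
    by rewrite /c; field; rewrite Nn0 gt_eqF.
  have : 2 * M / del ^+ 2 * (u * (1 - u)) / N%:R <= e / 2.
    rewrite ler_pdivrMr//.
    have h1 : K * (e / 2) <= e / 2 * N%:R by rewrite mulrC ler_pM2l ?divr_gt0// ltW.
    apply: le_trans h1; have -> : K * (e / 2) = 2 * M / del ^+ 2.
      by rewrite /K; field; rewrite !gt_eqF.
    have K0 : 0 <= 2 * M / del ^+ 2 by apply: divr_ge0; [exact: mulr_ge0|exact: ltW].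
    have u1 : u * (1 - u) <= 1 by have := sqr_ge0 (u - 2^-1); nra.
    by rewrite -[leRHS]mulr1; exact: ler_wpM2l.
  lra.
have B1 := bernsteinD N (fun=> g u) (fun k => -1 * g (k%:R / N%:R)) u.
rewrite bernsteinZ bernstein_cst mulN1r in B1.
rewrite -B1 ler_norml; apply/andP; split.
  rewrite lerNl; have -> : - bernstein N (fun k => g u + -1 * g (k%:R / N%:R)) u =
     bernstein N (fun k => -1 * (g u + -1 * g (k%:R / N%:R))) u.
    by rewrite (bernsteinZ N (-1)) mulN1r.
  rewrite (le_trans _ var)//; apply: le_bernstein => // k /main.
  by rewrite ler_norml => /andP[]; lra.
rewrite (le_trans _ var)//; apply: le_bernstein => // k /main.
by rewrite ler_norml => /andP[]; lra.
Qed.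

End Bernstein.

(** * The closed span of the resolvent functions *)

Section ResolventSpan.
Context {R : realType}.
Variable t0 : R.
Hypothesis t01 : 1 <= t0.

(* Up to the uniform closure, the linear span of the functions
   [(a + b x) / (x^2 + t)]; partial fractions make it stable under
   multiplication by [1 / (x^2 + s)]. *)
Inductive rspan : (R -> R) -> Prop :=
| rspan_base a b t : t0 <= t -> rspan (fun x => (a + b * x) / (x ^+ 2 + t))
| rspanD f g : rspan f -> rspan g -> rspan (fun x => f x + g x)
| rspanZ c f : rspan f -> rspan (fun x => c * f x)
| rspan_lim f (g : nat -> R -> R) : continuous f -> (forall k, rspan (g k)) ->
    (forall k x, `|f x - g k x| <= k.+1%:R^-1) -> rspan f.

Lemma den_ge1 t x : t0 <= t -> 1 <= x ^+ 2 + t.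
Proof. by move=> h; have := sqr_ge0 x; have := t01; lra. Qed.

Lemma den_gt0 t x : t0 <= t -> 0 < x ^+ 2 + t.
Proof. by move=> /(den_ge1 x); lra. Qed.

Lemma continuous_inv_den t : t0 <= t -> continuous (fun x : R => (x ^+ 2 + t)^-1).
Proof.
move=> h x; apply: cvgV; first by rewrite gt_eqF ?den_gt0.
by apply: cvgD; [exact: exprn_continuous|exact: cvg_cst].
Qed.

Lemma continuous_rspan f : rspan f -> continuous f.
Proof.
elim=> {f} [a b t h|f g _ cf _ cg|c f _ cf|f g cf _ _ _] // x.
- apply: cvgM; last exact: continuous_inv_den.
  apply: cvgD; first exact: cvg_cst.
  by apply: cvgM; [exact: cvg_cst|exact: cvg_id].
- by apply: cvgD; [exact: cf|exact: cg].
- by apply: cvgM; [exact: cvg_cst|exact: cf].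
Qed.

(** For different parameters this is partial fractions. The double pole [t = s] is a uniform limit
    of such products with the parameter moved to [s + del], which is the reason for closing [rspan]
    under uniform limits. *)
Lemma rspan_divM f s : t0 <= s -> rspan f -> rspan (fun x => f x / (x ^+ 2 + s)).
Proof.
move=> hs; elim=> {f} [a b t ht|f g _ ihf _ ihg|c f _ ihf|f g cf _ ih fg].
- have neq u : t0 <= u -> u != s -> rspan (fun x => (a + b * x) / (x ^+ 2 + u) / (x ^+ 2 + s)).
    move=> hu us.
    have -> : (fun x => (a + b * x) / (x ^+ 2 + u) / (x ^+ 2 + s)) = (fun x =>
       (s - u)^-1 * ((a + b * x) / (x ^+ 2 + u) + (-1) * ((a + b * x) / (x ^+ 2 + s)))).
      apply/funext => x; have su : s - u != 0 by rewrite subr_eq0 eq_sym.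
      by field; rewrite su !gt_eqF ?den_gt0.
    apply: rspanZ; apply: rspanD; first exact: rspan_base.
    by apply: rspanZ; exact: rspan_base.
  have [->|] := eqVneq t s; last exact: neq.
  (* [K] bounds [(a + b x) / (x^2 + s)], because both 1 and [|x|] are at most [x^2 + s]; a shift of
     [1 / (K (k + 1))] then costs [1 / (k + 1)]. *)
  pose K := `|a| + `|b| + 1.
  have K1 : 1 <= K by rewrite /K; have := normr_ge0 a; have := normr_ge0 b; lra.
  have K0 : 0 < K by lra.
  have d0 k : 0 < (K * k.+1%:R)^-1 by rewrite invr_gt0 mulr_gt0.
  apply: (@rspan_lim _ (fun k x => (a + b * x) / (x ^+ 2 + (s + (K * k.+1%:R)^-1)) / (x ^+ 2 + s))).
  + move=> x; apply: cvgM; last exact: continuous_inv_den.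
    exact: continuous_rspan (rspan_base a b hs) x.
  + move=> k; apply: neq; first by rewrite (le_trans hs)// lerDl ltW.
    by rewrite gt_eqF// ltrDl.
  + move=> k x; have := d0 k; set del := (K * _)^-1 => del0.
    have hd : t0 <= s + del by lra.
    have p0 := den_gt0 x hs; have p1 := den_ge1 x hs.
    have q0 := den_gt0 x hd; have q1 := den_ge1 x hd.
    have -> : (a + b * x) / (x ^+ 2 + s) / (x ^+ 2 + s) -
       (a + b * x) / (x ^+ 2 + (s + del)) / (x ^+ 2 + s) =
       (a + b * x) / (x ^+ 2 + s) * (del * ((x ^+ 2 + s)^-1 * (x ^+ 2 + (s + del))^-1)).
      by field; rewrite !gt_eqF.
    have kd : K * del = k.+1%:R^-1 by rewrite /del invfM mulrA divff ?mul1r// gt_eqF.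
    rewrite -kd normrM; apply: ler_pM => //.
      rewrite normrM normfV (gtr0_norm p0) ler_pdivrMr//.
      rewrite (le_trans (ler_normD _ _))// normrM.
      have : `|x| <= x ^+ 2 + s.
        have := sqr_ge0 (`|x| - 1); rewrite -[x ^+ 2]real_normK ?num_real//.
        have := normr_ge0 x; have := t01; have := hs; nra.
      move=> xX; have hA := ler_wpM2l (normr_ge0 a) p1.
      by have hB := ler_wpM2l (normr_ge0 b) xX; rewrite /K; lra.
    rewrite gtr0_norm; last by rewrite mulr_gt0// mulr_gt0// invr_gt0.
    have i1 : (x ^+ 2 + s)^-1 <= 1 by rewrite invf_le1.
    have i2 : (x ^+ 2 + (s + del))^-1 <= 1 by rewrite invf_le1.
    rewrite ler_piMr ?(ltW del0)// mulr_ile1// invr_ge0; exact: ltW.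
- have -> : (fun x => (f x + g x) / (x ^+ 2 + s)) = (fun x => f x / (x ^+ 2 + s) + g x / (x ^+ 2 + s)).
    by apply/funext => x; rewrite mulrDl.
  exact: rspanD.
- have -> : (fun x => c * f x / (x ^+ 2 + s)) = (fun x => c * (f x / (x ^+ 2 + s))).
    by apply/funext => x; rewrite mulrA.
  exact: rspanZ.
- apply: (@rspan_lim _ (fun k x => g k x / (x ^+ 2 + s))) => //.
    by move=> x; apply: cvgM; [exact: cf|exact: continuous_inv_den].
  move=> k x; rewrite -mulrBl normrM normfV (gtr0_norm (den_gt0 x hs)).
  rewrite ler_pdivrMr ?den_gt0// (le_trans (fg k x))//.
  by rewrite ler_peMr ?den_ge1// invr_ge0.
Qed.

End ResolventSpan.

(** * From resolvent functions to bounded continuous test functions *)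

Section WeakConvergence.
Context {R : realType}.
Variable lam : forall n, 'I_n -> R.

Definition empirical n (f : R -> R) := n%:R^-1 * \sum_(i < n) f (lam i).
(** Continuity is bundled because linearity and monotonicity of [sc_integral] are established for
    continuous functions. *)
Definition esd_cvg (f : R -> R) :=
  continuous f /\ (fun n => empirical n f) @ \oo --> sc_integral f.

Lemma empiricalD n f g : empirical n (fun x => f x + g x) = empirical n f + empirical n g.
Proof. by rewrite /empirical big_split mulrDr. Qed.

Lemma empiricalZ n c f : empirical n (fun x => c * f x) = c * empirical n f.
Proof. by rewrite /empirical -mulr_sumr; ring. Qed.

Lemma le_empirical n f g : (forall x, f x <= g x) -> empirical n f <= empirical n g.
Proof. by move=> h; rewrite ler_wpM2l// ?invr_ge0//; apply: ler_sum. Qed.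

Lemma esd_cvgD f g : esd_cvg f -> esd_cvg g -> esd_cvg (fun x => f x + g x).
Proof.
move=> [cf hf] [cg hg]; split; first by move=> x; apply: cvgD; [exact: cf|exact: cg].
rewrite sc_integralD// (funext (fun n => empiricalD n f g)).
exact: cvgD.
Qed.

Lemma esd_cvgZ c f : esd_cvg f -> esd_cvg (fun x => c * f x).
Proof.
move=> [cf hf]; split; first by move=> x; apply: cvgM; [exact: cvg_cst|exact: cf].
rewrite sc_integralZ// (funext (fun n => empiricalZ n c f)).
by apply: cvgM => //; exact: cvg_cst.
Qed.

Lemma sc_integral_cst (c : R) : sc_integral (fun=> c) = c.
Proof.
rewrite -[RHS]mulr1 -[in RHS](@sc_integral1 R) -sc_integralZ; last by move=> x; exact: cvg_cst.
by under [in RHS]eq_fun do rewrite mulr1.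
Qed.

Lemma esd_cvg_cst c : esd_cvg (fun=> c).
Proof.
split; first by move=> x; exact: cvg_cst.
rewrite sc_integral_cst.
apply: cvg_near_cst; exists 1%N => // n /= n1.
rewrite /empirical sumr_const card_ord -[c *+ n]mulr_natl mulrA mulVf ?mul1r//.
by rewrite pnatr_eq0 -lt0n.
Qed.

(** [w] has to be small only in semicircle mean, not uniformly. The bracket [g - w <= f <= g + w]
    passes to both functionals, and the error is twice the mean of [w] plus two convergence errors,
    four terms of at most [e / 4]. *)
Lemma esd_cvg_sandwich (f : R -> R) : continuous f ->
  (forall e, 0 < e -> exists g w, [/\ esd_cvg g, esd_cvg w, sc_integral w <= e &
     forall x, `|f x - g x| <= w x]) -> esd_cvg f.
Proof.
move=> cf h; split => //; apply/cvgrPdist_le => e e0.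
have e4 : 0 < e / 4 by rewrite divr_gt0.
have [g [w [[cg hg] [cw hw] we fgw]]] := h _ e4.
move/cvgrPdist_le : hg => /(_ _ e4) hg; move/cvgrPdist_le : hw => /(_ _ e4) hw.
near=> n.
have h1 : `|sc_integral g - empirical n g| <= e / 4 by near: n.
have h2 : `|sc_integral w - empirical n w| <= e / 4 by near: n.
have pw x : - w x <= f x - g x <= w x by rewrite -ler_norml.
have E : empirical n g + -1 * empirical n w <= empirical n f <= empirical n g + empirical n w.
  rewrite -empiricalZ -!empiricalD; apply/andP; split; apply: le_empirical => x;
    have /andP[] := pw x; lra.
have cN : continuous (fun x => -1 * w x).
  by move=> x; apply: cvgM; [exact: cvg_cst|exact: cw].
have I : sc_integral g + -1 * sc_integral w <= sc_integral f <= sc_integral g + sc_integral w.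
  rewrite -sc_integralZ// -!sc_integralD//; apply/andP; split; apply: le_sc_integral => // x;
    try (by have /andP[] := pw x; lra).
  - by apply: cvgD; [exact: cg|exact: cN].
  - by apply: cvgD; [exact: cg|exact: cw].
move: h1 h2 E I; rewrite !ler_norml => /andP[? ?] /andP[? ?] /andP[? ?] /andP[? ?].
by apply/andP; split; lra.
Unshelve. all: by end_near.
Qed.

Lemma esd_cvg_uniform_limit (f : R -> R) : continuous f ->
  (forall e, 0 < e -> exists2 g, esd_cvg g & forall x, `|f x - g x| <= e) -> esd_cvg f.
Proof.
move=> cf h; apply: esd_cvg_sandwich => // e e0; have [g cg fg] := h e e0.
exists g, (fun=> e); split => //; first exact: esd_cvg_cst.
by rewrite sc_integral_cst.
Qed.

Section Criterion.
Variable t0 : R.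
Hypothesis t01 : 1 <= t0.
Hypothesis esd_cvg_base : forall t, t0 <= t ->
  esd_cvg (fun x => (x ^+ 2 + t)^-1) /\ esd_cvg (fun x => x / (x ^+ 2 + t)).

Let den0 t (x : R) : t0 <= t -> 0 < x ^+ 2 + t. Proof. exact: den_gt0. Qed.

Lemma esd_cvg_rspan f : rspan t0 f -> esd_cvg f.
Proof.
elim=> {f} [a b t h|f g _ cf _ cg|c f _ cf|f g cf _ ih fg].
- have [c1 c2] := esd_cvg_base h; have := esd_cvgD (esd_cvgZ a c1) (esd_cvgZ b c2).
  by congr esd_cvg; apply/funext => x; ring.
- exact: esd_cvgD.
- exact: esd_cvgZ.
- apply: esd_cvg_uniform_limit => // e e0; pose k := Num.trunc e^-1.
  exists (g k) => // x; rewrite (le_trans (fg k x))//.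
  rewrite invf_ple ?posrE ?ltr0n//; apply/ltW; exact: Num.Theory.truncnS_gt.
Qed.

Variable t : R.
Hypothesis t0t : t0 <= t.
Let y (x : R) := t / (x ^+ 2 + t).
Let tp : 0 < t. Proof. by have := t01; have := t0t; lra. Qed.

Let y01 x : 0 < y x <= 1.
Proof.
have p := den0 x t0t; rewrite /y divr_gt0//= ler_pdivrMr// mul1r.
by rewrite lerDr sqr_ge0.
Qed.

Let cy : continuous y.
Proof. by move=> x; apply: cvgM; [exact: cvg_cst|exact: (continuous_inv_den t01 t0t)]. Qed.

(** The recursion of [bernstein] uses only sums, scalar multiples and products by its argument. The
    prefactor [e] lets one induction serve for both 1 and [x * y x]. *)
Lemma bernstein_closed (K : (R -> R) -> Prop) (e : R -> R) N phi :
  (forall f g, K f -> K g -> K (fun x => f x + g x)) ->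
  (forall c f, K f -> K (fun x => c * f x)) ->
  (forall f, K f -> K (fun x => f x * y x)) ->
  K e -> K (fun x => e x * bernstein N phi (y x)).
Proof.
move=> KD KZ Ky Ke; elim: N phi => [|N ih] phi /=.
  by have := KZ (phi 0%N) _ Ke; congr K; apply/funext => x; rewrite mulrC.
have h1 := Ky _ (ih (fun k => phi k.+1)); have h2 := Ky _ (ih phi).
have := KD _ _ h1 (KD _ _ (ih phi) (KZ (-1) _ h2)).
by congr K; apply/funext => x; ring.
Qed.

Lemma rspan_mul_y f : rspan t0 f -> rspan t0 (fun x => f x * y x).
Proof.
move=> h; have := rspanZ t (rspan_divM t01 t0t h).
by congr rspan; apply/funext => x; rewrite /y; ring.
Qed.

(** A nonzero constant does not vanish at infinity, so the induction runs in constants plus [rspan];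
    multiplication by [y] turns the constant [c] into the base function [c t / (x^2 + t)]. *)
Lemma esd_cvg_bernstein N phi : esd_cvg (fun x => bernstein N phi (y x)).
Proof.
pose K (f : R -> R) := exists c g, rspan t0 g /\ f = (fun x => c + g x).
have : K (fun x => 1 * bernstein N phi (y x)).
  apply: (bernstein_closed (e := fun=> 1)).
  - move=> _ _ [c [f [hf ->]]] [c' [g [hg ->]]]; exists (c + c'), (fun x => f x + g x).
    by split; [exact: rspanD|apply/funext => x; ring].
  - move=> a _ [c [f [hf ->]]]; exists (a * c), (fun x => a * f x).
    by split; [exact: rspanZ|apply/funext => x; ring].
  - move=> _ [c [f [hf ->]]]; exists 0, (fun x => (c * t + 0 * x) / (x ^+ 2 + t) + f x * y x).
    split; last by apply/funext => x; rewrite /y; ring.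
    by apply: rspanD; [exact: rspan_base|exact: rspan_mul_y].
  - exists 1, (fun x => 0 * ((0 + 0 * x) / (x ^+ 2 + t))).
    by split; [apply: rspanZ; exact: rspan_base|apply/funext => x; rewrite mul0r addr0].
move=> [c [g [hg e]]].
have -> : (fun x => bernstein N phi (y x)) = (fun x => c + g x).
  by rewrite -e; apply/funext => x; rewrite mul1r.
by apply: esd_cvgD; [exact: esd_cvg_cst|exact: esd_cvg_rspan].
Qed.

Lemma esd_cvg_bernstein_odd N phi : esd_cvg (fun x => x * y x * bernstein N phi (y x)).
Proof.
apply: esd_cvg_rspan; apply: (bernstein_closed (e := fun x => x * y x)).
- exact: rspanD.
- exact: rspanZ.
- exact: rspan_mul_y.
- have := rspan_base 0 t t0t; congr rspan; apply/funext => x; rewrite /y; ring.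
Qed.

(** An even function depends on [x^2 = t / y - t] alone, hence on [y], which lies between 0 and 1;
    vanishing at infinity says that this function of [y] extends continuously by 0 at [y = 0]. *)
Lemma even_bernstein_approx (phi : R -> R) (e : R) : continuous phi ->
  (forall x, phi (- x) = phi x) ->
  (forall e, 0 < e -> exists K, forall x, K <= `|x| -> `|phi x| <= e) -> 0 < e ->
  exists N c, forall x, `|phi x - bernstein N c (y x)| <= e.
Proof.
move=> cphi ev van e0.
pose h v := phi (Num.sqrt (t / v - t)).
pose g v := if 0 < v then h v else 0.
have hy x : g (y x) = phi x.
  have /andP[p _] := y01 x; rewrite /g p /h.
  have -> : t / y x - t = x ^+ 2.
    by rewrite /y; field; rewrite !gt_eqF ?den0.
  by rewrite sqrtr_sqr; case: (ger0P x) => // _; rewrite ev.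
have cg : continuous g.
  move=> u; have [u0|u0|->] := ltgtP u 0.
  - apply/cvgrPdist_le => d d0; near=> v.
    have v0 : v < 0 by near: v; exact: lt_nbhsl.
    by rewrite /g !ltNge (ltW u0) (ltW v0) /= subrr normr0 ltW.
  - have ch : {for u, continuous h}.
      have -> : h = phi \o (@Num.sqrt R \o (fun v => t / v - t)) by [].
      apply: continuous_comp; last exact: cphi.
      apply: continuous_comp; last exact: sqrt_continuous.
      apply: cvgB; last exact: cvg_cst.
      by apply: cvgM; [exact: cvg_cst|apply: cvgV; [rewrite gt_eqF|exact: cvg_id]].
    apply/cvgrPdist_le => d d0; move/cvgrPdist_le : ch => /(_ _ d0) ch; near=> v.
    have v0 : 0 < v by near: v; exact: lt_nbhsr.
    by rewrite /g u0 v0; near: v.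
  - apply/cvgrPdist_le => d d0; have [K hK] := van _ d0.
    (* For [v > 0], the condition [v <= t / (K'^2 + t)] amounts to [t / v - t >= K'^2], so the point
       behind [v] lies beyond [K]. *)
    pose K' := `|K| + 1; have K'0 : 0 < K' by rewrite /K'; have := normr_ge0 K; lra.
    have q0 : 0 < t / (K' ^+ 2 + t) by rewrite divr_gt0// addr_gt0// exprn_gt0.
    near=> v; rewrite {1}/g ltxx sub0r normrN /g; case: ltP => v0; last by rewrite normr0 ltW.
    apply: hK; rewrite ger0_norm ?sqrtr_ge0//.
    apply: (@le_trans _ _ K'); first by rewrite /K'; have := ler_norm K; lra.
    have vq : v <= t / (K' ^+ 2 + t) by apply: ltW; near: v; exact: lt_nbhsl.
    have hv : K' ^+ 2 <= t / v - t.
      by rewrite lerBrDr ler_pdivlMr// mulrC -ler_pdivlMr// addr_gt0// exprn_gt0.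
    by rewrite -[leLHS](gtr0_norm K'0) -sqrtr_sqr; exact: ler_wsqrtr.
have [N [c hc]] := bernstein_approx cg e0.
exists N, c => x; rewrite -hy; apply: hc.
by have /andP[p q] := y01 x; rewrite (ltW p) q.
Unshelve. all: by end_near.
Qed.

(** The even part of [f] times [y] is even and vanishes at infinity, so polynomials in [y]
    approximate it. The odd part is not a function of [y]; it is approximated by [x y] times a
    polynomial in [y], once its quotient by [x] has been regularised at 0. *)
Lemma esd_cvg_mul_y (f : R -> R) : continuous f -> (exists M, forall x, `|f x| <= M) ->
  esd_cvg (fun x => f x * y x).
Proof.
move=> cf [M0 hM0]; pose M := `|M0| + 1.
have M_gt0 : 0 < M by rewrite /M; have := normr_ge0 M0; lra.
have hM x : `|f x| <= M by rewrite (le_trans (hM0 x))// /M; have := ler_norm M0; lra.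
have cNf : continuous (fun x => f (- x)).
  by move=> x; apply: (@continuous_comp _ _ _ (fun x : R => - x) f); [exact: opp_continuous|exact: cf].
pose fe x := (f x + f (- x)) / 2; pose fo x := (f x - f (- x)) / 2.
have cfe : continuous fe.
  by move=> x; apply: cvgM; [apply: cvgD; [exact: cf|exact: cNf]|exact: cvg_cst].
have cfo : continuous fo.
  by move=> x; apply: cvgM; [apply: cvgB; [exact: cf|exact: cNf]|exact: cvg_cst].
have feM x : `|fe x| <= M.
  rewrite ler_norml; have := hM x; have := hM (- x); rewrite !ler_norml => /andP[? ?] /andP[? ?].
  by apply/andP; rewrite /fe; split; lra.
have foM x : `|fo x| <= M.
  rewrite ler_norml; have := hM x; have := hM (- x); rewrite !ler_norml => /andP[? ?] /andP[? ?].
  by apply/andP; rewrite /fo; split; lra.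
have yN x : y (- x) = y x by rewrite /y sqrrN.
have norm_le x : `|x| <= x ^+ 2 + t.
  have := sqr_ge0 (`|x| - 1); rewrite -[x ^+ 2]real_normK ?num_real//.
  have := normr_ge0 x; have := t01; have := t0t; nra.
have vanish (phi : R -> R) c : (forall x, `|x| * `|phi x| <= c) ->
    forall e, 0 < e -> exists K, forall x, K <= `|x| -> `|phi x| <= e.
  move=> h e e0; have c0 : 0 <= c by rewrite (le_trans _ (h 0))// normr0 mul0r.
  exists (c / e + 1) => x hx.
  have x0 : 0 < `|x| by apply: lt_le_trans hx; rewrite ltr_wpDl// divr_ge0// ltW.
  rewrite -(ler_pM2l x0) (le_trans (h x))// -ler_pdivrMr// (le_trans _ hx)//.
  by rewrite lerDl.
have cve : esd_cvg (fun x => fe x * y x).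
  apply: esd_cvg_uniform_limit => [x|e e0]; first by apply: cvgM; [exact: cfe|exact: cy].
  have [||| |N [c hc]] := @even_bernstein_approx (fun x => fe x * y x) e.
  - by move=> x; apply: cvgM; [exact: cfe|exact: cy].
  - by move=> x; rewrite yN /fe opprK (addrC (f (- x))).
  - apply: (vanish _ (M * t)) => x; rewrite normrM mulrCA.
    apply: ler_pM => //.
    have /andP[p _] := y01 x; rewrite (gtr0_norm p) /y mulrCA ler_piMr ?(ltW tp)//.
    by rewrite ler_pdivrMr ?den0// mul1r norm_le.
  - exact: e0.
  by exists (fun x => bernstein N c (y x)); [exact: esd_cvg_bernstein|exact: hc].
have cvo : esd_cvg (fun x => fo x * y x).
  apply: esd_cvg_uniform_limit => [x|e e0]; first by apply: cvgM; [exact: cfo|exact: cy].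
  have fo0 : fo 0 = 0 by rewrite /fo oppr0 subrr mul0r.
  have e2 : 0 < e / 2 by rewrite divr_gt0.
  have [rho rho0 hrho] : exists2 rho : R, 0 < rho & forall x, `|x| < rho -> `|fo x| <= e / 2.
    have /cvgrPdist_le/(_ _ e2)/nbhs_ballP[rho /= rho0 hr] := cfo 0.
    exists rho => // x xr; have : `|fo 0 - fo x| <= e / 2.
      by apply: hr; rewrite /ball/= sub0r normrN.
    by rewrite fo0 sub0r normrN.
  (* [phi] below replaces [fo x / x], which need not extend continuously to 0. The error is
     [y fo del / (x^2 + del)]: for [|x| < rho] the factor [fo] is at most [e / 2], and elsewhere
     [M del / rho^2 = e / 2], which fixes [del]. *)
  pose del := rho ^+ 2 * (e / 2) / M.
  have del0 : 0 < del by rewrite /del divr_gt0// mulr_gt0// exprn_gt0.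
  have dd x : 0 < x ^+ 2 + del by rewrite ltr_wpDl// sqr_ge0.
  pose phi x := fo x * x / (x ^+ 2 + del).
  have step1 x : `|fo x * y x - x * y x * phi x| <= e / 2.
    have -> : fo x * y x - x * y x * phi x = y x * (fo x * (del / (x ^+ 2 + del))).
      by rewrite /phi; field; rewrite gt_eqF.
    have /andP[p q] := y01 x; rewrite normrM (gtr0_norm p).
    apply: (@le_trans _ _ (1 * `|fo x * (del / (x ^+ 2 + del))|)); first by rewrite ler_wpM2r.
    rewrite mul1r normrM (ger0_norm (divr_ge0 (ltW del0) (ltW (dd x)))).
    have [xr|xr] := ltP `|x| rho.
      apply: (@le_trans _ _ (e / 2 * 1)); last by rewrite mulr1.
      apply: ler_pM => //; [by rewrite divr_ge0// ltW|exact: hrho|].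
      by rewrite ler_pdivrMr// mul1r lerDr sqr_ge0.
    apply: (@le_trans _ _ (M * (del / rho ^+ 2))).
      apply: ler_pM => //; first by rewrite divr_ge0// ltW.
      rewrite ler_wpM2l ?(ltW del0)// lef_pV2 ?posrE ?exprn_gt0//.
      apply: (@le_trans _ _ (x ^+ 2)); last by rewrite lerDl ltW.
      by rewrite -[x ^+ 2]real_normK ?num_real// lerXn2r ?nnegrE ?(ltW rho0).
    have -> : M * (del / rho ^+ 2) = e / 2.
      by rewrite /del; field; rewrite !gt_eqF.
    exact: lexx.
  (* Since [|x * y x| <= t], an error [e / 2 / t] on [phi] costs at most [e / 2]. *)
  have e3 : 0 < e / 2 / t by rewrite divr_gt0.
  have [||| |N [c hc]] := @even_bernstein_approx phi (e / 2 / t).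
  - move=> x; apply: cvgM; first by apply: cvgM; [exact: cfo|exact: cvg_id].
    apply: cvgV; first by rewrite gt_eqF.
    by apply: cvgD; [exact: exprn_continuous|exact: cvg_cst].
  - by move=> x; rewrite /phi sqrrN /fo opprK; congr (_ / _); ring.
  - apply: (vanish _ M) => x; rewrite /phi normrM normfV (gtr0_norm (dd x)) normrM.
    rewrite mulrA ler_pdivrMr// mulrCA; apply: ler_pM => //.
    by rewrite -expr2 real_normK ?num_real// lerDl ltW.
  - exact: e3.
  exists (fun x => x * y x * bernstein N c (y x)); first exact: esd_cvg_bernstein_odd.
  move=> x; have -> : fo x * y x - x * y x * bernstein N c (y x) =
     (fo x * y x - x * y x * phi x) + x * y x * (phi x - bernstein N c (y x)) by ring.
  rewrite (le_trans (ler_normD _ _))//.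
  have -> : e = e / 2 + t * (e / 2 / t) by field; rewrite gt_eqF.
  apply: lerD; first exact: step1.
  rewrite normrM; apply: ler_pM => //.
  have /andP[p _] := y01 x; rewrite normrM (gtr0_norm p) /y mulrCA ler_piMr ?(ltW tp)//.
  by rewrite ler_pdivrMr ?den0// mul1r norm_le.
have := esd_cvgD cve cvo; congr esd_cvg; apply/funext => x.
by rewrite /fe /fo; field.
Qed.

End Criterion.

(** Replacing [f] by [f y] loses at most [M (1 - y)], whose semicircle mean is [M m^2] with
    [m = (a - eta) / 2] and [m (m + eta) = 1]. The convergence of the empirical mean of [1 - y]
    supplies the tightness. *)
Lemma weak_convergence_criterion (eta0 : R) : 1 <= eta0 ->
  (forall eta, eta0 <= eta ->
    esd_cvg (fun x => (x ^+ 2 + eta ^+ 2)^-1) /\ esd_cvg (fun x => x / (x ^+ 2 + eta ^+ 2))) ->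
  forall f : R -> R, continuous f -> (exists M, forall x, `|f x| <= M) -> esd_cvg f.
Proof.
move=> eta01 hbase f cf bf.
have t01 : 1 <= eta0 ^+ 2 by rewrite exprn_ege1.
have base t : eta0 ^+ 2 <= t ->
    esd_cvg (fun x => (x ^+ 2 + t)^-1) /\ esd_cvg (fun x => x / (x ^+ 2 + t)).
  move=> h; have t0 : 0 <= t by lra.
  rewrite -(sqr_sqrtr t0); apply: hbase.
  have e0 : 0 <= eta0 by lra.
  by rewrite -[eta0](ger0_norm e0) -sqrtr_sqr; exact: ler_wsqrtr.
have [M0 hM0] := bf; pose M := `|M0| + 1.
have M_gt0 : 0 < M by rewrite /M; have := normr_ge0 M0; lra.
have hM x : `|f x| <= M by rewrite (le_trans (hM0 x))// /M; have := ler_norm M0; lra.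
apply: esd_cvg_sandwich => // e e0.
(* With [m <= 1] and [m eta <= 1], the inequality [eta >= M / e] gives
   [M m^2 <= M m <= e eta m <= e]. *)
pose eta := eta0 + M / e.
have Me : 0 < M / e by rewrite divr_gt0.
have he : eta0 <= eta by rewrite /eta; lra.
have eta1 : 1 <= eta by lra.
have ep : 0 < eta by lra.
have ht : eta0 ^+ 2 <= eta ^+ 2 by rewrite lerXn2r ?nnegrE; lra.
pose y x := eta ^+ 2 / (x ^+ 2 + eta ^+ 2).
have cy : esd_cvg y by apply: esd_cvgZ; have [] := hbase _ he.
have den x : 0 < x ^+ 2 + eta ^+ 2 by rewrite ltr_wpDl ?sqr_ge0// exprn_gt0.
have yle x : y x <= 1 by rewrite ler_pdivrMr// mul1r lerDr sqr_ge0.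
exists (fun x => f x * y x), (fun x => M * (1 + (-1) * y x)); split.
- exact: (esd_cvg_mul_y t01 base ht).
- by apply: esd_cvgZ; apply: esd_cvgD; [exact: esd_cvg_cst|exact: esd_cvgZ].
- have cyc : continuous y by case: cy.
  have cNy : continuous (fun x => -1 * y x).
    by move=> x; apply: cvgM; [exact: cvg_cst|exact: cyc].
  have c1 : continuous (fun _ : R => 1 : R) by move=> x; exact: cvg_cst.
  rewrite sc_integralZ; last by move=> x; apply: cvgD; [exact: c1|exact: cNy].
  rewrite sc_integralD// sc_integral1 sc_integralZ//.
  rewrite sc_integralZ; last exact: continuous_resolvent_even.
  rewrite sc_integral_even//.
  set a := Num.sqrt _.
  have a2 : a ^+ 2 = eta ^+ 2 + 4 by rewrite sqr_sqrtr// addr_ge0// sqr_ge0.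
  have ea : eta <= a.
    by rewrite -[leLHS](gtr0_norm ep) -sqrtr_sqr ler_wsqrtr// lerDl.
  have -> : 1 + -1 * (eta ^+ 2 * ((a - eta) / 2 / eta)) = ((a - eta) / 2) ^+ 2.
    have -> : ((a - eta) / 2) ^+ 2 = (a ^+ 2 - 2 * a * eta + eta ^+ 2) / 4 by field.
    by rewrite a2; field; rewrite gt_eqF.
  set m := (a - eta) / 2.
  have m0 : 0 <= m by rewrite /m divr_ge0// subr_ge0.
  have mE : m * (m + eta) = 1.
    have -> : m * (m + eta) = (a ^+ 2 - eta ^+ 2) / 4 by rewrite /m; field.
    by rewrite a2; field.
  have meta : m * eta <= 1 by have := sqr_ge0 m; nra.
  have m1 : m <= 1 by nra.
  have : M <= e * eta.
    have : M / e <= eta by rewrite /eta; lra.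
    by rewrite ler_pdivrMr// mulrC.
  move=> hMe; have : M * m <= e * eta * m by rewrite ler_wpM2r.
  have : e * (m * eta) <= e * 1 by rewrite ler_wpM2l// ltW.
  have : M * m * m <= M * m * 1 by rewrite ler_wpM2l// mulr_ge0// ltW.
  by rewrite expr2; nra.
- move=> x; have -> : f x - f x * y x = f x * (1 + -1 * y x) by ring.
  rewrite normrM [X in _ * X]ger0_norm; last by have := yle x; lra.
  by rewrite ler_wpM2r//; have := yle x; lra.
Qed.

End WeakConvergence.

(** * Almost sure convergence *)

(** The sum of the [Y n] has finite expectation by monotone convergence, so it is finite almost
    everywhere and its terms tend to 0. *)
Lemma ae_cvg0_of_summable d (T : measurableType d) (R : realType) (P : probability T R)
  (Y : nat -> T -> R) (K : R) :
  (forall n x, 0 <= Y n x) -> (forall n, intble P (Y n)) ->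
  (forall N, \sum_(0 <= n < N) Ex P (Y n) <= K) ->
  {ae P, forall x, Y ^~ x @ \oo --> 0}.
Proof.
move=> Y0 iY YK.
pose S x := (\sum_(0 <= n <oo) (Y n x)%:E)%E.
have mY n : measurable_fun setT (fun x => (Y n x)%:E).
  by have /measurable_int := iY n.
have S0 x : (0 <= S x)%E by apply: nneseries_ge0 => n _ _; rewrite lee_fin.
have iS : P.-integrable setT S.
  apply/integrableP; split.
    by apply: ge0_emeasurable_sum => // n x _ _; rewrite lee_fin.
  under eq_integral do rewrite gee0_abs//.
  rewrite integral_nneseries//; last by move=> n x _; rewrite lee_fin.
  apply: (@le_lt_trans _ _ K%:E); last exact: ltry.
  apply: lime_le.
    by apply: is_cvg_nneseries => n _ _; apply: integral_ge0 => x _; rewrite lee_fin.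
  apply: nearW => N; rewrite (eq_bigr (fun n => (Ex P (Y n))%:E)).
    by rewrite sumEFin lee_fin.
  by move=> n _; rewrite EFin_Ex.
have := integrable_ae measurableT iS.
apply: filterS => x /(_ I) Sfin.
apply: cvg_series_cvg_0; apply: nondecreasing_is_cvgn.
  by apply: nondecreasing_series => n _ _; exact: Y0.
exists (fine (S x)) => _ [N _ <-].
rewrite -lee_fin fineK// /series/= -sumEFin.
by apply: nneseries_lim_ge => n _ _; rewrite lee_fin.
Qed.

Lemma ae_cvg_of_fourth_moment d (T : measurableType d) (R : realType) (P : probability T R)
  (X : nat -> T -> R) (c : nat -> R) (l K : R) : 0 <= K ->
  (forall n, intble P (fun x => (X n x - c n) ^+ 4)) ->
  (forall n, (0 < n)%N -> Ex P (fun x => (X n x - c n) ^+ 4) <= K / n%:R ^+ 2) ->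
  c @ \oo --> l ->
  {ae P, forall x, X ^~ x @ \oo --> l}.
Proof.
move=> K0 iX hX cl.
(* The shift by one avoids [n = 0], for which no moment bound is assumed. *)
pose Y n x := (X n.+1 x - c n.+1) ^+ 4.
(* Telescoping, from [1 / y^2 <= 2 / y - 2 / (y + 1)] for [y >= 1]. *)
have YK N : \sum_(0 <= n < N) Ex P (Y n) <= 2 * K - 2 * K / N.+1%:R.
  elim: N => [|N ih].
    by rewrite big_geq// invr1 mulr1 subrr.
  rewrite big_nat_recr//= (le_trans (lerD ih (hX N.+1 isT)))//.
  have y1 : 1 <= N.+1%:R :> R by rewrite ler1n.
  have -> : N.+2%:R = N.+1%:R + 1 :> R by rewrite natr1.
  move: (N.+1%:R : R) y1 => y y1.
  have y0 : 0 < y by lra.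
  have y10 : 0 < y + 1 by lra.
  rewrite -subr_ge0.
  have -> : 2 * K - 2 * K / (y + 1) - (2 * K - 2 * K / y + K / y ^+ 2) =
     K * (y - 1) / (y ^+ 2 * (y + 1)) by field; rewrite !gt_eqF.
  by rewrite divr_ge0 ?mulr_ge0 ?sqr_ge0 ?subr_ge0// ltW.
have : {ae P, forall x, Y ^~ x @ \oo --> 0}.
  apply: (@ae_cvg0_of_summable _ _ _ P Y (2 * K)).
  - move=> n x; rewrite /Y (_ : _ ^+ 4 = ((X n.+1 x - c n.+1) ^+ 2) ^+ 2) ?sqr_ge0//.
    by rewrite -exprM.
  - by move=> n; exact: iX.
  - by move=> N; rewrite (le_trans (YK N))// gerBl divr_ge0// mulr_ge0.
apply: filterS => x hY.
have h0 : (fun n => X n x - c n) @ \oo --> 0.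
  apply/cvgrPdist_le => e e0.
  have e4 : 0 < e ^+ 4 by rewrite exprn_gt0.
  move/cvgrPdist_le : hY => /(_ _ e4) [N _ hN].
  exists N.+1 => // -[//|n] /= Nn; have := hN n Nn.
  rewrite /Y !sub0r !normrN normrX => h.
  by rewrite -(@ler_pXn2r _ 4)// nnegrE// ltW.
have -> : X ^~ x = (fun n => X n x - c n + c n) by apply/funext => n; rewrite subrK.
by rewrite -[l]add0r; exact: cvgD.
Qed.

Section ImageExpectation.
Context d d' (T : measurableType d) (U : measurableType d') (R : realType).
Variables (P : probability T R) (X : T -> U) (mX : measurable_fun setT X).
Variables (F : U -> R) (mF : measurable_fun setT F).

Lemma intble_image_law : intble P (F \o X) -> intble (image_law P mX) F.
Proof.
move=> h; have mE : measurable_fun setT (EFin \o F) by exact/measurable_EFinP.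
exact: (integrable_pushforward mX mE h measurableT).
Qed.

Lemma Ex_image_law : intble P (F \o X) -> Ex (image_law P mX) F = Ex P (F \o X).
Proof.
move=> h; have mE : measurable_fun setT (EFin \o F) by exact/measurable_EFinP.
by rewrite /Ex /Rintegral; congr fine; exact: (integral_pushforward mX mE h measurableT).
Qed.

End ImageExpectation.

(** * Transfer from the random matrices to the law of their coordinates *)

Section MatrixLaw.
Context {R : realType} {d : measure_display} {T : measurableType d}.
Variables (P : probability T R) (n : nat) (V : 'I_n -> 'I_n -> T -> R[i]).
Local Notation N := #|{: 'I_n * 'I_n}|.
Local Notation E := (N.-tuple (R * R)%type).
Hypothesis mV : forall i j, cmeasurable (V i j).
Hypothesis hV : forall i j w, V i j w = conjc (V j i w).
Local Notation U := [set ij : 'I_n * 'I_n | (ij.1 <= ij.2)%N]%SET.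
Hypothesis iV : cindependent P U (fun ij => V ij.1 ij.2).

(** The constants below the diagonal are independent of everything, so all [N] coordinates are
    independent while the index set remains the full square. *)
Definition upper_coords (w : T) : E :=
  [tuple (let ij := enum_val (e : 'I_N) in if (ij.1 <= ij.2)%N then
     (complex.Re (V ij.1 ij.2 w), complex.Im (V ij.1 ij.2 w)) else (0, 0)) | e < N].

Lemma tnth_upper_coords w ij : tnth (upper_coords w) (enum_rank ij) =
  if (ij.1 <= ij.2)%N then
     (complex.Re (V ij.1 ij.2 w), complex.Im (V ij.1 ij.2 w)) else (0, 0).
Proof. by rewrite tnth_mktuple enum_rankK. Qed.

Lemma measurable_upper_coords : measurable_fun setT upper_coords.
Proof.
apply/measurable_fun_tnthP => e; rewrite -(enum_valK e).
rewrite (_ : _ \o _ = (fun w => tnth (upper_coords w) (enum_rank (enum_val e))))//.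
rewrite (funext (fun w => tnth_upper_coords w (enum_val e))).
case: (_ <= _)%N; last exact: measurable_cst.
by have [m1 m2] := mV (enum_val e).1 (enum_val e).2; exact: measurable_fun_pair.
Qed.

Lemma hmatrix_upper_coords w : hmatrix (upper_coords w) = \matrix_(i, j) V i j w.
Proof.
apply/matrixP => i j; rewrite !mxE /entry !tnth_upper_coords /= leqnn.
case: (ltngtP i j) => [||/val_inj <-].
- by case: (V i j w).
- by rewrite (hV i j); case: (V j i w).
- have := hV i i w; case: (V i i w) => a b [] /= /eqP.
  by rewrite -subr_eq0 opprK -mulr2n mulrn_eq0 /= => /eqP ->.
Qed.

Lemma in_bigsetI (I : finType) (J : {set I}) (F : I -> set T) w :
  (\big[setI/setT]_(i in J) F i) w <-> (forall i, i \in J -> F i w).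
Proof.
rewrite -bigcap_seq_cond; split => h i; last by move=> /= /andP[_]; exact: h.
by move=> iJ; apply: h; rewrite /= mem_index_enum.
Qed.

(** Below the diagonal each coordinate event is everything or empty. If all of them are everything,
    the claim is the hypothesis [iV]; if one is empty, both sides are 0. *)
Lemma independent_upper_coords :
  independent_coordinates (image_law P measurable_upper_coords).
Proof.
move=> B mB; pose F ij := [set w | B (enum_rank ij) (tnth (upper_coords w) (enum_rank ij))].
transitivity (\prod_(ij : 'I_n * 'I_n) P (F ij))%E; last first.
  by rewrite [RHS](reindex enum_rank) //; apply: onW_bij; exact: enum_rank_bij.
transitivity (P [set w | forall ij, F ij w]).
  rewrite /= /image_law /pushforward; congr (P _); apply/seteqP; split=> w h.
    by move=> ij; exact: h.
  by move=> e; rewrite -(enum_valK e); exact: h.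
have [h0|] := pselect (forall ij : 'I_n * 'I_n, ~~ (ij.1 <= ij.2)%N -> B (enum_rank ij) (0, 0)).
  have FT ij : ij \notin U -> F ij = setT.
    rewrite inE => h; apply/seteqP; split=> // w _.
    by rewrite /F /= tnth_upper_coords (negbTE h); exact: h0.
  have FU ij : ij \in U -> F ij = [set w | B (enum_rank ij) (complex.Re (V ij.1 ij.2 w), complex.Im (V ij.1 ij.2 w))].
    by rewrite inE => h; apply/seteqP; split=> w; rewrite /F /= tnth_upper_coords h.
  have key := iV (B := fun ij => B (enum_rank ij)) (fintype.subxx U) (fun ij => mB (enum_rank ij)).
  rewrite [RHS](bigID (fun ij => ij \in U)) /= [X in _ = (_ * X)%E]big1 ?mule1; last first.
    by move=> ij /FT ->; exact: probability_setT.
  rewrite (eq_bigr (fun ij => P [set w | B (enum_rank ij)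
    (complex.Re (V ij.1 ij.2 w), complex.Im (V ij.1 ij.2 w))])); last by move=> ij /FU ->.
  rewrite -key; congr (P _); apply/seteqP; split=> w.
    by move=> h; apply/in_bigsetI => ij ijU; have := h ij; rewrite FU.
  move=> /in_bigsetI h ij; have [ijU|/FT ->//] := boolP (ij \in U).
  by rewrite FU//; exact: h.
move=> /existsNP[ij /not_implyP[ijU nB]].
have F0 : F ij = set0.
  by apply/seteqP; split=> // w; rewrite /F /= tnth_upper_coords (negbTE ijU).
rewrite (bigD1 ij)//= F0 measure0 mul0e.
rewrite (_ : [set w | forall ij, F ij w] = set0) ?measure0//.
by apply/seteqP; split=> // w /(_ ij); rewrite F0.
Qed.

Definition matrix_law : probability E R := image_law P measurable_upper_coords.

Lemma Ex_matrix_law (F : R[i] -> R) i j :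
  measurable_fun setT (fun x : E => F (hmatrix x i j)) ->
  intble P (fun w => F (V i j w)) ->
  intble matrix_law (fun x : E => F (hmatrix x i j)) /\
  Ex matrix_law (fun x : E => F (hmatrix x i j)) = Ex P (fun w => F (V i j w)).
Proof.
move=> mF iF.
have e : (fun x : E => F (hmatrix x i j)) \o upper_coords = (fun w => F (V i j w)).
  by apply/funext => w /=; rewrite hmatrix_upper_coords mxE.
rewrite -e in iF *.
by split; [exact: intble_image_law|exact: Ex_image_law].
Qed.

Hypothesis meanV : forall i j : 'I_n, (i <= j)%N ->
  P.-integrable setT (fun w => (complex.Re (V i j w))%:E) /\
  P.-integrable setT (fun w => (complex.Im (V i j w))%:E) /\ cmean P (V i j) = 0.
Hypothesis varV : forall i j : 'I_n, (i <= j)%N -> (cvar P (V i j) < +oo)%E.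

Lemma mean_entry i j : [/\ intble P (fun w => complex.Re (V i j w)),
  intble P (fun w => complex.Im (V i j w)),
  Ex P (fun w => complex.Re (V i j w)) = 0 & Ex P (fun w => complex.Im (V i j w)) = 0].
Proof.
have [ij|/ltnW ij] := leqP i j.
  by have [h1 [h2]] := meanV ij; rewrite /cmean => -[h3 h4]; split.
have [h1 [h2]] := meanV ij; rewrite /cmean => -[h3 h4].
have e1 : (fun w => complex.Re (V i j w)) = (fun w => complex.Re (V j i w)).
  by apply/funext => w; rewrite hV cReJ.
have e2 : (fun w => complex.Im (V i j w)) = (fun w => - complex.Im (V j i w)).
  by apply/funext => w; rewrite hV cImJ.
rewrite e1 e2; split => //; first exact: intbleN.
by rewrite ExN// [Ex _ _]h4 oppr0.
Qed.

Lemma cmean_entry i j : cmean P (V i j) = 0.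
Proof. by have [_ _ h1 h2] := mean_entry i j; rewrite /cmean [X in Complex X _]h1 [X in Complex _ X]h2. Qed.

Lemma cvar_entry i j : cvar P (V i j) = (\int[P]_w ((cabs (V i j w)) ^+ 2)%:E)%E.
Proof. by rewrite /cvar cmean_entry; apply: eq_integral => w _; rewrite subr0. Qed.

Lemma intble_sqr_entry i j : intble P (fun w => cabs (V i j w) ^+ 2).
Proof.
have fin (k l : 'I_n) : (k <= l)%N -> intble P (fun w => cabs (V k l w) ^+ 2).
  move=> kl; have := varV kl; rewrite cvar_entry => h.
  apply/integrableP; split.
    by apply/measurable_EFinP; apply: measurable_funX; exact: measurable_cabs.
  suff -> : (\int[P]_w `|(EFin \o (fun w => (cabs (V k l w) ^+ 2)%R)) w|)%E =
    (\int[P]_w ((cabs (V k l w)) ^+ 2)%:E)%E by [].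
  by apply: eq_integral => w _ /=; rewrite ger0_norm ?sqr_ge0.
have [ij|/ltnW ij] := leqP i j; first exact: fin.
by under eq_fun do rewrite hV cabsJ; exact: fin.
Qed.

Let mcabs i j : measurable_fun setT (fun x : E => cabs (hmatrix x i j)).
Proof. by apply: measurable_cabs; exact: cmeasurable_hmatrix. Qed.

Lemma matrix_law_sqr i j : intble matrix_law (fun x : E => cabs (hmatrix x i j) ^+ 2) /\
  entry_var matrix_law i j = fine (cvar P (V i j)).
Proof.
have [h1 h2] := Ex_matrix_law (F := fun z => cabs z ^+ 2)
  (measurable_funX 2 (mcabs i j)) (intble_sqr_entry i j).
by split => //; rewrite cvar_entry; exact: h2.
Qed.

Lemma matrix_law_mean i j : Ex matrix_law (fun x : E => complex.Re (hmatrix x i j)) = 0 /\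
  Ex matrix_law (fun x : E => complex.Im (hmatrix x i j)) = 0.
Proof.
have [i1 i2 h1 h2] := mean_entry i j; have [m1 m2] := cmeasurable_hmatrix (R := R) i j.
split.
  by have [_ ->] := Ex_matrix_law (F := fun z => complex.Re z) m1 i1.
by have [_ ->] := Ex_matrix_law (F := fun z => complex.Im z) m2 i2.
Qed.

Lemma matrix_law_tail eps i j : entry_tail matrix_law eps i j =
  fine (\int[P]_w ((cabs (V i j w)) ^+ 2 * (eps < cabs (V i j w))%R%:R)%:E)%E.
Proof.
have mind (S : Type) (c : S -> R) : (fun x => (eps < c x)%R%:R : R) =
  (fun x => if eps < c x then 1 else 0) by apply/funext => x; case: ifP.
have mm : measurable_fun setT
    (fun x : E => cabs (hmatrix x i j) ^+ 2 * (eps < cabs (hmatrix x i j))%R%:R).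
  apply: measurable_funM; first exact: measurable_funX.
  rewrite mind; apply: measurable_fun_ifT; [|exact: measurable_cst..].
  by apply: measurable_fun_ltr => //; exact: measurable_cst.
have mi : measurable_fun setT (fun w => (eps < cabs (V i j w))%R%:R : R).
  rewrite mind; apply: measurable_fun_ifT; [|exact: measurable_cst..].
  by apply: measurable_fun_ltr; [exact: measurable_cst|exact: measurable_cabs].
have ii : intble P (fun w => (cabs (V i j w)) ^+ 2 * (eps < cabs (V i j w))%R%:R).
  apply: intbleM_bounded => //; first exact: intble_sqr_entry.
  by exists 1 => w; case: (_ < _); rewrite ?normr1 ?normr0.
by have [_] := Ex_matrix_law (F := fun z => cabs z ^+ 2 * (eps < cabs z)%R%:R) mm ii.
Qed.

End MatrixLaw.

Lemma cvg0_near_le (R : realType) (u : nat -> R) (e : R) : u @ \oo --> 0 -> 0 < e ->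
  \forall n \near \oo, u n <= e.
Proof.
move=> /cvgrPdist_le h /h; apply: filterS => n.
by rewrite sub0r normrN => /(le_trans (ler_norm _)).
Qed.

(** * Limits of the normalized trace along the sequence *)

Section Convergence.
Context {R : realType} {d : measure_display} {T : measurableType d}.
Variables (P : probability T R) (W : forall n : nat, 'I_n -> 'I_n -> T -> R[i]) (C : R).
Hypothesis mW : forall n (i j : 'I_n), cmeasurable (W i j).
Hypothesis hW : forall n (i j : 'I_n) (w : T), W i j w = conjc (W j i w).
Hypothesis indW : forall n, cindependent P [set ij : 'I_n * 'I_n | (ij.1 <= ij.2)%N]%SET
                (fun ij => W ij.1 ij.2).
Hypothesis meanW : forall n (i j : 'I_n), (i <= j)%N ->
     P.-integrable setT (fun w => (complex.Re (W i j w))%:E) /\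
     P.-integrable setT (fun w => (complex.Im (W i j w))%:E) /\
     cmean P (W i j) = 0.
Hypothesis varW : forall n (i j : 'I_n), (i <= j)%N -> (cvar P (W i j) < +oo)%E.
Hypothesis rowW : (fun n : nat => n%:R^-1 * \sum_(i < n)
       `| \sum_(j < n) (fine (cvar P (W i j)) - n%:R^-1) |) @ \oo --> 0.
Hypothesis C0 : 0 <= C.
Hypothesis excessW : (fun n : nat => n%:R^-1 * \sum_(i < n)
       Num.max (\sum_(j < n) fine (cvar P (W i j)) - C) 0) @ \oo --> 0.
Hypothesis lindebergW : forall eps : R, 0 < eps ->
    (fun n : nat => n%:R^-1 * \sum_(i < n) \sum_(j < n)
       fine (\int[P]_w ((cabs (W i j w)) ^+ 2 *
                        (eps < cabs (W i j w))%R%:R)%:E)%E) @ \oo --> 0.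

Let mu n : probability _ R := matrix_law P (@mW n).
Let X n (w : T) := upper_coords (@W n) w.

Section FixedEta.
Variable eta : R.
Hypotheses (eta1 : 1 <= eta) (etaC : C + 1 <= eta).
Let eta0 : 0 < eta. Proof. exact: lt_le_trans eta1. Qed.
(** The positive root of [m0^2 + eta m0 = 1]; by [sc_integral_even] and [sc_integral_odd], [i m0] is
    the semicircle integral of [1 / (x - i eta)]. *)
Let m0 := (Num.sqrt (eta ^+ 2 + 4) - eta) / 2.

Let m00 : 0 <= m0.
Proof.
rewrite divr_ge0// subr_ge0 -[leLHS](gtr0_norm eta0) -sqrtr_sqr ler_wsqrtr//.
by rewrite lerDl.
Qed.

Let m0E : m0 ^+ 2 + eta * m0 = 1.
Proof.
have a2 : Num.sqrt (eta ^+ 2 + 4) ^+ 2 = eta ^+ 2 + 4 by rewrite sqr_sqrtr// addr_ge0// sqr_ge0.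
rewrite /m0; set a := Num.sqrt _ in a2 *.
have -> : ((a - eta) / 2) ^+ 2 + eta * ((a - eta) / 2) = (a ^+ 2 - eta ^+ 2) / 4 by field.
by rewrite a2; field.
Qed.

Let dev n i := Ex (mu n) (fun x => cabs (resolvent eta (hmatrix x) i i - Complex 0 m0) ^+ 2).

Lemma avg_deviation_cvg0 : (fun n => n%:R^-1 * \sum_(i < n) dev i) @ \oo --> 0.
Proof.
apply/cvgrPdist_le => e e0.
(* The bound of [sum_resolvent_deviation] splits into four terms with a budget of [e / 4] each. The
   choice of [eps] settles the first, and [304 = 300 + 4] collects the two occurrences of the
   excess. *)
pose eps := Num.min 1 (e / 4 / (300 * (1 + C))).
have C1 : 0 < 300 * (1 + C) by have := C0; lra.
have eps0 : 0 < eps by rewrite lt_min ltr01 !divr_gt0.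
have eps1 : eps <= 1 by rewrite ge_min lexx.
have epsC : 300 * (eps * (1 + C)) <= e / 4.
  have -> : 300 * (eps * (1 + C)) = eps * (300 * (1 + C)) by ring.
  by rewrite -ler_pdivlMr// ge_min lexx orbT.
have r0 : 0 < e / 8 by rewrite divr_gt0.
have e4 : 0 < e / 4 by rewrite divr_gt0.
have q0 : 0 < e / 4 / 304 by apply: divr_gt0 e4 _; rewrite ltr0n.
have t0 : 0 < e / 4 / 300 by apply: divr_gt0 e4 _; rewrite ltr0n.
have hr := cvg0_near_le rowW r0.
have hq := cvg0_near_le excessW q0.
have ht := cvg0_near_le (lindebergW eps0) t0.
near=> n.
have n0 : (0 < n)%N by near: n; exists 1%N.
have nN : n%:R != 0 :> R by rewrite pnatr_eq0 -lt0n.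
have np : 0 < n%:R :> R by rewrite ltr0n.
pose r := n%:R^-1 * \sum_(i < n) `|\sum_(j < n) entry_var (mu n) i j - 1|.
pose q := n%:R^-1 * \sum_(i < n) Num.max (\sum_(j < n) entry_var (mu n) i j - C) 0.
pose t := n%:R^-1 * \sum_(i < n) \sum_(j < n) entry_tail (mu n) eps i j.
have sv i j := (matrix_law_sqr (@mW n) (@hW n) (@meanW n) (@varW n) i j).2.
have hr' : r <= e / 8.
  have : n%:R^-1 * \sum_(i < n) `| \sum_(j < n) (fine (cvar P (W i j)) - n%:R^-1) | <= e / 8.
    by near: n.
  apply: le_trans.
  rewrite le_eqVlt; apply/orP; left; apply/eqP; congr (_ * _); apply: eq_bigr => i _.
  rewrite sumrB sumr_const card_ord -[n%:R^-1 *+ n]mulr_natl divff//; congr (`|_ - _|).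
  by apply: eq_bigr => j _; rewrite sv.
have hq' : q <= e / 4 / 304.
  have : n%:R^-1 * \sum_(i < n)
       Num.max (\sum_(j < n) fine (cvar P (W i j)) - C) 0 <= e / 4 / 304 by near: n.
  apply: le_trans.
  rewrite le_eqVlt; apply/orP; left; apply/eqP; congr (_ * _); apply: eq_bigr => i _.
  by congr (Num.max (_ - _) _); apply: eq_bigr => j _; rewrite sv.
have ht' : t <= e / 4 / 300.
  have : n%:R^-1 * \sum_(i < n) \sum_(j < n)
       fine (\int[P]_w ((cabs (W i j w)) ^+ 2 *
                        (eps < cabs (W i j w))%R%:R)%:E)%E <= e / 4 / 300 by near: n.
  apply: le_trans.
  rewrite le_eqVlt; apply/orP; left; apply/eqP; congr (_ * _); apply: eq_bigr => i _.
  by apply: eq_bigr => j _; rewrite (matrix_law_tail (@mW n) (@hW n) (@meanW n) (@varW n)).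
have ind : independent_coordinates (mu n) := independent_upper_coords (@mW n) (@indW n).
have key := sum_resolvent_deviation ind eta1 C0 etaC m00 m0E
  (fun i j => (matrix_law_sqr (@mW n) (@hW n) (@meanW n) (@varW n) i j).1)
  (fun i j => (matrix_law_mean (@mW n) (@hW n) (@meanW n) i j).1)
  (fun i j => (matrix_law_mean (@mW n) (@hW n) (@meanW n) i j).2) eps0 eps1.
rewrite sub0r normrN ger0_norm; last first.
  by rewrite mulr_ge0 ?invr_ge0//; apply: sumr_ge0 => i _; apply: Ex_ge0 => x; exact: sqr_ge0.
have ni : 0 <= n%:R^-1 :> R by rewrite invr_ge0.
have := ler_wpM2l ni key.
set Q := \sum_(i < n) Num.max _ _; set TT := \sum_(i < n) \sum_(j < n) _.
set RR := \sum_(i < n) `|_|.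
have -> : n%:R^-1 * (300 * (eps * (1 + C) * n%:R + Q + TT) + 4 * Q + 2 * RR) =
   300 * (eps * (1 + C)) + 304 * (n%:R^-1 * Q) + 300 * (n%:R^-1 * TT) + 2 * (n%:R^-1 * RR).
  by field.
move=> /le_trans; apply; move: hr' hq' ht'; rewrite /r /q /t -/Q -/TT -/RR; lra.
Unshelve. all: by end_near.
Qed.

Definition part (b : bool) (z : R[i]) : R := if b then complex.Re z else complex.Im z.

Let partB b z z' : part b (z - z') = part b z - part b z'.
Proof. by case: b => /=; [exact: cReB|exact: cImB]. Qed.

Let part_le b z : `|part b z| <= cabs z.
Proof. by case: b => /=; [exact: normr_Re|exact: normr_Im]. Qed.

Let mpart b n : measurable_fun setT (fun x => part b (@ntrace R n eta x)).
Proof. by have [m1 m2] := @cmeasurable_ntrace R n eta eta0; case: b. Qed.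

Let ipart b n : intble (mu n) (fun x => part b (ntrace eta x)).
Proof.
apply: (intble_bounded (mu n) (@mpart b n)); exists eta^-1 => x.
by rewrite (le_trans (part_le _ _))// cabs_ntrace.
Qed.

Lemma mean_ntrace_cvg b :
  (fun n => Ex (mu n) (fun x => part b (ntrace eta x))) @ \oo --> part b (Complex 0 m0).
Proof.
apply/cvgrPdist_le => e e0.
have e2 : 0 < e / 2 by rewrite divr_gt0.
have ee : 0 < (e / 2) ^+ 2 by rewrite exprn_gt0.
have h := cvg0_near_le avg_deviation_cvg0 ee.
near=> n.
have n0 : (0 < n)%N by near: n; exists 1%N.
have nN : n%:R != 0 :> R by rewrite pnatr_eq0 -lt0n.
have hn : n%:R^-1 * \sum_(i < n) dev i <= (e / 2) ^+ 2 by near: n.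
have icst := intble_cst (mu n) (part b (Complex 0 m0)).
rewrite distrC -[X in _ - X](Ex_cst (mu n)) -(ExB (ipart b n) icst).
rewrite (le_trans (norm_Ex (intbleB (ipart b n) icst)))//.
have mD (i : 'I_n) : cmeasurable (fun x : #|{: 'I_n * 'I_n}|.-tuple (R * R)%type =>
    resolvent eta (hmatrix x) i i - Complex 0 m0).
  apply: cmeasurableB; [exact: cmeasurable_resolvent_hmatrix|exact: cmeasurable_cst].
have bD (i : 'I_n) (x : #|{: 'I_n * 'I_n}|.-tuple (R * R)%type) :
    cabs (resolvent eta (hmatrix x) i i - Complex 0 m0) <= 1 + `|m0|.
  apply: cabsB_le; first exact: cabs_resolvent_le1.
  by rewrite cabs_imag.
have iD2 (i : 'I_n) : intble (mu n) (fun x => cabs (resolvent eta (hmatrix x) i i - Complex 0 m0) ^+ 2).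
  by have [] := intble_cmeasurable (mu n) (mD i) (bD i).
(* The pointwise inequality [c <= e / 2 + (e / 2)^-1 * c ^+ 2] passes from the first to the second
   moment: a mean square of at most [(e / 2)^2] yields [e]. *)
pose B x := n%:R^-1 * \sum_(i < n)
  (e / 2 + (e / 2)^-1 * cabs (resolvent eta (hmatrix x) i i - Complex 0 m0) ^+ 2).
have iBi (i : 'I_n) := intbleD (intble_cst (mu n) (e / 2)) (intbleZ (e / 2)^-1 (iD2 i)).
have iB : intble (mu n) B by apply: intbleZ; exact: intble_sum.
apply: (@le_trans _ _ (Ex (mu n) B)).
  apply: Ex_le => //; first by apply: intble_norm; exact: intbleB.
  move=> x; rewrite -partB (le_trans (part_le _ _))//.
  have -> : ntrace eta x - Complex 0 m0 = (n%:R^-1 : R[i]) *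
      \sum_(i < n) (resolvent eta (hmatrix x) i i - Complex 0 m0).
    rewrite sumrB sumr_const card_ord /ntrace mulrC mulrBr; congr (_ - _).
    by rewrite -[Complex 0 m0 *+ n]mulr_natl mulrA mulVf ?mul1r// pnatr_eq0 -lt0n.
  rewrite cabsM cabs_natV ler_wpM2l ?invr_ge0// (le_trans (cabs_sum _ _ _))//.
  apply: ler_sum => i _; set c := cabs _.
  have -> : e / 2 + (e / 2)^-1 * c ^+ 2 = ((e / 2) ^+ 2 + c ^+ 2) / (e / 2).
    by field; rewrite gt_eqF.
  by rewrite ler_pdivlMr//; have := sqr_ge0 (c - e / 2); have := cabs_ge0 (resolvent eta (hmatrix x) i i - Complex 0 m0); rewrite -/c; nra.
rewrite (ExZ _ (intble_sum _ iBi)) (Ex_sum _ iBi).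
have -> : \sum_(i < n) Ex (mu n) (fun x => e / 2 + (e / 2)^-1 *
     cabs (resolvent eta (hmatrix x) i i - Complex 0 m0) ^+ 2) =
   n%:R * (e / 2) + (e / 2)^-1 * \sum_(i < n) dev i.
  rewrite (eq_bigr (fun i => e / 2 + (e / 2)^-1 * dev i)); last first.
    by move=> i _; rewrite (ExD (intble_cst _ _) (intbleZ _ (iD2 i))) Ex_cst (ExZ _ (iD2 i)).
  by rewrite big_split/= sumr_const card_ord -[(e / 2) *+ n]mulr_natl -mulr_sumr.
rewrite mulrDr mulKf// mulrCA.
have : (e / 2)^-1 * (n%:R^-1 * \sum_(i < n) dev i) <= (e / 2)^-1 * (e / 2) ^+ 2.
  by rewrite ler_wpM2l// invr_ge0 ltW.
have -> : (e / 2)^-1 * (e / 2) ^+ 2 = e / 2 by field; rewrite gt_eqF.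
lra.
Unshelve. all: by end_near.
Qed.

Lemma ntrace_ae_cvg b :
  {ae P, forall w, (fun n => part b (ntrace eta (X n w))) @ \oo --> part b (Complex 0 m0)}.
Proof.
pose Y n x := (part b (@ntrace R n eta x) - Ex (mu n) (fun x => part b (ntrace eta x))) ^+ 4.
have mY n : measurable_fun setT (Y n).
  by apply: measurable_funX; apply: measurable_funB; [exact: mpart|exact: measurable_cst].
have iY n : intble P (Y n \o X n).
  apply: intble_bounded.
    by apply: (measurableT_comp (mY n)); exact: measurable_upper_coords.
  exists ((eta^-1 + eta^-1) ^+ 4) => w; rewrite /= /Y normrX lerXn2r ?nnegrE ?normr_ge0//.
    by rewrite addr_ge0// invr_ge0 ltW.
  rewrite (le_trans (ler_normB _ _))// lerD//.
    by rewrite (le_trans (part_le _ _))// cabs_ntrace.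
  by apply: Ex_bound => // x; rewrite (le_trans (part_le _ _))// cabs_ntrace.
apply: (@ae_cvg_of_fourth_moment _ _ _ P (fun n w => part b (ntrace eta (X n w)))
  (fun n => Ex (mu n) (fun x => part b (ntrace eta x))) _ (64 / eta ^+ 4)).
- by rewrite divr_ge0// exprn_ge0// ltW.
- exact: iY.
- move=> n n0.
  have ind : independent_coordinates (mu n) := independent_upper_coords (@mW n) (@indW n).
  have := ntrace_fourth_moment ind eta0 n0 (partB b) (part_le b) (@mpart b n).
  by rewrite (Ex_image_law (measurable_upper_coords (@mW n)) (mY n) (iY n)).
- exact: mean_ntrace_cvg.
Qed.

End FixedEta.

Definition spectrum (w : T) n : 'I_n -> R := eigenvalues (\matrix_(i < n, j < n) W i j w).

Lemma inv_real_sub_imag (a eta : R) : 0 < eta -> (Complex a 0 - Complex 0 eta)^-1 =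
  Complex (a / (a ^+ 2 + eta ^+ 2)) (eta / (a ^+ 2 + eta ^+ 2)).
Proof.
move=> eta0; have d0 : a ^+ 2 + eta ^+ 2 != 0 by rewrite gt_eqF// ltr_wpDl ?sqr_ge0// exprn_gt0.
have n0 := real_sub_imag_neq0 eta0 a.
apply: (mulfI n0); rewrite divff//; apply/eqP; rewrite eq_complex /=.
by apply/andP; split; apply/eqP; field.
Qed.

Lemma ntrace_spectrum eta n w : 0 < eta -> ntrace eta (X n w) =
  Complex (empirical (spectrum w) n (fun x => x / (x ^+ 2 + eta ^+ 2)))
    (eta * empirical (spectrum w) n (fun x => (x ^+ 2 + eta ^+ 2)^-1)).
Proof.
move=> eta0.
have hh := hermitian_hmatrix (X n w).
rewrite (hmatrix_upper_coords (@hW n)) in hh.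
rewrite /ntrace (hmatrix_upper_coords (@hW n)) (resolvent_trace_eigenvalues eta0 hh).
have -> : ((n%:R : R[i])^-1) = ((n%:R^-1)%:C)%C by rewrite fmorphV/= rmorph_nat.
apply/eqP; rewrite eq_complex cReM cImM /= !mulr0 subr0 add0r cRe_sum cIm_sum.
rewrite /empirical mulrC; apply/andP; split; apply/eqP.
  by congr (_ * _); apply: eq_bigr => i _; rewrite inv_real_sub_imag.
rewrite mulrCA [LHS]mulrC; congr (_ * _); rewrite mulr_sumr.
by apply: eq_bigr => i _; rewrite inv_real_sub_imag.
Qed.

Lemma esd_cvg_resolvent_ae eta : 1 <= eta -> C + 1 <= eta ->
  {ae P, forall w, esd_cvg (spectrum w) (fun x => (x ^+ 2 + eta ^+ 2)^-1) /\
     esd_cvg (spectrum w) (fun x => x / (x ^+ 2 + eta ^+ 2))}.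
Proof.
move=> eta1 etaC; have eta0 : 0 < eta by lra.
have := ntrace_ae_cvg eta1 etaC false; have := ntrace_ae_cvg eta1 etaC true.
apply: filterS2 => w /= h1 h2; split; split.
- exact: continuous_resolvent_even.
- rewrite sc_integral_even//.
  have -> : (fun n => empirical (spectrum w) n (fun x => (x ^+ 2 + eta ^+ 2)^-1)) =
     (fun n => complex.Im (ntrace eta (X n w)) / eta).
    by apply/funext => n; rewrite ntrace_spectrum//=; field; rewrite gt_eqF.
  by apply: cvgM; [exact: h2|exact: cvg_cst].
- exact: continuous_resolvent_odd.
- rewrite sc_integral_odd//; have -> : (fun n => empirical (spectrum w) n (fun x => x / (x ^+ 2 + eta ^+ 2))) =
     (fun n => complex.Re (ntrace eta (X n w))).
    by apply/funext => n; rewrite ntrace_spectrum.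
  exact: h1.
Qed.

End Convergence.

(** Both 1 and [|x|] are at most [x^2 + eta^2], so changing the parameter from [eta] to [t] moves
    either function by at most [|eta^2 - t^2|], uniformly in [x]. Uniform limits then carry the
    convergence from countably many parameters to all. *)
Lemma esd_cvg_resolvent_dense (R : realType) (lam : forall n, 'I_n -> R) (eta0 : R) : 1 <= eta0 ->
  (forall p q : nat, let eta := eta0 + p%:R / q.+1%:R in
    esd_cvg lam (fun x => (x ^+ 2 + eta ^+ 2)^-1) /\ esd_cvg lam (fun x => x / (x ^+ 2 + eta ^+ 2))) ->
  forall eta, eta0 <= eta ->
    esd_cvg lam (fun x => (x ^+ 2 + eta ^+ 2)^-1) /\ esd_cvg lam (fun x => x / (x ^+ 2 + eta ^+ 2)).
Proof.
move=> eta01 h eta he.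
have near_eta (e : R) : 0 < e -> exists p q : nat, let eta' := eta0 + p%:R / q.+1%:R in
    `|eta ^+ 2 - eta' ^+ 2| <= e.
  move=> e0; have eta_p : 0 < 2 * eta by lra.
  (* [q] makes [1 / (q + 1) <= e / (2 eta)], and [p] is the integer part of [(eta - eta0) (q + 1)];
     the new parameter is below [eta] by at most [e / (2 eta)], and the sum of the two is at most
     [2 eta]. *)
  pose q := Num.trunc ((e / (2 * eta))^-1); pose y : R := q.+1%:R.
  have y0 : 0 < y by rewrite ltr0n.
  pose p := Num.trunc ((eta - eta0) * y); exists p, q => /=; rewrite -/y.
  have a0 : 0 <= (eta - eta0) * y by rewrite mulr_ge0 ?subr_ge0// ltW.
  have /andP[p1 p2] : (p%:R <= (eta - eta0) * y < p.+1%:R) by exact: Num.Theory.truncn_itv.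
  have yq : y^-1 <= e / (2 * eta).
    have ee : 0 < e / (2 * eta) by rewrite divr_gt0.
    by rewrite invf_ple ?posrE//; apply/ltW; exact: Num.Theory.truncnS_gt.
  have l1 : p%:R / y <= eta - eta0 by rewrite ler_pdivrMr.
  have l2 : eta - eta0 <= p%:R / y + y^-1.
    have -> : p%:R / y + y^-1 = (p%:R + 1) / y by rewrite mulrDl mul1r.
    by rewrite ler_pdivlMr// natr1 ltW.
  have p0 : 0 <= p%:R / y by rewrite divr_ge0// ltW.
  move: (p%:R / y) l1 l2 p0 => z l1 l2 p0.
  have -> : eta ^+ 2 - (eta0 + z) ^+ 2 = (eta - (eta0 + z)) * (eta + (eta0 + z)) by ring.
  rewrite ger0_norm; last by apply: mulr_ge0; lra.
  apply: (@le_trans _ _ (e / (2 * eta) * (2 * eta))); last first.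
    by rewrite divfK// gt_eqF.
  move: (e / (2 * eta)) (y^-1) yq l2 => k v yq l2; apply: ler_pM; lra.
have den (t x : R) : 1 <= t -> [/\ 0 < x ^+ 2 + t ^+ 2, 1 <= x ^+ 2 + t ^+ 2 & `|x| <= x ^+ 2 + t ^+ 2].
  move=> t1; have t2 : 1 <= t ^+ 2 by rewrite exprn_ege1.
  have x2 := sqr_ge0 x; split; [lra|lra|].
  have := sqr_ge0 (`|x| - 1); rewrite -[x ^+ 2]real_normK ?num_real//.
  by have := normr_ge0 x; nra.
have eta1 : 1 <= eta by lra.
have bound (c x t : R) : 1 <= t -> `|c| <= x ^+ 2 + eta ^+ 2 ->
    `|c / (x ^+ 2 + eta ^+ 2) - c / (x ^+ 2 + t ^+ 2)| <= `|eta ^+ 2 - t ^+ 2|.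
  move=> t1 hc; have [d0 d1 _] := den _ x eta1; have [f0 f1 _] := den _ x t1.
  have -> : c / (x ^+ 2 + eta ^+ 2) - c / (x ^+ 2 + t ^+ 2) =
     (c / (x ^+ 2 + eta ^+ 2)) * (x ^+ 2 + t ^+ 2)^-1 * - (eta ^+ 2 - t ^+ 2).
    by field; rewrite !gt_eqF.
  rewrite normrM normrN -[leRHS]mul1r ler_wpM2r// normrM !normfV mulr_ile1//.
    by rewrite normrM normfV (gtr0_norm d0) ler_pdivrMr// mul1r.
  by rewrite (gtr0_norm f0) invf_le1.
have pos p q : 1 <= eta0 + p%:R / q.+1%:R.
  by rewrite (le_trans eta01)// lerDl divr_ge0.
split; apply: esd_cvg_uniform_limit.
- by apply: continuous_resolvent_even; lra.
- move=> e /near_eta[p [q /= hpq]]; have [c1 _] := h p q.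
  exists (fun x => (x ^+ 2 + (eta0 + p%:R / q.+1%:R) ^+ 2)^-1); first exact: c1.
  move=> x; rewrite (le_trans _ hpq)//; have := bound 1 x _ (pos p q).
  by rewrite !mul1r; apply; rewrite normr1; have [] := den _ x eta1.
- by apply: continuous_resolvent_odd; lra.
- move=> e /near_eta[p [q /= hpq]]; have [_ c1] := h p q.
  exists (fun x => x / (x ^+ 2 + (eta0 + p%:R / q.+1%:R) ^+ 2)); first exact: c1.
  move=> x; rewrite (le_trans _ hpq)//; apply: bound => //.
  by have [] := den _ x eta1.
Qed.

Theorem theorem1p2 (R : realType) (d : measure_display) (T : measurableType d)
  (P : probability T R) (W : forall n : nat, 'I_n -> 'I_n -> T -> R[i])
  (C : R) :
  (* each W_n is a random Hermitian matrix *)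
  (forall n (i j : 'I_n), cmeasurable (W n i j)) ->
  (forall n (i j : 'I_n) (w : T), W n i j w = conjc (W n j i w)) ->
  (* upper triangular entries jointly independent *)
  (forall n, cindependent P [set ij : 'I_n * 'I_n | (ij.1 <= ij.2)%N]
                (fun ij => W n ij.1 ij.2)) ->
  (* mean zero *)
  (forall n (i j : 'I_n), (i <= j)%N ->
     P.-integrable setT (fun w => (complex.Re (W n i j w))%:E) /\
     P.-integrable setT (fun w => (complex.Im (W n i j w))%:E) /\
     cmean P (W n i j) = 0) ->
  (* finite variances *)
  (forall n (i j : 'I_n), (i <= j)%N -> (cvar P (W n i j) < +oo)%E) ->
  (fun n : nat => n%:R^-1 * \sum_(i < n)
       `| \sum_(j < n) (fine (cvar P (W n i j)) - n%:R^-1) |) @ \oo --> 0 ->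
  0 <= C ->
  (fun n : nat => n%:R^-1 * \sum_(i < n)
       Num.max (\sum_(j < n) fine (cvar P (W n i j)) - C) 0) @ \oo --> 0 ->
  (forall eps : R, 0 < eps ->
    (fun n : nat => n%:R^-1 * \sum_(i < n) \sum_(j < n)
       fine (\int[P]_w ((cabs (W n i j w)) ^+ 2 *
                        (eps < cabs (W n i j w))%R%:R)%:E)%E) @ \oo --> 0) ->
  {ae P, forall w, esd_weakly_to_sc (fun n => \matrix_(i, j) W n i j w)}.
Proof.
move=> mW hW indW meanW varW rowW C0 excessW lindebergW.
(* A countable intersection of almost sure events; afterwards [w] is fixed and the argument is
   deterministic. *)
have : {ae P, forall w, forall p q : nat, let eta := (C + 1) + p%:R / q.+1%:R in
    esd_cvg (spectrum W w) (fun x => (x ^+ 2 + eta ^+ 2)^-1) /\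
    esd_cvg (spectrum W w) (fun x => x / (x ^+ 2 + eta ^+ 2))}.
  apply: ae_foralln => p; apply: ae_foralln => q.
  have pq : 0 <= (p%:R / q.+1%:R : R) by [].
  apply: (esd_cvg_resolvent_ae mW hW indW meanW varW rowW C0 excessW lindebergW).
    by rewrite addrAC -[leLHS]add0r lerD2r addr_ge0.
  by rewrite lerDl.
apply: filterS => w h f cf bf; have C1 : 1 <= C + 1 by lra.
by have [_] := weak_convergence_criterion C1 (esd_cvg_resolvent_dense C1 h) cf bf.
Qed.
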